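(* Let $n\ge 2$, let $f:J\to\mathbb{R}^{n+1}$ be a regular curve with speed $\nu$ and Frenet apparatus $\{\kappa_1,\dots,\kappa_n,V_1,\dots,V_{n+1}\}$, let $I=[a,b]\subset J$, and let $R>0$ be constant. Put $\Omega_I=\{(X,t):\ X\in\mathbb{R}^n,\ \|X\|\le R,\ t\in I\}$ and $$G(x_1,\dots,x_n,t)=f(t)+\sum_{j=1}^n x_jV_{j+1}(t),$$ and suppose that, in some neighborhood of $\Omega_I$, $G$ is injective and $\nu(t)(1-x_1\kappa_1(t))>0$. Let $\partial_l\Gamma=\{G(R\,X,t):\ X\in\mathbb{S}^{n-1},\ t\in I\}$ be the lateral hypersurface (sphere tube of constant radius $R$) of the disk tube $\Gamma=G(\Omega_I)$. Then $$\mathrm{vol}(\partial_l\Gamma)=\mathrm{vol}(\mathbb{S}^{n-1}(R))\,l(f,I),$$ where $\mathbb{S}^{n-1}(R)\subset\mathbb{R}^n$ is the sphere of radius $R$ centered at the origin and $l(f,I)=\int_a^b\nu(t)\,dt$.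
   Context: Curves are smooth maps on an interval $J$; $\nu=\|f'\|>0$. The Frenet apparatus of $f:J\to\mathbb{R}^{n+1}$ consists of an orthonormal frame field $V_1,\dots,V_{n+1}$ along $f$ with $V_1=f'/\nu$ and curvature functions $\kappa_1,\dots,\kappa_n$ satisfying the Frenet equations $V_1'=\kappa_1\nu V_2$, $V_j'=-\kappa_{j-1}\nu V_{j-1}+\kappa_j\nu V_{j+1}$ ($2\le j\le n$), $V_{n+1}'=-\kappa_n\nu V_n$. If $f$ is $n$-regular (i.e. $f',\dots,f^{(n)}$ are linearly independent everywhere) it is the usual one: the frame is positively oriented, $\mathrm{span}\{V_1,\dots,V_j\}=\mathrm{span}\{f',\dots,f^{(j)}\}$ for $j\le n$ and $\kappa_j>0$ for $j<n$. For suitable curves lying in an affine subspace of dimension $m<n+1$ (including straight lines) the apparatus is the one inside this subspace, completed by a constant orthonormal basis $V_{m+1},\dots,V_{n+1}$ of the orthogonal complement and $\kappa_m=\dots=\kappa_n=0$. $\mathrm{vol}(\partial_l\Gamma)$ is the $n$-dimensional hypersurface volume in $\mathbb{R}^{n+1}$ and $\mathrm{vol}(\mathbb{S}^{n-1}(R))$ is the $(n-1)$-dimensional volume. $\mathbb{S}^{n-1}$ is the unit sphere of $\mathbb{R}^n$. *)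

(* Defs.v *)
From HB Require Import structures.
From mathcomp Require Import all_boot all_order all_algebra.
From mathcomp Require Import all_classical all_reals all_analysis.

Set Implicit Arguments.
Unset Strict Implicit.
Unset Printing Implicit Defensive.

Import Order.TTheory GRing.Theory Num.Theory.
Import numFieldNormedType.Exports.

Local Open Scope classical_set_scope.
Local Open Scope ring_scope.

Section Euclidean.
Context {R : realType} {m : nat}.

Definition dot (u v : 'rV[R]_m) : R := \sum_(i < m) u 0 i * v 0 i.

(* The library norm `|u| of a row vector is the sup norm. *)
Definition enorm (u : 'rV[R]_m) : R := Num.sqrt (dot u u).

Definition sphere (r : R) : set 'rV[R]_m := [set X | enorm X = r].

End Euclidean.

Section Volume.
Context {R : realType} {m : nat}.

(* The point 0 makes the diameter of the empty set 0 rather than -oo. *)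
Definition ediam (A : set 'rV[R]_m) : \bar R :=
  ereal_sup (0%E |` [set d | exists x y, [/\ A x, A y & d = (enorm (x - y))%:E]]).

Definition hausdorff_content (k : nat) (delta : R) (A : set 'rV[R]_m) : \bar R :=
  ereal_inf [set (\sum_(0 <= i <oo) ediam (U i) ^+ k)%E | U in
    [set U : nat -> set 'rV[R]_m |
      (forall i, (ediam (U i) <= delta%:E)%E) /\ A `<=` \bigcup_i U i]].

Definition hausdorff (k : nat) (A : set 'rV[R]_m) : \bar R :=
  ereal_sup [set hausdorff_content k delta A | delta in [set delta : R | 0 < delta]].

End Volume.

Definition unit_cube {R : realType} (k : nat) : set 'rV[R]_k :=
  [set x | forall i, 0 <= x 0 i <= 1].

(* k-dimensional volume (k > 0) of subsets of R^m: the k-dimensional Hausdorff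
   measure with its constant fixed by giving the unit cube of R^k volume 1,
   i.e. so that it is Lebesgue measure when m = k. *)
Definition vol {R : realType} {m : nat} (k : nat) (A : set 'rV[R]_m) : \bar R :=
  (hausdorff k A / hausdorff k (@unit_cube R k))%E.

Section Curves.
Context {R : realType} {m : nat}.

(* Smoothness on an interval that may contain its endpoints: smoothness on
   some open set containing it. *)
Definition smooth_on (J : set R) (g : R -> 'rV[R]_m) : Prop :=
  exists O : set R, [/\ open O, J `<=` O &
    forall (k : nat) (t : R), O t -> derivable (derive1n k g) t 1].

Definition speed (f : R -> 'rV[R]_m) (t : R) : R := enorm (derive1 f t).

Definition k_regular (k : nat) (J : set R) (f : R -> 'rV[R]_m) : Prop :=
  forall t, J t -> row_free (\matrix_(i < k) derive1n i.+1 f t).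

Definition arc_length (f : R -> 'rV[R]_m) (a b : R) : \bar R :=
  \int[lebesgue_measure]_(t in `[a, b]) (speed f t)%:E.

End Curves.

(* The families are indexed from 1: only V 1, ..., V n.+1 and
   kappa 1, ..., kappa n are meaningful, and only on J. *)
Record frenet_apparatus {R : realType} (n : nat) (J : set R)
    (f : R -> 'rV[R]_n.+1) (kappa : nat -> R -> R)
    (V : nat -> R -> 'rV[R]_n.+1) : Prop := FrenetApparatus {
  frenet_smooth : forall j, (1 <= j <= n.+1)%N -> smooth_on J (V j);
  frenet_orthonormal : forall i j t, (1 <= i <= n.+1)%N -> (1 <= j <= n.+1)%N ->
    J t -> dot (V i t) (V j t) = (i == j)%:R;
  frenet_tangent : forall t, J t -> V 1%N t = (speed f t)^-1 *: derive1 f t;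
  frenet_first : forall t, J t ->
    derive1 (V 1%N) t = (kappa 1%N t * speed f t) *: V 2%N t;
  frenet_middle : forall j t, (2 <= j <= n)%N -> J t ->
    derive1 (V j) t = - (kappa j.-1 t * speed f t) *: V j.-1 t
                  + (kappa j t * speed f t) *: V j.+1 t;
  frenet_last : forall t, J t ->
    derive1 (V n.+1) t = - (kappa n t * speed f t) *: V n t;
  (* For an n-regular curve it is the classical apparatus. Otherwise any frame
     as above is admitted, in particular the apparatus inside an affine
     subspace completed by constant vectors and zero curvatures. *)
  frenet_regular : k_regular n J f -> forall t, J t ->
    [/\ 0 < \det (\matrix_(i < n.+1) V i.+1 t),
        forall j, (1 <= j <= n)%N ->
          (\matrix_(i < j) V i.+1 t == \matrix_(i < j) derive1n i.+1 f t)%MS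
      & forall j, (1 <= j < n)%N -> 0 < kappa j t]
}.

Section Tube.
Context {R : realType} {n : nat}.

(* G(x_1, ..., x_n, t); the coordinate x_j is x 0 (j - 1). *)
Definition tube_map (f : R -> 'rV[R]_n.+1) (V : nat -> R -> 'rV[R]_n.+1)
    (x : 'rV[R]_n) (t : R) : 'rV[R]_n.+1 :=
  f t + \sum_(j < n) x 0 j *: V j.+2 t.

Definition tube_domain (r a b : R) : set ('rV[R]_n * R) :=
  [set p | enorm p.1 <= r /\ a <= p.2 <= b].

Definition tube_lateral (f : R -> 'rV[R]_n.+1) (V : nat -> R -> 'rV[R]_n.+1)
    (r a b : R) : set 'rV[R]_n.+1 :=
  [set tube_map f V (r *: p.1) p.2 | p in
    [set p : 'rV[R]_n * R | sphere 1 p.1 /\ a <= p.2 <= b]].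

End Tube.

(* Main.v *)
Require Import Defs.
From HB Require Import structures.
From mathcomp Require Import all_boot all_order all_algebra.
From mathcomp Require Import all_classical all_reals all_analysis.
From mathcomp Require Import measurable_realfun ring lra.
Set Implicit Arguments.
Unset Strict Implicit.
Unset Printing Implicit Defensive.
Import Order.TTheory GRing.Theory Num.Theory.
Import numFieldNormedType.Exports.
Local Open Scope classical_set_scope.
Local Open Scope ring_scope.

(** Why the formula holds. A point of the tube is the value at [(X, t)] of
[tube f W], where [X] runs over the sphere of radius [r] and [W] is the moving normal
frame. When [t] varies, this point moves with a component
[c = nu * (1 - X_1 * kappa_1)] along the curve and with a normal component that is
orthogonal to [X], because the Frenet matrix is skew-symmetric ([frenet_products]).
Hence the area element of the tube is [c] times the area element of the sphere times
[dt]. The curvature term is odd in [X_1] and integrates to 0 over the sphere, which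
leaves the volume of the sphere times the length of the curve.

The volumes are Hausdorff measures, so that the area formula has to be derived for
them. Three facts carry the proof.

Flat models. Hausdorff measures are additive on sets at a positive distance
([hausdorff_separated]); hence every sublevel set of a coordinate is measurable
([measurable_sublevel]), and dyadic tiles cut any set into pieces with additive
measures. Since all tiles of a given size are translates of each other, a
translation-invariant measure is unique up to a factor ([homogeneous_unique]). The
measure of the unit cube, which is positive and finite ([hausdorff_cube_gt0],
[hausdorff_cube_fin]), serves as the unit. Uniqueness gives the invariance under shears
([hausdorff_shear_cube]), the measure of prisms ([hausdorff_prism]), and then Cavalieri's
principle: the set swept out by a base that moves with constant velocity has the measure
of the base times the height ([swept_measure]). It is here that the measures in two
consecutive dimensions, each with its own normalization, are related.

Localization. For a factor [lam > 1], a small piece of the sphere is [lam]-bi-Lipschitz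
to its projection to a tangent hyperplane, and the part of the tube over this piece and
a short time interval is [lam]-bi-Lipschitz to an oblique cylinder over the projection,
of height [c] times the duration ([tube_local_model]). Lipschitz maps change Hausdorff
measures by a power of the factor ([hausdorff_lipschitz]), so that the area element is
the expected one up to powers of [lam] ([tube_piece_measure]).

Summation. The tube map is injective on a compact set; hence the parts of the tube over
distinct tiles of the sphere, or over distinct time intervals, have additive measures
([tube_separated]). The integral of [c] over the sphere is avoided: reversing the
principal normal yields a second frame for the same tube, with the tangential component
[nu * (1 + X_1 * kappa_1)]. The two components have the sum [2 * nu], so that adding the
estimates for both frames leaves only the measure of the sphere ([tube_time_slice]).
Concatenating short intervals and letting [lam] tend to 1 gives the formula
([tube_volume]). The hypothesis that [c] is positive is used at the points of the sphere
on the first axis, where it bounds [r * kappa_1] in absolute value by 1; compactness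
makes the components positive uniformly. *)

(** * Euclidean geometry of row vectors *)

Lemma ler_sum_ord_const {R : numDomainType} m (F : 'I_m -> R) (M : R) :
  (forall i, F i <= M) -> \sum_i F i <= m%:R * M.
Proof.
move=> FM; apply: (@le_trans _ _ (\sum_(i < m) M)); first exact: ler_sum.
by rewrite sumr_const card_ord mulr_natl.
Qed.

Section EuclideanLemmas.
Context {R : realType} {m : nat}.
Implicit Types u v w x y : 'rV[R]_m.

Lemma dotC u v : dot u v = dot v u.
Proof. by apply: eq_bigr => i _; rewrite mulrC. Qed.

Lemma dotDl u v w : dot (u + v) w = dot u w + dot v w.
Proof. by rewrite -big_split; apply: eq_bigr => i _; rewrite mxE mulrDl. Qed.

Lemma dotZl a u v : dot (a *: u) v = a * dot u v.
Proof. by rewrite mulr_sumr; apply: eq_bigr => i _; rewrite mxE mulrA. Qed.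

Lemma dotNl u v : dot (- u) v = - dot u v.
Proof. by rewrite -scaleN1r dotZl mulN1r. Qed.

Lemma dotBl u v w : dot (u - v) w = dot u w - dot v w.
Proof. by rewrite dotDl dotNl. Qed.

Lemma dotDr u v w : dot w (u + v) = dot w u + dot w v.
Proof. by rewrite dotC dotDl !(dotC w). Qed.

Lemma dotZr a u v : dot v (a *: u) = a * dot v u.
Proof. by rewrite dotC dotZl (dotC v). Qed.

Lemma dotBr u v w : dot w (u - v) = dot w u - dot w v.
Proof. by rewrite dotC dotBl !(dotC w). Qed.

Lemma dot_suml (I : Type) (s : seq I) (P : pred I) (F : I -> 'rV[R]_m) u :
  dot (\sum_(i <- s | P i) F i) u = \sum_(i <- s | P i) dot (F i) u.
Proof.
elim/big_rec2: _ => [|i y1 y2 _ <-]; last by rewrite dotDl.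
by rewrite /dot big1 // => i _; rewrite mxE mul0r.
Qed.

Lemma dot_sumr (I : Type) (s : seq I) (P : pred I) (F : I -> 'rV[R]_m) u :
  dot u (\sum_(i <- s | P i) F i) = \sum_(i <- s | P i) dot u (F i).
Proof. by rewrite dotC dot_suml; apply: eq_bigr => i _; rewrite dotC. Qed.

Lemma dot_ge0 u : 0 <= dot u u.
Proof. by apply: sumr_ge0 => i _; rewrite -expr2 sqr_ge0. Qed.

Lemma enorm_ge0 u : 0 <= enorm u.
Proof. exact: sqrtr_ge0. Qed.

Lemma sqr_enorm u : enorm u ^+ 2 = dot u u.
Proof. by rewrite sqr_sqrtr // dot_ge0. Qed.

Lemma enorm0 : enorm (0 : 'rV[R]_m) = 0.
Proof. by rewrite /enorm -(scale0r 0) dotZl mul0r sqrtr0. Qed.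

Lemma enormZ a u : enorm (a *: u) = `|a| * enorm u.
Proof. by rewrite /enorm dotZl dotZr mulrA -expr2 sqrtrM ?sqr_ge0 // sqrtr_sqr. Qed.

Lemma enormN u : enorm (- u) = enorm u.
Proof. by rewrite -scaleN1r enormZ normrN1 mul1r. Qed.

Lemma enormC u v : enorm (u - v) = enorm (v - u).
Proof. by rewrite -enormN opprB. Qed.

Lemma ler_coord_enorm u i : `|u 0 i| <= enorm u.
Proof.
rewrite -(@ler_pXn2r _ 2) ?nnegrE ?enorm_ge0 // sqr_enorm /dot (bigD1 i) //=.
by rewrite real_normK ?num_real // expr2 lerDl sumr_ge0 // => j _; rewrite -expr2 sqr_ge0.
Qed.

Lemma enorm_eq0 u : enorm u = 0 -> u = 0.
Proof.
move=> u0; apply/rowP => i; rewrite mxE; apply/eqP.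
by rewrite -normr_le0 -u0 ler_coord_enorm.
Qed.

(** The vector [dot v v *: u - dot u v *: v] has a nonnegative square. *)
Lemma cauchy_schwarz u v : `|dot u v| <= enorm u * enorm v.
Proof.
rewrite -(@ler_pXn2r _ 2) ?nnegrE ?mulr_ge0 ?enorm_ge0 // exprMn !sqr_enorm.
rewrite real_normK ?num_real //.
have [v0|v_neq0] := eqVneq (enorm v) 0.
  by rewrite (enorm_eq0 v0) -(scale0r 0) dotZr dotZl !mul0r mulr0 expr0n.
have v_gt0 : 0 < dot v v by rewrite -sqr_enorm exprn_even_gt0.
have := dot_ge0 (dot v v *: u - dot u v *: v).
rewrite !dotBl !dotBr !dotZl !dotZr (dotC v u).
set p := dot u u; set q := dot v v; set s := dot u v => h.
have : 0 <= q * (p * q - s ^+ 2) by nra.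
by rewrite pmulr_rge0 // subr_ge0.
Qed.

Lemma ler_enormD u v : enorm (u + v) <= enorm u + enorm v.
Proof.
rewrite -(@ler_pXn2r _ 2) ?nnegrE ?addr_ge0 ?enorm_ge0 // sqrrD !sqr_enorm.
rewrite !dotDl !dotDr (dotC v u).
have := le_trans (ler_norm _) (cauchy_schwarz u v); lra.
Qed.

Lemma ler_enormB u v : enorm (u - v) <= enorm u + enorm v.
Proof. by rewrite -(enormN v) ler_enormD. Qed.

Lemma ler_enorm_dist u v : enorm u - enorm v <= enorm (u - v).
Proof. by rewrite lerBlDr -{1}(subrK v u) ler_enormD. Qed.

Lemma ler_enorm_sum (I : Type) (s : seq I) (P : pred I) (F : I -> 'rV[R]_m) :
  enorm (\sum_(i <- s | P i) F i) <= \sum_(i <- s | P i) enorm (F i).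
Proof.
elim/big_ind2: _ => [|x1 x2 y1 y2 h1 h2|//]; first by rewrite enorm0.
by rewrite (le_trans (ler_enormD _ _)) // lerD.
Qed.

Lemma ler_enorm_coords u : enorm u <= \sum_i `|u 0 i|.
Proof.
have uE : u = \sum_i u 0 i *: delta_mx 0 i by rewrite {1}(row_sum_delta u).
rewrite {1}uE (le_trans (ler_enorm_sum _ _ _)) // ler_sum // => i _.
rewrite enormZ -[leRHS]mulr1 ler_wpM2l // /enorm /dot (bigD1 i) //= mxE !eqxx mulr1.
rewrite big1 ?addr0 ?sqrtr1 // => j ji; rewrite mxE (negbTE ji) andbF mul0r //.
Qed.

End EuclideanLemmas.

(** * Hausdorff measures *)

Section Hausdorff.
Local Open Scope ereal_scope.
Context {R : realType}.

Lemma ediam_ge0 m (A : set 'rV[R]_m) : 0 <= ediam A.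
Proof. by apply: ereal_sup_ubound; left. Qed.

Lemma ediam_ub m (A : set 'rV[R]_m) x y : A x -> A y -> (enorm (x - y))%:E <= ediam A.
Proof. by move=> Ax Ay; apply: ereal_sup_ubound; right; exists x, y. Qed.

Lemma ediam_le m (A : set 'rV[R]_m) (d : \bar R) : 0 <= d ->
  (forall x y, A x -> A y -> (enorm (x - y))%:E <= d) -> ediam A <= d.
Proof.
move=> d0 dA; apply: ge_ereal_sup => _ [->//|[x [y [Ax Ay ->]]]]; exact: dA.
Qed.

Lemma ediam0 m : ediam (set0 : set 'rV[R]_m) = 0.
Proof. by apply/eqP; rewrite eq_le ediam_ge0 andbT ediam_le. Qed.

Lemma le_ediam m (A B : set 'rV[R]_m) : A `<=` B -> ediam A <= ediam B.
Proof.
by move=> AB; apply: ediam_le (ediam_ge0 _) _ => x y /AB Bx /AB By; exact: ediam_ub.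
Qed.

Lemma lee_pXn2 (x y : \bar R) k : 0 <= x -> x <= y -> x ^+ k <= y ^+ k.
Proof.
move=> x0 xy; elim: k => [//|k ih]; rewrite !expeS.
by apply: lee_pmul => //; rewrite expe_ge0.
Qed.

Lemma content_ge0 m k d (A : set 'rV[R]_m) : 0 <= hausdorff_content k d A.
Proof.
apply: le_ereal_inf_tmp => _ [U _ <-].
by apply: nneseries_ge0 => i _ _; rewrite expe_ge0 // ediam_ge0.
Qed.

Lemma content_le m k d (A : set 'rV[R]_m) (U : nat -> set 'rV[R]_m) :
  (forall i, ediam (U i) <= d%:E) -> A `<=` \bigcup_i U i ->
  hausdorff_content k d A <= \sum_(0 <= i <oo) ediam (U i) ^+ k.
Proof. by move=> dU AU; apply: ereal_inf_lbound; exists U. Qed.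

Lemma content_le_hausdorff m k d (A : set 'rV[R]_m) : (0 < d)%R ->
  hausdorff_content k d A <= hausdorff k A.
Proof. by move=> d0; apply: ereal_sup_ubound; exists d. Qed.

Lemma hausdorff_le m k (A : set 'rV[R]_m) x :
  (forall d, (0 < d)%R -> hausdorff_content k d A <= x) -> hausdorff k A <= x.
Proof. by move=> h; apply: ge_ereal_sup => _ [d d0 <-]; exact: h. Qed.

Lemma hausdorff_ge0 m k (A : set 'rV[R]_m) : 0 <= hausdorff k A.
Proof. exact: le_trans (content_ge0 k 1 A) (content_le_hausdorff _ _ _). Qed.

Lemma le_hausdorff m k (A B : set 'rV[R]_m) : A `<=` B ->
  hausdorff k A <= hausdorff k B.
Proof.
move=> AB; apply: hausdorff_le => d d0.
apply: le_trans (content_le_hausdorff _ _ d0).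
apply: le_ereal_inf_tmp => _ [U [dU BU] <-]; apply: content_le => //.
exact: subset_trans BU.
Qed.

Lemma hausdorff0 m k : hausdorff k.+1 (set0 : set 'rV[R]_m) = 0.
Proof.
apply/eqP; rewrite eq_le hausdorff_ge0 andbT; apply: hausdorff_le => d d0.
have := @content_le m k.+1 d set0 (fun=> set0).
rewrite eseries0 => [|i _ _]; last by rewrite ediam0 expeS mul0e.
by apply => // i; rewrite ediam0 lee_fin ltW.
Qed.

Lemma content_approx m k d (A : set 'rV[R]_m) (e : R) : (0 < e)%R ->
  hausdorff_content k d A < +oo ->
  exists U : nat -> set 'rV[R]_m, [/\ forall i, ediam (U i) <= d%:E, A `<=` \bigcup_i U i
    & \sum_(0 <= i <oo) ediam (U i) ^+ k <= hausdorff_content k d A + e%:E].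
Proof.
move=> e0 fin.
have finA : hausdorff_content k d A \is a fin_num.
  by rewrite ge0_fin_numE // content_ge0.
have [_ [U [dU AU] <-] lt] := lb_ereal_inf_adherent e0 finA.
by exists U; split => //; exact: ltW.
Qed.

(** An enumeration of pairs turns a countable union of countable covers into one
countable cover, without changing the sum. *)
Lemma pair_enumeration : exists f : nat -> nat * nat, (forall p, exists n, f n = p) /\
  forall g : nat * nat -> \bar R, (forall p, 0 <= g p) ->
    \sum_(n <oo) g (f n) = \sum_(i <oo) \sum_(j <oo) g (i, j).
Proof.
have /card_esym/ppcard_eqP[f] := card_nat2.
exists f; split=> [p|g g0]; first by exists (f^-1%FUN p); rewrite invK ?inE.
transitivity (\esum_(i in setT) g i).
  rewrite -(esum_pred_image g f xpredT) ?[fun=> _]set_true//.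
  by rewrite image_eq.
pose J : nat -> set (nat * nat) := fun i => [set (i, j) | j in setT].
rewrite (_ : setT = \bigcup_k J k); last first.
  by rewrite predeqE => -[a b]; split => // _; exists a => //; exists b.
rewrite esum_bigcupT //=; last first.
  apply/trivIsetP => i j _ _ ij.
  rewrite predeqE => -[n m] /=; split => //= -[] [_] _ [<-{n} _].
  by move=> [m' _] [] /esym/eqP; rewrite (negbTE ij).
rewrite -(image_id [set: nat]) -fun_true esum_pred_image//; last first.
  by move=> n _; exact: esum_ge0.
apply: eq_eseriesr => /= j _.
rewrite -(esum_pred_image g (pair j) predT)//=; last first.
  by move=> ? ? _ _; exact: (@can_inj _ _ _ snd).
by congr esum; rewrite predeqE => -[a b]; split; move=> [i _ <-]; exists i.
Qed.

Lemma hausdorff_sigma_subadditive m k : sigma_subadditive (@hausdorff R m k).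
Proof.
move=> F; apply: hausdorff_le => d d0.
have [->|fin] := eqVneq (\sum_(i <oo) hausdorff k (F i)) +oo; first by rewrite leey.
have finF i : hausdorff_content k d (F i) < +oo.
  apply: le_lt_trans (content_le_hausdorff _ _ d0) _.
  rewrite ltey; apply: contra fin => /eqP Fi; apply/eqP.
  by apply: nneseries_pinfty Fi => // j _; exact: hausdorff_ge0.
apply/lee_addgt0Pr => e e0.
have e2 i : (0 < e / (2 ^ i.+1)%:R)%R by rewrite divr_gt0 // ltr0n expn_gt0.
have /choice [U UP] : forall i, exists V : nat -> set 'rV[R]_m,
    [/\ forall j, ediam (V j) <= d%:E, F i `<=` \bigcup_j V j
    & \sum_(0 <= j <oo) ediam (V j) ^+ k
        <= hausdorff_content k d (F i) + (e / (2 ^ i.+1)%:R)%:E].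
  by move=> i; apply: content_approx.
have [f [fsurj fsum]] := pair_enumeration.
apply: (@le_trans _ _ (\sum_(n <oo) ediam (U (f n).1 (f n).2) ^+ k)).
  apply: content_le => [n|x [i _ Fix]].
    by have [+ _ _] := UP (f n).1; apply.
  have [_ /(_ x Fix) [j _ Uijx] _] := UP i.
  by have [n fn] := fsurj (i, j); exists n => //; rewrite fn.
rewrite (fsum (fun p => ediam (U p.1 p.2) ^+ k)) => [|p]; last first.
  by rewrite expe_ge0 // ediam_ge0.
apply: le_trans (epsilon_trick _ _ (ltW e0)); last by move=> n; exact: hausdorff_ge0.
apply: lee_nneseries => [i _ _|i _].
  by apply: nneseries_ge0 => j _ _; rewrite expe_ge0 // ediam_ge0.
by have [_ _ /le_trans] := UP i; apply; rewrite leeD2r // content_le_hausdorff.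
Qed.

(** A set of diameter less than [d] cannot meet both [A] and [B], so that a cover
of the union by small sets splits into a cover of [A] and a cover of [B]. *)
Lemma hausdorff_separated m k (A B : set 'rV[R]_m) (d : R) : (0 < d)%R ->
  (forall x y, A x -> B y -> d <= enorm (x - y))%R ->
  hausdorff k.+1 A + hausdorff k.+1 B <= hausdorff k.+1 (A `|` B).
Proof.
move=> d0 AB; apply/lee_addgt0Pr => e e0.
have [->|fin] := eqVneq (hausdorff k.+1 (A `|` B)) +oo; first by rewrite addye ?leey.
have main t : (0 < t)%R -> hausdorff_content k.+1 t A + hausdorff_content k.+1 t B
    <= hausdorff k.+1 (A `|` B) + e%:E.
  move=> t0; pose s := (Num.min t (d / 2))%R.
  have s0 : (0 < s)%R by rewrite lt_min t0 divr_gt0.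
  have st : (s <= t)%R by rewrite ge_min lexx.
  have sd : (s < d)%R by rewrite gt_min; apply/orP; right; rewrite ltr_pdivrMr // ltr_pMr // ltr1n.
  have fin' : hausdorff_content k.+1 s (A `|` B) < +oo.
    by apply: le_lt_trans (content_le_hausdorff _ _ s0) _; rewrite ltey.
  have [U [sU ABU Ule]] := content_approx e0 fin'.
  apply: le_trans (leeD2r _ (content_le_hausdorff k.+1 (A `|` B) s0)).
  apply: le_trans Ule.
  pose V C i := U i `&` C.
  have VE C : C `<=` A `|` B -> hausdorff_content k.+1 t C <=
      \sum_(0 <= i <oo) ediam (V C i) ^+ k.+1.
    move=> CAB; apply: content_le => [i|x Cx].
      apply: le_trans (_ : s%:E <= _); last by rewrite lee_fin.
      by apply: le_trans (sU i); apply: le_ediam => x [].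
    by have [i _ Uix] := ABU x (CAB x Cx); exists i.
  have := leeD (VE A (@subsetUl _ A B)) (VE B (@subsetUr _ A B)).
  rewrite -nneseriesD => [| i _ _|i _ _]; rewrite ?expe_ge0 ?ediam_ge0 //.
  move/le_trans; apply; apply: lee_nneseries => [i _ _|i _].
    by rewrite adde_ge0 ?expe_ge0 ?ediam_ge0.
  have [[x [Ux Ax]]|nA] := pselect (exists x, U i x /\ A x); last first.
    rewrite (_ : V A i = set0) ?ediam0 ?expeS ?mul0e ?add0e -?expeS; last first.
      by apply/seteqP; split => // x [Ux Ax]; case: nA; exists x.
    by apply: lee_pXn2 (ediam_ge0 _) _; apply: le_ediam => y [].
  rewrite (_ : V B i = set0) ?ediam0 ?[X in _ + X]expeS ?mul0e ?adde0; last first.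
    apply/seteqP; split => // y [Uy By].
    have := le_trans (ediam_ub Ux Uy) (sU i); rewrite lee_fin => h.
    by have := lt_le_trans sd (AB _ _ Ax By); rewrite ltNge h.
  by apply: lee_pXn2 (ediam_ge0 _) _; apply: le_ediam => y [].
have finAB : hausdorff k.+1 (A `|` B) + e%:E \is a fin_num.
  by rewrite fin_numD ge0_fin_numE ?hausdorff_ge0 // ltey fin.
have anti (C : set 'rV[R]_m) (s t : R) : (0 < s)%R -> (s <= t)%R ->
    hausdorff_content k.+1 t C <= hausdorff_content k.+1 s C.
  move=> s0 st; apply: le_ereal_inf_tmp => _ [U [sU CU] <-].
  by apply: content_le => // i; rewrite (le_trans (sU i)) // lee_fin.
(* the contents grow as the mesh decreases, so that the two meshes in the sum may
   be chosen independently *)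
have two (s t : R) : (0 < s)%R -> (0 < t)%R ->
    hausdorff_content k.+1 s A + hausdorff_content k.+1 t B
    <= hausdorff k.+1 (A `|` B) + e%:E.
  move=> s0 t0; have u0 : (0 < Num.min s t :> R)%R by rewrite lt_min s0.
  apply: le_trans (main _ u0); apply: leeD; apply: anti => //.
    by rewrite ge_min lexx.
  by rewrite ge_min lexx orbT.
have finB (t : R) : (0 < t)%R -> hausdorff_content k.+1 t B \is a fin_num.
  move=> t0; rewrite ge0_fin_numE ?content_ge0 //.
  apply: le_lt_trans (content_le_hausdorff _ _ t0) _.
  by apply: le_lt_trans (le_hausdorff _ (@subsetUr _ A B)) _; rewrite ltey.
have finA : hausdorff k.+1 A \is a fin_num.
  rewrite ge0_fin_numE ?hausdorff_ge0 //.
  by apply: le_lt_trans (le_hausdorff _ (@subsetUl _ A B)) _; rewrite ltey.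
rewrite addeC -leeBrDr //; apply: hausdorff_le => t t0; rewrite leeBrDr // addeC.
rewrite -leeBrDr ?finB //; apply: hausdorff_le => s s0; rewrite leeBrDr ?finB //.
exact: two.
Qed.

(** The image of a cover under an [L]-Lipschitz map is a cover with diameters at
most [L] times larger. *)
Lemma hausdorff_lipschitz m p k (A : set 'rV[R]_m) (B : set 'rV[R]_p)
    (F : 'rV[R]_m -> 'rV[R]_p) (L : R) : (0 < L)%R ->
  B `<=` F @` A ->
  (forall x y, A x -> A y -> enorm (F x - F y) <= L * enorm (x - y))%R ->
  hausdorff k B <= (L ^+ k)%:E * hausdorff k A.
Proof.
move=> L0 BFA lip; apply: hausdorff_le => d d0.
have dL : (0 < d / L)%R by rewrite divr_gt0.
have Lk : (0 < L ^+ k)%R by rewrite exprn_gt0.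
apply: (@le_trans _ _ ((L ^+ k)%:E * hausdorff_content k (d / L) A)); last first.
  by rewrite lee_pmul2l ?fin_numE // ?lte_fin // content_le_hausdorff.
rewrite -lee_pdivrMl //; apply: le_ereal_inf_tmp => _ [U [dU AU] <-].
rewrite lee_pdivrMl // -nneseriesZl => [|i _]; last by rewrite expe_ge0 ?ediam_ge0.
have diamL i : ediam (F @` (U i `&` A)) <= L%:E * ediam (U i).
  apply: ediam_le => [|_ _ [x [Ux Ax] <-] [y [Uy Ay] <-]].
    by rewrite mule_ge0 ?ediam_ge0 // lee_fin ltW.
  apply: (@le_trans _ _ (L * enorm (x - y))%:E); first by rewrite lee_fin lip.
  by rewrite EFinM lee_pmul2l // ediam_ub.
apply: le_trans (_ : \sum_(0 <= i <oo) ediam (F @` (U i `&` A)) ^+ k <= _).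
  apply: content_le => [i|y /BFA [x Ax <-]].
    apply: le_trans (diamL i) _.
    by rewrite -lee_pdivlMl // -EFinM mulrC.
  by have [i _ Uix] := AU x Ax; exists i => //; exists x.
apply: lee_nneseries => [i _ _|i _]; first by rewrite expe_ge0 ?ediam_ge0.
apply: le_trans (lee_pXn2 k (ediam_ge0 _) (diamL i)) _.
rewrite EFin_expe (_ : (_ * _) ^+ k = L%:E ^+ k * ediam (U i) ^+ k) //.
by elim: (k) => [|j ih]; rewrite ?expe0 ?mule1 // !expeS ih muleACA.
Qed.

Lemma hausdorff_isometry m p k (A : set 'rV[R]_m) (F : 'rV[R]_m -> 'rV[R]_p) :
  (forall x y, A x -> A y -> enorm (F x - F y) = enorm (x - y)) ->
  hausdorff k (F @` A) = hausdorff k A.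
Proof.
move=> FA; apply/eqP; rewrite eq_le; apply/andP; split.
  have := @hausdorff_lipschitz m p k A (F @` A) F 1 ltr01 (fun _ h => h).
  by rewrite expr1n mul1e; apply => x y Ax Ay; rewrite mul1r FA.
have /choice [G GP] : forall y, exists x, (F @` A) y -> A x /\ F x = y.
  move=> y; have [[x Ax Fx]|n] := pselect ((F @` A) y); first by exists x.
  by exists 0%R.
have := @hausdorff_lipschitz p m k (F @` A) A G 1 ltr01.
rewrite expr1n mul1e; apply.
  move=> x Ax; exists (F x); first by exists x.
  have [AG FG] := GP (F x) (ex_intro2 _ _ x Ax erefl).
  by apply/eqP; rewrite -subr_eq0; apply/eqP/enorm_eq0; rewrite -FA // FG subrr enorm0.
by move=> y z /GP [Gy Fy] /GP [Gz Fz]; rewrite mul1r -FA // Fy Fz.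
Qed.

End Hausdorff.

HB.instance Definition _ (R : realType) m k :=
  isOuterMeasure.Build R 'rV[R]_m (@hausdorff R m k.+1) (@hausdorff0 R m k)
    (@hausdorff_ge0 R m k.+1) (@le_hausdorff R m k.+1)
    (@hausdorff_sigma_subadditive R m k.+1).

(** * The unit cube has positive finite measure *)

Section CubeMeasure.
Local Open Scope ereal_scope.
Context {R : realType}.

(** The boxes met by a slice of the cube cover this slice; integrating the inequality
for the slices over the last coordinate gives the one for the cube. The
predicate [M] selects the boxes that meet the slice. *)
Lemma box_cover_sum k (p : nat -> nat -> R) (s : nat -> R) (M : pred nat) :
  (forall i, 0 <= s i)%R ->
  (forall x : nat -> R, (forall j, 0 <= x j <= 1)%R ->
    exists2 i, M i & forall j, (j < k)%N -> (`|x j - p i j| <= s i)%R) ->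
  1 <= \sum_(i <oo | M i) ((2 * s i) ^+ k)%:E.
Proof.
move=> s0; elim: k M => [|k ih] M cov.
  have [j|i Mi _] := cov (fun=> 0%R); first by rewrite lexx ler01.
  have := @nneseries_lim_ge R (fun=> 1) M 0 i.+1 (fun n _ _ => lee01).
  apply: le_trans.
  by rewrite big_mkcond big_nat_recr //= Mi leeDr // sume_ge0 // => n _; case: ifP.
pose I i : set R := `[(p i k - s i)%R, (p i k + s i)%R]%classic.
pose a i : R := ((M i)%:R * (2 * s i) ^+ k)%R.
have a0 i : (0 <= a i)%R by rewrite mulr_ge0 // exprn_ge0 // mulr_ge0.
pose F i t : \bar R := (a i)%:E * (\1_(I i) t)%:E.
have F0 i t : 0 <= F i t by rewrite /F -EFinM lee_fin mulr_ge0 ?indicE.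
have mI i : measurable (I i) by exact: measurable_itv.
have mind i : measurable_fun [set: R] (fun x => (\1_(I i) x)%:E).
  by apply/measurable_EFinP; exact: measurable_indic.
have Fm i : measurable_fun [set: R] (F i) by exact: measurable_funeM.
pose D : set R := `[0%R, 1%R]%classic.
have slice t : D t -> 1 <= \sum_(i <oo) F i t.
  rewrite /D /= in_itv /= => t01.
  pose Mt i := M i && (`|t - p i k| <= s i)%R.
  have covt : forall x : nat -> R, (forall j, 0 <= x j <= 1)%R ->
      exists2 i, Mt i & forall j, (j < k)%N -> (`|x j - p i j| <= s i)%R.
    move=> x x01; pose y j := if j == k then t else x j.
    have [j|i Mi yi] := cov y; first by rewrite /y; case: eqP.
    exists i; first by rewrite /Mt Mi; have := yi k (ltnSn k); rewrite /y eqxx.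
    by move=> j jk; have := yi j (ltnW jk); rewrite /y ltn_eqF.
  apply: le_trans (ih _ covt) _.
  rewrite eseries_mkcond; apply: lee_nneseries => [i _ _|i _].
    by case: ifP => // _; rewrite lee_fin exprn_ge0 // mulr_ge0.
  rewrite /Mt; case: ifP => [/andP[Mi h]|_]; last exact: F0.
  rewrite /F indicE mem_set ?mule1 /a ?Mi ?mul1r //= /I /= in_itv /=.
  by move: h; rewrite ler_distl.
have -> : 1 = \int[lebesgue_measure]_(t in D) (cst 1 t : \bar R).
  rewrite integral_cst; last exact: measurable_itv.
  rewrite mul1e; have := @lebesgue_measure_itv R `[0%R, 1%R]; rewrite /= lte_fin ltr01.
  by rewrite -EFinB subr0 => ->.
apply: le_trans (_ : \int[lebesgue_measure]_(t in D) \sum_(i <oo) F i t <= _).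
  apply: ge0_le_integral => //.
    exact: measurable_itv.
  apply: (measurable_funS measurableT) => //.
  apply: ge0_emeasurable_sum => [i x _ _|i _]; [exact: F0|exact: Fm].
rewrite integral_nneseries //; last 2 first.
- exact: measurable_itv.
- by move=> i; apply: measurable_funTS; exact: Fm.
rewrite [leRHS]eseries_mkcond; apply: lee_nneseries => [i _ _|i _].
  exact: integral_ge0.
rewrite ge0_integralZl_EFin //; last 2 first.
- exact: measurable_itv.
- by apply: measurable_funTS; exact: mind.
rewrite integral_indic; [|exact: measurable_itv|exact: mI].
rewrite /a; case: (M i); last by rewrite !mul0r mul0e.
rewrite mul1r exprSr EFinM; apply: lee_wpmul2l.
  by rewrite lee_fin exprn_ge0 // mulr_ge0.
apply: le_trans (_ : lebesgue_measure (I i) <= _).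
  apply: le_measure; rewrite ?inE; [|exact: mI|exact: subIsetl].
  by apply: measurableI; exact: measurable_itv.
have := @lebesgue_measure_itv R `[(p i k - s i)%R, (p i k + s i)%R]; rewrite /= => ->.
case: ifP => _; last by rewrite lee_fin mulr_ge0.
by rewrite -EFinB lee_fin; lra.
Qed.

(** A set of diameter [d] lies in a box with sides [2 * d]. *)
Lemma hausdorff_cube_gt0 k : 0 < hausdorff k (@unit_cube R k).
Proof.
apply: lt_le_trans (content_le_hausdorff _ _ ltr01).
apply: (@lt_le_trans _ _ (2^-1 ^+ k)%:E); first by rewrite lte_fin exprn_gt0.
apply: le_ereal_inf_tmp => _ [U [U1 QU] <-].
have finU i : ediam (U i) \is a fin_num.
  by rewrite ge0_fin_numE ?ediam_ge0 // (le_lt_trans (U1 i)) // ltry.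
pose s i := fine (ediam (U i)).
have s0 i : (0 <= s i)%R by rewrite fine_ge0 // ediam_ge0.
have /choice [p pP] : forall i, exists x, U i !=set0 -> U i x.
  by move=> i; have [[x Ux]|n] := pselect (U i !=set0); [exists x|exists 0%R].
pose q i j := if insub j is Some o then p i 0%R o else 0%R.
have cov : forall x : nat -> R, (forall j, 0 <= x j <= 1)%R ->
    exists2 i, predT i & forall j, (j < k)%N -> (`|x j - q i j| <= s i)%R.
  move=> x x01; have [j|i _ Uix] := QU (\row_j x j); first by rewrite mxE.
  exists i => // j jk; rewrite /q insubT.
  rewrite -lee_fin fineK //; apply: le_trans (ediam_ub Uix (pP i _)); last by exists (\row_j x j).
  rewrite lee_fin; apply: le_trans (ler_coord_enorm _ (Ordinal jk)).
  by rewrite !mxE.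
have bcs := box_cover_sum s0 cov.
rewrite exprVn -[X in X <= _]mule1 lee_pdivrMl ?exprn_gt0 //.
rewrite -nneseriesZl => [|i _]; last by rewrite expe_ge0 // ediam_ge0.
apply: le_trans bcs _; apply: lee_nneseries => [i _ _|i _].
  by rewrite lee_fin exprn_ge0 // mulr_ge0.
by rewrite exprMn EFinM (EFin_expe (s i)) fineK.
Qed.

Lemma sum_initial_le (c : R) m M : (0 <= c)%R ->
  \sum_(0 <= i < M) (if (i < m)%N then c%:E else 0) <= (m%:R * c)%:E.
Proof.
move=> c0; apply: (@le_trans _ _ ((minn m M)%:R * c)%:E); last first.
  by rewrite lee_fin ler_wpM2r // ler_nat geq_minl.
elim: M => [|M ih]; first by rewrite big_geq // minn0 mul0r.
rewrite big_nat_recr //=; case: (ltnP M m) ih => Mm ih.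
  apply: le_trans (leeD2r _ ih) _; rewrite -EFinD lee_fin.
  by rewrite (minn_idPr Mm) -natr1 mulrDl mul1r.
by rewrite adde0 (minn_idPl (leqW Mm)).
Qed.

(** Cutting the cube into [N ^ k] cubes of side [1 / N], for every [N], keeps the
sum of the powers of the diameters bounded. *)
Lemma hausdorff_cube_fin k : hausdorff k.+1 (@unit_cube R k.+1) < +oo.
Proof.
apply: (@le_lt_trans _ _ (k.+1%:R ^+ k.+1)%:E); last by rewrite ltry.
apply: hausdorff_le => d d0.
pose N := (Num.truncn (k.+1%:R / d)).+1.
have Nd : (k.+1%:R / N%:R <= d :> R)%R.
  rewrite ler_pdivrMr ?ltr0n // mulrC -ler_pdivrMr //.
  by rewrite ltW // Num.Theory.truncnS_gt.
pose T := {ffun 'I_k.+1 -> 'I_N}.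
pose C (g : T) : set 'rV[R]_k.+1 := [set x | forall j, ((g j)%:R <= N%:R * x 0 j <= (g j).+1%:R)%R].
have Cd g : ediam (C g) <= (k.+1%:R / N%:R)%:E.
  apply: ediam_le => [|x y Cx Cy]; first by rewrite lee_fin divr_ge0.
  rewrite lee_fin; apply: le_trans (ler_enorm_coords _) _.
  apply: ler_sum_ord_const => j.
  rewrite !mxE -div1r ler_pdivlMr ?ltr0n // -[N%:R]gtr0_norm ?ltr0n // -normrM.
  have /andP[x1 x2] := Cx j; have /andP[y1 y2] := Cy j.
  rewrite ler_norml; move: x2 y2; rewrite -natr1 => x2 y2.
  by apply/andP; split; lra.
pose U i := if nth None (map Some (enum T)) i is Some g then C g else set0.
apply: le_trans (_ : \sum_(0 <= i <oo) ediam (U i) ^+ k.+1 <= _).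
  apply: content_le => [i|x Qx].
    rewrite /U; case: nth => [g|]; last by rewrite ediam0 lee_fin ltW.
    by apply: le_trans (Cd g) _; rewrite lee_fin.
  have xb j : (minn (Num.truncn (N%:R * x 0%R j)) N.-1 < N)%N by rewrite ltnS geq_minr.
  pose g : T := [ffun j => Ordinal (xb j)].
  exists (index g (enum T)) => //; rewrite /U (nth_map g) ?index_mem ?mem_enum //.
  rewrite nth_index ?mem_enum // => j; rewrite ffunE /=.
  have /andP[x0 x1] := Qx j.
  have Nx0 : (0 <= N%:R * x 0 j)%R by rewrite mulr_ge0.
  have /andP[t1 t2] := truncn_itv Nx0.
  apply/andP; split; first by apply: le_trans t1; rewrite ler_nat geq_minl.
  rewrite /minn; case: ifP => _; first exact: ltW.
  by rewrite -[N.-1.+1]/N ler_piMr.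
have Ub i : ediam (U i) ^+ k.+1 <= (if (i < #|T|)%N then ((k.+1%:R / N%:R) ^+ k.+1)%:E else 0).
  case: ltnP => h.
    rewrite EFin_expe lee_pXn2 ?ediam_ge0 // /U; case: nth => [g|]; first exact: Cd.
    by rewrite ediam0 lee_fin divr_ge0.
  rewrite /U nth_default; last by rewrite size_map -cardT.
  by rewrite ediam0 expeS mul0e.
have U0 : forall j, (0 <= j)%N -> xpredT j -> 0 <= ediam (U j) ^+ k.+1.
  by move=> j _ _; rewrite expe_ge0 // ediam_ge0.
apply: (lime_le (is_cvg_nneseries U0)).
apply: nearW => M; apply: le_trans (lee_sum _ (fun i _ => Ub i)) _.
apply: le_trans (sum_initial_le _ _ _) _; first by rewrite exprn_ge0 // divr_ge0.
by rewrite lee_fin card_ffun !card_ord natrX -exprMn mulrC divfK // pnatr_eq0.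
Qed.

End CubeMeasure.

(** * Caratheodory measurability of half spaces *)

Section Caratheodory.
Local Open Scope ereal_scope.
Context {R : realType} {T : Type} (mu : {outer_measure set T -> \bar R}).

(** The additivity of metric outer measures on far apart sets, when the distance
is the one seen by a single function. *)
Definition separates (g : T -> R) := forall (X Y : set T) (c d : R), (c < d)%R ->
  (forall x, X x -> g x <= c)%R -> (forall y, Y y -> d <= g y)%R ->
  mu X + mu Y <= mu (X `|` Y).

Lemma outer_measure_fin (A B : set T) : A `<=` B -> mu B < +oo -> mu A < +oo.
Proof. by move=> AB; apply: le_lt_trans; exact: le_outer_measure. Qed.

(** Caratheodory's criterion. The part of a test set [X] above the level [c] is cut
into shells that accumulate at this level. The even shells are separated from each
other, and so are the odd ones; hence the measures of the shells have a finite sum,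
and the part of [X] just above the level [c] has a small measure. *)
Lemma measurable_sublevel g : separates g ->
  forall c, mu.-caratheodory [set x | (g x <= c)%R].
Proof.
move=> sep c; apply: le_caratheodory_measurable => X.
have [->|] := eqVneq (mu X) +oo; first by rewrite leey.
rewrite -ltey => Xfin.
pose h i : R := (c + i.+1%:R^-1)%R.
have h_anti i j : (i < j)%N -> (h j < h i)%R.
  by move=> ij; rewrite ltrD2l ltf_pV2 ?posrE ?ltr0n // ltr_nat ltnS.
have hc i : (c < h i)%R by rewrite ltrDl invr_gt0 ltr0n.
pose D i := X `&` [set x | (h i.+1 <= g x < h i)%R].
pose E i := X `&` [set x | (h i <= g x)%R].
(* [b] is 0 for the even shells and 1 for the odd ones *)
have half b n : \sum_(i < n) mu (D (b + i.*2)%N) <= mu X.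
  pose B m := [set x | exists2 i, (i < m)%N & D (b + i.*2)%N x].
  suff : \sum_(i < n) mu (D (b + i.*2)%N) <= mu (B n).
    by move/le_trans; apply; apply: le_outer_measure => x [i _ []].
  elim: n => [|n ih]; first by rewrite big_ord0 outer_measure_ge0.
  rewrite big_ord_recr /=; apply: le_trans (leeD2r _ ih) _; rewrite addeC.
  have [d cd Bd] : exists2 d, (h (b + n.*2)%N < d)%R & forall x, B n x -> (d <= g x)%R.
    case: (n) => [|m].
      by exists (h (b + 0.*2)%N + 1)%R; [rewrite ltrDl|move=> x []].
    exists (h (b + m.*2).+1); first by apply: h_anti; rewrite doubleS !addnS.
    move=> x [i im [_ /andP[+ _]]]; apply: le_trans.
    have [->//|ne] := eqVneq i m; apply/ltW/h_anti.
    by rewrite ltnS ltn_add2l ltn_double ltn_neqAle ne -ltnS.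
  apply: le_trans (sep _ _ _ _ cd _ Bd) _ => [x [_ /andP[_ /ltW]]//|].
  apply: le_outer_measure => x [Dx|[i ltin Dx]]; first by exists n.
  by exists i => //; exact: ltnW.
have fin A : A `<=` X -> mu A < +oo by move=> AX; exact: outer_measure_fin Xfin.
have mu0 i : 0 <= mu (D i) by exact: outer_measure_ge0.
have sumD : \sum_(i <oo) mu (D i) < +oo.
  apply: (@le_lt_trans _ _ (mu X + mu X)); last by rewrite lte_add_pinfty.
  apply: (lime_le (is_cvg_nneseries (fun n _ _ => mu0 n))); apply: nearW => n.
  rewrite big_mkord; apply: le_trans (leeD (half 0%N n) (half 1%N n)).
  have evod m : \sum_(i < m.*2) mu (D i) =
      \sum_(i < m) mu (D (0 + i.*2)%N) + \sum_(i < m) mu (D (1 + i.*2)%N).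
    elim: m => [|m ih]; first by rewrite !big_ord0 adde0.
    rewrite doubleS !big_ord_recr /= ih -!addeA; congr (_ + _).
    by rewrite addeCA.
  rewrite -evod -!(big_mkord xpredT (fun i => mu (D i))).
  by apply: lee_sum_nneg_natr => //; rewrite -addnn leq_addr.
have tail : (fun N => \sum_(N <= i <oo) mu (D i)) @ \oo --> 0.
  by apply: nneseries_tail_cvg => // i _; exact: outer_measure_ge0.
have EX n : mu (X `&` [set x | (g x <= c)%R]) + mu (E n) <= mu X.
  apply: le_trans (sep _ _ c (h n) (hc n) _ _) _ => [x []//|x []//|].
  by apply: le_outer_measure => x [[]|[]].
have upper n : mu (X `&` ~` [set x | (g x <= c)%R]) <= mu (E n) + \sum_(n <= i <oo) mu (D i).
  apply: le_trans (leeD2l _ (outer_measure_sigma_subadditive_tail _ _ _)).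
  apply: le_trans (outer_measureU2 _ _ _); apply: le_outer_measure => x [Xx /negP].
  rewrite -ltNge => cx.
  have [hx|xh] := leP (h n) (g x); [by left|right].
  have exj : exists j, (h j <= g x)%R.
    exists (Num.truncn (g x - c)^-1); rewrite /h -lerBrDl.
    rewrite -[leRHS]invrK lef_pV2 ?posrE ?invr_gt0 ?subr_gt0 ?ltr0n //.
    exact/ltW/Num.Theory.truncnS_gt.
  case: (ex_minnP exj) => -[|j] hj minj.
    have := le_lt_trans hj xh; rewrite ltNge; case: (n) => [|m]; first by rewrite lexx.
    by rewrite ltW // h_anti.
  exists j.
    move=> /= jn; have := le_lt_trans hj xh; rewrite ltNge.
    move: jn; rewrite leq_eqVlt => /predU1P[->|jn]; first by rewrite lexx.
    by rewrite ltW // h_anti.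
  split => //; rewrite /= hj ltNge; apply/negP => /minj; by rewrite ltnn.
apply/lee_addgt0Pr => e e0.
have [N _ /(_ N (leqnn N)) tN] : \forall N \near \oo, \sum_(N <= i <oo) mu (D i) < e%:E.
  apply: (tail [set x | x < e%:E]); exists e => //= t /=.
  by rewrite sub0r normrN lte_fin => /ltr_normlW.
apply: le_trans (leeD2l _ (upper N)) _; rewrite addeA.
by apply: leeD (EX N) (ltW tN).
Qed.

End Caratheodory.

Section Spread.
Local Open Scope ereal_scope.
Context {R : realType} {T U : Type}.

(** The measure of the set swept out over [E] when [F x] is, for instance, a curve
issued from [x]. Allowing sets for the values lets all the measures compared below,
on the parameter space or on a linear image, be outer measures of a set of
parameters. *)
Definition spread (mu : set U -> \bar R) (F : T -> set U) (E : set T) : \bar R :=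
  mu (\bigcup_(x in E) F x).

Context (mu : {outer_measure set U -> \bar R}) (F : T -> set U).

Lemma spread0 : spread mu F set0 = 0.
Proof. by rewrite /spread bigcup_set0 outer_measure0. Qed.

Lemma spread_ge0 E : 0 <= spread mu F E.
Proof. exact: outer_measure_ge0. Qed.

Lemma le_spread : {homo spread mu F : A B / A `<=` B >-> A <= B}.
Proof. by move=> A B AB; apply: le_outer_measure; exact: bigcup_subset. Qed.

Lemma spread_sigma_subadditive : sigma_subadditive (spread mu F).
Proof.
move=> E; apply: le_trans (outer_measure_sigma_subadditive mu _).
apply: le_outer_measure => y [x [i _ Eix] Fxy]; exists i => //; exists x => //.
Qed.

HB.instance Definition _ := isOuterMeasure.Build R T (spread mu F)
  spread0 spread_ge0 le_spread spread_sigma_subadditive.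

End Spread.

Section Separation.
Local Open Scope ereal_scope.
Context {R : realType}.

Lemma separates_spread m k (T : Type) (F : T -> set 'rV[R]_m) (g : T -> R) :
  (forall c d, (c < d)%R -> exists2 e, (0 < e)%R & forall x y u v,
     (g x <= c)%R -> (d <= g y)%R -> F x u -> F y v -> (e <= enorm (u - v))%R) ->
  separates (spread (@hausdorff R m k.+1) F) g.
Proof.
move=> gF X Y c d cd Xc Yd; have [e e0 eF] := gF c d cd.
rewrite /= /spread bigcup_setU; apply: (@hausdorff_separated R m k _ _ e e0).
by move=> u v [x Xx Fxu] [y Yy Fyv]; apply: (eF x y) => //; [exact: Xc|exact: Yd].
Qed.

Lemma separates_hausdorff m k (i : 'I_m) :
  separates (@hausdorff R m k.+1) (fun x : 'rV[R]_m => x ord0 i).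
Proof.
move=> X Y c d cd Xc Yd; have dc : (0 < d - c)%R by rewrite subr_gt0.
apply: (@hausdorff_separated R m k _ _ _ dc) => x y /Xc xc /Yd dy.
rewrite enormC; apply: le_trans (ler_coord_enorm _ i); apply: le_trans (ler_norm _).
by rewrite !mxE lerB.
Qed.

End Separation.

(** * Dyadic tiles and uniqueness of translation-invariant measures *)

Section Tiles.
Context {R : realType} {m : nat}.
Implicit Types x y : 'rV[R]_m.

(** Rounding up makes the tiles closed above, hence differences of sublevel sets
of the coordinates. *)
Definition tile_index j x : 'rV[int]_m := \row_i Num.ceil (2 ^+ j * x 0 i).

(** The tiles are numbered by natural numbers so that they form a sequence. Each
[tile j i] is empty or a dyadic cube of side [2 ^- j]. *)
Definition tile j (i : nat) : set 'rV[R]_m := [set x | pickle (tile_index j x) = i].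

Lemma tile_eq j x y : tile j (pickle (tile_index j x)) y -> tile_index j y = tile_index j x.
Proof. by move=> yx; apply: (pcan_inj pickleK); exact: yx. Qed.

Lemma tile_trivIset j : trivIset setT (tile j).
Proof. by apply/trivIsetP => i i' _ _ /eqP ii'; apply/seteqP; split=> // x [xi xi']; case: ii'; rewrite -xi -xi'. Qed.

Lemma tile_cover j : \bigcup_i tile j i = setT.
Proof. by apply/seteqP; split=> // x _; exists (pickle (tile_index j x)). Qed.

Lemma tile_close j x y l : tile_index j x = tile_index j y ->
  `|x 0 l - y 0 l| < 2^-1 ^+ j.
Proof.
move=> /rowP /(_ l); rewrite !mxE => xy.
have j0 : 0 < 2 ^+ j :> R by rewrite exprn_gt0.
rewrite exprVn -div1r ltr_pdivlMr // -[X in _ * X]gtr0_norm // -normrM mulrC mulrBr.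
have := ceil_itv (2 ^+ j * x 0 l); have := ceil_itv (2 ^+ j * y 0 l).
rewrite xy; set z := _%:~R; rewrite ltr_norml; lra.
Qed.

Lemma tile_refine j x y : tile_index j.+1 x = tile_index j.+1 y ->
  tile_index j x = tile_index j y.
Proof.
have mono (a b : R) : Num.ceil (2 * a) = Num.ceil (2 * b) -> Num.ceil a <= Num.ceil b.
  move=> ab; rewrite leNgt; apply/negP => lt.
  have ba : b <= (Num.ceil b)%:~R by have /andP[] := ceil_itv b.
  have : (Num.ceil b)%:~R < a by rewrite -ceil_gt_int.
  move=> h; have : Num.ceil (2 * b) <= 2 * Num.ceil b by rewrite ceil_le_int intrM ler_pM2l.
  have : 2 * Num.ceil b < Num.ceil (2 * a) by rewrite ceil_gt_int intrM ltr_pM2l.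
  by rewrite ab ltNge => /negP.
move=> /rowP xy; apply/rowP => l; have := xy l; rewrite !mxE !exprS -!mulrA => h.
by apply/eqP; rewrite eq_le !mono.
Qed.

Lemma tile_refine_le j j' x y : (j <= j')%N ->
  tile_index j' x = tile_index j' y -> tile_index j x = tile_index j y.
Proof.
by move=> /subnK <-; elim: (j' - j)%N => [//|d ih]; rewrite addSn => /tile_refine.
Qed.

Lemma tile_index_shift j x (z : 'rV[int]_m) :
  tile_index j (x + \row_i ((z 0 i)%:~R / 2 ^+ j)) = tile_index j x + z.
Proof.
apply/rowP => i; rewrite !mxE mulrDr mulrCA divff ?expf_neq0 // mulr1.
by rewrite ceilDrz ?intr_int // intrKceil.
Qed.

End Tiles.

Section Haar.
Local Open Scope ereal_scope.
Context {R : realType} {m : nat}.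
Implicit Types (mu : {outer_measure set 'rV[R]_m -> \bar R}) (B X : set 'rV[R]_m).

Local Notation tile := (@tile R m).
Local Notation tile_index := (@tile_index R m).

Definition ebounded X := exists M : R, forall x, X x -> (enorm x <= M)%R.

(** The properties of a Haar measure that determine it up to a factor; measurability
is required in the form that Hausdorff measures provide. *)
Record homogeneous mu : Prop := Homogeneous {
  homogeneous_shift : forall (v : 'rV[R]_m) X, mu [set (x + v)%R | x in X] = mu X;
  homogeneous_separates : forall i, separates mu (fun x => x ord0 i);
  homogeneous_fin : forall X, ebounded X -> mu X < +oo }.

Lemma bigsetI_finP (I : finType) T (S : I -> set T) y :
  (\big[setI/setT]_(l : I) S l) y <-> forall l, S l y.
Proof.
split=> [+ l|Sy]; first by rewrite (bigD1 l) //= => -[].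
by elim/big_ind: _ => // A A' Ay A'y; split.
Qed.

Lemma tile_measurable mu j i : (forall l, separates mu (fun x => x ord0 l)) ->
  mu.-caratheodory (tile j i).
Proof.
move=> sep; have [[x xi]|n] := pselect (tile j i !=set0); last first.
  rewrite (_ : tile j i = set0); first exact: caratheodory_measurable_set0.
  by apply/seteqP; split => // x xi; case: n; exists x.
pose S (c : int -> int) l := [set y : 'rV[R]_m | (y ord0 l <= (c (tile_index j x ord0 l))%:~R / 2 ^+ j)%R].
have -> : tile j i = \big[setI/setT]_l (S id l `\` S (fun z => z - 1)%R l).
  have j0 : (0 < 2 ^+ j :> R)%R by rewrite exprn_gt0.
  apply/seteqP; split => y.
    rewrite -xi => /tile_eq yx; apply/bigsetI_finP => l.
    rewrite /S /= -yx mxE; have /andP[c1 c2] := ceil_itv (2 ^+ j * y ord0 l)%R.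
    split; first by rewrite ler_pdivlMr // mulrC.
    by apply/negP; rewrite -ltNge ltr_pdivrMr // [ltRHS]mulrC.
  move/bigsetI_finP => Sy; rewrite /tile /= -xi; congr pickle.
  apply/rowP => l; have := Sy l; rewrite /S /= => -[y1 /negP y2]; rewrite mxE; apply/eqP.
  rewrite ceil_eq; apply/andP; split.
    by move: y2; rewrite -ltNge ltr_pdivrMr // [ltRHS]mulrC.
  by move: y1; rewrite ler_pdivlMr // mulrC.
have SM c l : mu.-caratheodory (S c l) by exact: measurable_sublevel.
elim/big_ind: _ => [|A B|l _].
- by rewrite -setC0; apply: caratheodory_measurable_setC; exact: caratheodory_measurable_set0.
- exact: caratheodory_measurable_setI.
- exact: caratheodory_measurable_setD.
Qed.

Lemma tile_sum mu j X : (forall l, separates mu (fun x => x ord0 l)) ->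
  mu X = \sum_(i <oo) mu (X `&` tile j i).
Proof.
move=> sep; apply/eqP; rewrite eq_le; apply/andP; split.
  apply: le_trans (outer_measure_sigma_subadditive mu _).
  by rewrite -setI_bigcupr tile_cover setIT.
have := caratheodory_lime_le (fun i => tile_measurable (mu := mu) j i sep) (@tile_trivIset R m j) X.
by rewrite tile_cover setCT setI0 outer_measure0 adde0.
Qed.

Definition fatten j B := [set x : 'rV[R]_m | exists2 b : 'rV[R]_m, B b & tile_index j x = tile_index j b].

Definition cell j := fatten j [set 0%R].

Lemma cellE j : cell j = tile j (pickle (tile_index j 0%R)).
Proof.
apply/seteqP; split=> [x [_ -> xb]|x /tile_eq xb]; first by rewrite /tile /= xb.
by exists 0%R.
Qed.

Lemma homogeneous_tile mu j x : homogeneous mu ->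
  mu (tile j (pickle (tile_index j x))) = mu (cell j).
Proof.
move=> hmu; pose z := (tile_index j x - tile_index j 0)%R.
rewrite -(homogeneous_shift hmu (\row_i ((z ord0 i)%:~R / 2 ^+ j)%R) (cell j)); congr (mu _).
rewrite cellE; apply/seteqP; split=> [y /tile_eq yx|].
  exists (y + \row_i (((- z) ord0 i)%:~R / 2 ^+ j))%R; last first.
    by apply/rowP => i; rewrite !mxE mulrNz mulNr subrK.
  rewrite /tile /= tile_index_shift yx; congr pickle.
  by rewrite /z opprB addrC subrK.
move=> _ [y /tile_eq y0 <-]; rewrite /tile /= tile_index_shift y0.
by congr pickle; rewrite /z addrC subrK.
Qed.

Definition tile_count j B : \bar R :=
  \sum_(i <oo) (`[< tile j i `&` B !=set0 >]%:R)%:E.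

Lemma cell_fin mu j : homogeneous mu -> mu (cell j) \is a fin_num.
Proof.
move=> hmu; rewrite ge0_fin_numE ?outer_measure_ge0 //; apply: homogeneous_fin => //.
exists (m%:R * 1)%R => x [_ -> xb]; apply: le_trans (ler_enorm_coords _) _.
apply: ler_sum_ord_const => i.
have := tile_close i xb; rewrite [X in (_ - X)%R]mxE subr0 => /ltW /le_trans; apply.
by rewrite exprn_ile1 // invf_le1 // ler1n.
Qed.

(** All the tiles of a given size have the same measure, by translation. *)
Lemma measure_fatten mu j B : homogeneous mu ->
  mu (fatten j B) = mu (cell j) * tile_count j B.
Proof.
move=> hmu; have sep := homogeneous_separates hmu.
rewrite (tile_sum j _ sep) -(fineK (cell_fin j hmu)) /tile_count -nneseriesZl //.
apply: eq_eseriesr => i _; case: asboolP => [[b [bi Bb]]|n].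
  rewrite mule1 fineK ?cell_fin // -(homogeneous_tile j b hmu) bi.
  congr (mu _); apply/setIidPr => x; rewrite -bi => /tile_eq xb.
  by exists b.
rewrite mule0 (_ : _ `&` _ = set0) ?outer_measure0 //.
apply/seteqP; split=> // x [[b Bb xb] xi]; case: n; exists b; split => //.
by rewrite /tile /= -xb.
Qed.

Lemma fatten_cell j : fatten j (cell 0) = cell 0.
Proof.
apply/seteqP; split=> [x [b [c c0 bc] xb]|x x0]; last by exists x.
by exists c => //; rewrite -bc; exact: (tile_refine_le _ xb).
Qed.

(** The cell of side 1 is itself a union of tiles of side [2 ^- j], by
[fatten_cell]; the numbers of tiles cancel. *)
Lemma measure_fatten_prop mu nu j B : homogeneous mu -> homogeneous nu ->
  mu (fatten j B) * nu (cell 0) = nu (fatten j B) * mu (cell 0).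
Proof.
move=> hmu hnu; rewrite -[in LHS](fatten_cell j) -[in RHS](fatten_cell j).
rewrite (measure_fatten j B hmu) (measure_fatten j B hnu).
rewrite (measure_fatten j (cell 0) hmu) (measure_fatten j (cell 0) hnu).
by rewrite muleACA [X in X * _]muleC muleACA.
Qed.

Lemma fatten_bounded j B : ebounded B -> ebounded (fatten j B).
Proof.
move=> [M BM]; exists (M + m%:R * 1)%R => x [b Bb xb].
rewrite -(subrK b x) addrC; apply: le_trans (ler_enormD _ _) _; apply: lerD; first exact: BM.
apply: le_trans (ler_enorm_coords _) _.
apply: ler_sum_ord_const => i.
have := tile_close i xb; rewrite !mxE => /ltW /le_trans; apply.
by rewrite exprn_ile1 // invf_le1 // ler1n.
Qed.

Lemma fatten_bigcap B : closed B -> \bigcap_j fatten j B = B.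
Proof.
move=> cB; apply/seteqP; split=> [x fx|x Bx j _]; last by exists x.
apply: cB => A /nbhs_ballP [e /= e0 eA].
have [j jA] : exists j, (2^-1 ^+ j < e)%R.
  have := @cvg_expr R 2^-1; rewrite ger0_norm // invf_lt1 // ltr1n => /(_ isT).
  by move=> /cvgr_lt /(_ _ e0) [N _ /(_ N (leqnn N))]; exists N.
have [b Bb xb] := fx j I; exists b; split => //; apply: eA; split => // i l.
rewrite (ord1 i); apply: lt_trans jA; exact: tile_close.
Qed.

Lemma fatten_measurable mu j B : homogeneous mu -> mu.-caratheodory (fatten j B).
Proof.
move=> hmu; rewrite (_ : fatten j B = \bigcup_i
    (if `[< tile j i `&` B !=set0 >] then tile j i else set0)).
  apply: caratheodory_measurable_bigcup => i; case: ifP => _.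
    exact/tile_measurable/homogeneous_separates.
  exact: caratheodory_measurable_set0.
apply/seteqP; split=> [x [b Bb xb]|x [i _]].
  exists (pickle (tile_index j b)) => //; rewrite asboolT; first by rewrite /tile /= xb.
  by exists b.
case: asboolP => // -[b [bi Bb]]; rewrite -bi => /tile_eq xb.
by exists b.
Qed.

Lemma closed_caratheodory mu B : homogeneous mu -> closed B -> mu.-caratheodory B.
Proof.
move=> hmu /fatten_bigcap <-; rewrite -[X in caratheodory_measurable _ X]setCK setC_bigcap.
apply: caratheodory_measurable_setC; apply: caratheodory_measurable_bigcup => j.
by apply: caratheodory_measurable_setC; exact: fatten_measurable.
Qed.

Lemma fatten_cvg mu B : homogeneous mu -> closed B -> ebounded B ->
  (fun j => mu (fatten j B)) @ \oo --> mu B.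
Proof.
move=> hmu cB bB; rewrite -[B in X in _ --> X](fatten_bigcap cB).
apply: (@nonincreasing_cvg_mu _ (caratheodory_type mu) R mu (fun j => fatten j B)).
- exact/homogeneous_fin/fatten_bounded.
- by move=> j; exact: fatten_measurable.
- by apply: bigcap_measurable => // j _; exact: fatten_measurable.
- move=> j j' jj'; apply/subsetPset => x [b Bb xb]; exists b => //.
  exact: tile_refine_le xb.
Qed.

(** A translation-invariant measure is determined up to a factor, since the unions
of the tiles that meet [B] decrease to [B]. *)
Lemma homogeneous_unique_cell mu nu B : homogeneous mu -> homogeneous nu ->
  closed B -> ebounded B -> mu B * nu (cell 0) = nu B * mu (cell 0).
Proof.
move=> hmu hnu cB bB.
have cvg1 := cvgeZr (cell_fin 0 hnu) (fatten_cvg hmu cB bB).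
have cvg2 := cvgeZr (cell_fin 0 hmu) (fatten_cvg hnu cB bB).
apply: (@cvg_unique _ (@ereal_hausdorff R) _ _ _ _ cvg1).
rewrite (_ : (fun j => _) = (fun j => nu (fatten j B) * mu (cell 0))); first exact: cvg2.
by apply/funext => j; exact: measure_fatten_prop.
Qed.

End Haar.

Section CubeNormalization.
Local Open Scope ereal_scope.
Context {R : realType}.

Lemma unit_cube_closed m : closed (@unit_cube R m).
Proof.
rewrite (_ : @unit_cube R m = \bigcap_(i in [set: 'I_m]) (fun x : 'rV[R]_m => x 0%R i) @^-1` `[0%R, 1%R]).
  apply: closed_bigI => i _; apply: closed_comp; last exact: itv_closed.
  by move=> x _; exact: coord_continuous.
apply/seteqP; split=> x; first by move=> Qx i _; rewrite /= in_itv /= Qx.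
by move=> Qx i; have := Qx i I; rewrite /= in_itv.
Qed.

Lemma ebounded_coord m (X : set 'rV[R]_m) (M : R) :
  (forall x i, X x -> `|x 0%R i| <= M)%R -> ebounded X.
Proof.
move=> XM; exists (m%:R * M)%R => x Xx; apply: le_trans (ler_enorm_coords _) _.
by apply: ler_sum_ord_const => i; exact: XM.
Qed.

Lemma unit_cube_bounded m : ebounded (@unit_cube R m).
Proof.
apply: (@ebounded_coord _ _ 1%R) => x i Qx; have /andP[x0 x1] := Qx i.
by rewrite ger0_norm.
Qed.

(** A bounded set lies in a cube, which is a Lipschitz image of the unit cube. *)
Lemma hausdorff_bounded k (X : set 'rV[R]_k.+1) : ebounded X -> hausdorff k.+1 X < +oo.
Proof.
move=> [M XM]; pose L : R := (2 * (`|M| + 1))%R.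
have L0 : (0 < L)%R by rewrite mulr_gt0 // ltr_wpDl.
pose F (x : 'rV[R]_k.+1) := (L *: x - const_mx (`|M| + 1))%R.
apply: (@le_lt_trans _ _ ((L ^+ k.+1)%:E * hausdorff k.+1 (@unit_cube R k.+1))); last first.
  have := @hausdorff_cube_fin R k; rewrite -ge0_fin_numE ?hausdorff_ge0 // => fin.
  by rewrite -(fineK fin) -EFinM ltry.
apply: (@hausdorff_lipschitz R _ _ _ _ _ F L L0) => [x Xx|x y _ _]; last first.
  by rewrite /F opprB addrA subrK -scalerBr enormZ gtr0_norm.
exists (L^-1 *: (x + const_mx (`|M| + 1)))%R; last first.
  by rewrite /F scalerA divff ?gt_eqF // scale1r addrK.
move=> i; rewrite !mxE mulrC.
have xM := le_trans (ler_coord_enorm x i) (XM x Xx).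
have /andP[h1 h2] : (- M <= x 0 i <= M)%R by rewrite -ler_norml.
have hM := ler_norm M; rewrite ler_pdivrMr // ler_pdivlMr // mul0r mul1r /L.
by apply/andP; split; lra.
Qed.

Lemma homogeneous_hausdorff k : homogeneous (@hausdorff R k.+1 k.+1).
Proof.
split=> [v X|i|X]; [|exact: separates_hausdorff|exact: hausdorff_bounded].
by apply: hausdorff_isometry => x y _ _; rewrite opprD addrACA subrr addr0.
Qed.

Definition cube_measure k : \bar R := hausdorff k (@unit_cube R k).

Lemma cube_measure_fin k : cube_measure k.+1 \is a fin_num.
Proof. by rewrite ge0_fin_numE ?hausdorff_ge0 // hausdorff_cube_fin. Qed.

Lemma cube_measure_gt0 k : 0 < cube_measure k.
Proof. exact: hausdorff_cube_gt0. Qed.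

Lemma hausdorff_cell_gt0 k : 0 < hausdorff k.+1 (@cell R k.+1 0).
Proof.
rewrite lt0e hausdorff_ge0 andbT; apply/eqP => c0.
have := cube_measure_gt0 k.+1; rewrite ltNge => /negP; apply.
apply: le_trans (le_outer_measure _ _ _ (@subsetT _ _)) _.
rewrite (tile_sum (mu := @hausdorff R k.+1 k.+1) 0); last by move=> l; exact: separates_hausdorff.
rewrite eseries0 // => i _ _; rewrite setTI.
have [[x <-]|n] := pselect (@tile R k.+1 0 i !=set0).
  by rewrite (homogeneous_tile (mu := @hausdorff R k.+1 k.+1)) //; exact: homogeneous_hausdorff.
rewrite (_ : tile _ _ = set0) ?outer_measure0 //.
by apply/seteqP; split => // x xi; case: n; exists x.
Qed.

(** The normalization by the closed cube, whose measure compares with that of the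
half-open cell like the measure of any closed bounded set. *)
Lemma homogeneous_unique k (mu : {outer_measure set 'rV[R]_k.+1 -> \bar R}) B :
  homogeneous mu -> closed B -> ebounded B ->
  mu B * cube_measure k.+1 = hausdorff k.+1 B * mu (@unit_cube R k.+1).
Proof.
move=> hmu cB bB; have hH := homogeneous_hausdorff k.
have e1 := homogeneous_unique_cell hmu hH cB bB.
have e2 := homogeneous_unique_cell hmu hH (@unit_cube_closed k.+1) (@unit_cube_bounded k.+1).
have fin (nu : {outer_measure set 'rV[R]_k.+1 -> \bar R}) X : homogeneous nu -> ebounded X ->
    nu X \is a fin_num.
  by move=> hnu bX; rewrite ge0_fin_numE ?outer_measure_ge0 // (homogeneous_fin hnu).
have := hausdorff_cell_gt0 k.
move: e1 e2; rewrite /cube_measure /=.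
rewrite -(fineK (fin _ _ hmu bB)) -(fineK (fin _ _ hH bB)) -(fineK (cell_fin 0 hmu)).
rewrite -(fineK (cell_fin 0 hH)) -(fineK (fin _ _ hmu (@unit_cube_bounded k.+1))).
rewrite -(fineK (fin _ _ hH (@unit_cube_bounded k.+1))) /=.
set b1 := fine _; set b2 := fine _; set q1 := fine _; set q2 := fine _.
set c1 := fine _; set c2 := fine _.
rewrite -!EFinM lte_fin => -[e1] [e2] q0; congr EFin.
apply: (mulIf (lt0r_neq0 q0)).
by rewrite mulrAC e1 -!mulrA e2 [(q2 * c2)%R]mulrC.
Qed.

(** Pieces of a partition are differences of closed sets. *)
Lemma homogeneous_unique_diff k (mu : {outer_measure set 'rV[R]_k.+1 -> \bar R}) B B' :
  homogeneous mu -> closed B -> closed B' -> B' `<=` B -> ebounded B ->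
  mu (B `\` B') * cube_measure k.+1 = hausdorff k.+1 (B `\` B') * mu (@unit_cube R k.+1).
Proof.
move=> hmu cB cB' B'B bB; have hH := homogeneous_hausdorff k.
have bB' : ebounded B' by case: bB => M BM; exists M => x /B'B; exact: BM.
have bD : ebounded (B `\` B') by case: bB => M BM; exists M => x [Bx _]; exact: BM.
have fin (nu : {outer_measure set 'rV[R]_k.+1 -> \bar R}) X : homogeneous nu -> ebounded X ->
    nu X \is a fin_num.
  by move=> hnu bX; rewrite ge0_fin_numE ?outer_measure_ge0 // (homogeneous_fin hnu).
have split (nu : {outer_measure set 'rV[R]_k.+1 -> \bar R}) : homogeneous nu ->
    nu (B `\` B') = nu B - nu B'.
  move=> hnu; have := closed_caratheodory hnu cB' B.
  have -> : B `&` B' = B' by apply/setIidPr.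
  by rewrite -setDE => ->; rewrite addeAC subee ?fin ?add0e.
rewrite (split mu) // (split (@hausdorff R k.+1 k.+1)) //=.
rewrite muleBl ?cube_measure_fin ?fin_num_adde_defr ?fin //.
rewrite muleBl ?fin_num_adde_defr ?(fin _ _ hH) ?(fin _ _ hmu) //; last exact: unit_cube_bounded.
by rewrite !homogeneous_unique.
Qed.

End CubeNormalization.

(** * The measure of sheared cylinders *)

Section ConsRow.
Context {R : realType} {k : nat}.
Implicit Types (s t : R) (x y : 'rV[R]_k).

Definition cons_row s y : 'rV[R]_k.+1 :=
  \row_i (if unlift ord0 i is Some j then y 0 j else s).

Definition tail_row (x : 'rV[R]_k.+1) : 'rV[R]_k := \row_j x 0 (lift ord0 j).

Lemma cons_row0 s y : cons_row s y 0 ord0 = s.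
Proof. by rewrite mxE unlift_none. Qed.

Lemma cons_rowS s y j : cons_row s y 0 (lift ord0 j) = y 0 j.
Proof. by rewrite mxE liftK. Qed.

Lemma cons_tail (x : 'rV[R]_k.+1) : cons_row (x 0 ord0) (tail_row x) = x.
Proof.
by apply/rowP => i; case: (unliftP ord0 i) => [j|] ->; rewrite ?cons_rowS ?cons_row0 ?mxE.
Qed.

Lemma tail_cons s y : tail_row (cons_row s y) = y.
Proof. by apply/rowP => j; rewrite mxE cons_rowS. Qed.

Lemma cons_rowD s t x y : cons_row s x + cons_row t y = cons_row (s + t) (x + y).
Proof.
by apply/rowP => i; case: (unliftP ord0 i) => [j|] ->; rewrite mxE ?cons_rowS ?cons_row0 ?mxE.
Qed.

Lemma cons_rowZ a s y : a *: cons_row s y = cons_row (a * s) (a *: y).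
Proof.
by apply/rowP => i; case: (unliftP ord0 i) => [j|] ->; rewrite mxE ?cons_rowS ?cons_row0 ?mxE.
Qed.

Lemma cons_row00 : cons_row 0 0 = 0.
Proof.
by apply/rowP => i; case: (unliftP ord0 i) => [j|] ->; rewrite ?cons_rowS ?cons_row0 !mxE.
Qed.

Lemma cons_rowB s t x y : cons_row s x - cons_row t y = cons_row (s - t) (x - y).
Proof. by rewrite -scaleN1r cons_rowZ cons_rowD mulN1r scaleN1r. Qed.

Lemma dot_cons s t x y : dot (cons_row s x) (cons_row t y) = s * t + dot x y.
Proof.
rewrite /dot big_ord_recl !cons_row0; congr (_ + _).
by apply: eq_bigr => j _; rewrite !cons_rowS.
Qed.

Lemma dot_tail (x y : 'rV[R]_k.+1) :
  dot x y = x 0 ord0 * y 0 ord0 + dot (tail_row x) (tail_row y).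
Proof. by rewrite -{1}(cons_tail x) -{1}(cons_tail y) dot_cons. Qed.

Lemma ler_enorm_tail (x : 'rV[R]_k.+1) : enorm (tail_row x) <= enorm x.
Proof. by rewrite ler_sqrt ?dot_ge0 // dot_tail lerDr -expr2 sqr_ge0. Qed.

Lemma ler_enorm_cons s y : enorm (cons_row s y) <= `|s| + enorm y.
Proof.
rewrite -(@ler_pXn2r _ 2) ?nnegrE ?addr_ge0 ?enorm_ge0 // sqr_enorm dot_cons.
rewrite sqrrD sqr_enorm real_normK ?num_real // -expr2.
have : 0 <= `|s| * enorm y by rewrite mulr_ge0 ?enorm_ge0.
lra.
Qed.

End ConsRow.

Section LinearImages.
Local Open Scope ereal_scope.
Context {R : realType} {k : nat}.
Implicit Types (S : 'rV[R]_k.+1 -> 'rV[R]_k.+1).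

Lemma homogeneous_linear S (L : R) : (0 < L)%R ->
  (forall x y, S (x + y)%R = S x + S y)%R ->
  (forall x, enorm (S x) <= L * enorm x)%R -> (forall x, enorm x <= L * enorm (S x))%R ->
  homogeneous (spread (@hausdorff R k.+1 k.+1) (fun x => [set S x])).
Proof.
move=> L0 SD SL LS.
have SB x y : (S (x - y) = S x - S y)%R by apply/eqP; rewrite eq_sym subr_eq -SD subrK.
split=> [v X|i|X [M XM]].
- rewrite /= /spread !bigcup_imset1.
  transitivity (hausdorff k.+1 [set (x + S v)%R | x in [set S x | x in X]]).
    congr hausdorff; apply/seteqP; split=> [_ [_ [x Xx <-] <-]|_ [_ [x Xx <-] <-]].
      by exists (S x); [exists x|rewrite SD].
    by exists (x + v)%R; [exists x|rewrite SD].
  by rewrite (homogeneous_shift (homogeneous_hausdorff k)).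
- apply: separates_spread => c d cd; exists ((d - c) / L)%R; first by rewrite divr_gt0 ?subr_gt0.
  move=> x y _ _ xc dy -> ->; rewrite ler_pdivrMr // mulrC enormC -SB.
  apply: le_trans (LS _); apply: le_trans (ler_coord_enorm _ i).
  by apply: le_trans (ler_norm _); rewrite !mxE lerB.
- rewrite /= /spread bigcup_imset1; apply: hausdorff_bounded; exists (L * M)%R.
  by move=> _ [x Xx <-]; apply: le_trans (SL _) _; rewrite ler_pM2l // XM.
Qed.

End LinearImages.

Section Shear.
Context {R : realType} {k : nat}.
Implicit Types (w : 'rV[R]_k) (x : 'rV[R]_k.+1).

Definition shear w x : 'rV[R]_k.+1 := (x + x ord0 ord0 *: cons_row 0 w)%R.

Lemma shearD w x y : (shear w (x + y) = shear w x + shear w y)%R.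
Proof. by rewrite /shear mxE scalerDl addrACA. Qed.

Lemma shearK w : cancel (shear w) (shear (- w)).
Proof.
move=> x; rewrite /shear !mxE unlift_none mulr0 addr0 -addrA -scalerDr cons_rowD addr0 subrr.
by rewrite cons_row00 scaler0 addr0.
Qed.

Lemma ler_enorm_shear w x : (enorm (shear w x) <= (1 + enorm w) * enorm x)%R.
Proof.
apply: le_trans (ler_enormD _ _) _; rewrite mulrDl mul1r lerD2l enormZ mulrC.
rewrite ler_pM ?enorm_ge0 ?ler_coord_enorm //.
by apply: le_trans (ler_enorm_cons _ _) _; rewrite normr0 add0r.
Qed.

Lemma homogeneous_shear w : homogeneous (spread (@hausdorff R k.+1 k.+1) (fun x => [set shear w x])).
Proof.
apply: (@homogeneous_linear _ _ _ (1 + enorm w)%R).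
- by rewrite ltr_wpDr ?enorm_ge0.
- exact: shearD.
- exact: ler_enorm_shear.
- by move=> x; have := ler_enorm_shear (- w) (shear w x); rewrite shearK enormN.
Qed.

Lemma shear_continuous w : continuous (shear w).
Proof.
move=> x; apply: (@continuousD _ _ _ id (fun z : 'rV[R]_k.+1 => z ord0 ord0 *: cons_row 0 w)).
  exact: cvg_id.
by apply: continuousZr_tmp; exact: coord_continuous.
Qed.

End Shear.

Section ShearMeasure.
Local Open Scope ereal_scope.
Context {R : realType}.

Lemma mule_cancelr (x y c : \bar R) : c \is a fin_num -> 0 < c -> x * c = y * c -> x = y.
Proof.
move=> cfin c0 xy; apply/eqP; rewrite eq_le.
by rewrite -(lee_pmul2r cfin c0) -[X in _ && X](lee_pmul2r cfin c0) xy lexx.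
Qed.

Lemma hausdorff_shift k (v : 'rV[R]_k.+1) (X : set 'rV[R]_k.+1) :
  hausdorff k.+1 [set (x + v)%R | x in X] = hausdorff k.+1 X.
Proof. exact: (homogeneous_shift (homogeneous_hausdorff k)). Qed.

Lemma image_shearK k (w : 'rV[R]_k) X : shear (- w)%R @` (shear w @` X) = X.
Proof.
apply/seteqP; split=> [_ [_ [x Xx <-] <-]|x Xx]; first by rewrite shearK.
by exists (shear w x); [exists x|rewrite shearK].
Qed.

Lemma image_shear_preimage k (w : 'rV[R]_k) X : shear w @` X = shear (- w)%R @^-1` X.
Proof.
apply/seteqP; split=> [_ [x Xx <-]|y Xy]; first by rewrite /preimage /= shearK.
by exists (shear (- w)%R y) => //; rewrite -{1}(opprK w) shearK.
Qed.

Lemma closed_shear k (w : 'rV[R]_k) X : closed X -> closed (shear w @` X).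
Proof.
move=> cX; rewrite image_shear_preimage; apply: preimage_closed => // x _.
exact: shear_continuous.
Qed.

Lemma ebounded_shear k (w : 'rV[R]_k) X : ebounded X -> ebounded (shear w @` X).
Proof.
move=> [M XM]; exists ((1 + enorm w) * M)%R => _ [x Xx <-].
apply: le_trans (ler_enorm_shear _ _) _; apply: ler_wpM2l; last exact: XM.
by rewrite addr_ge0 ?enorm_ge0.
Qed.

Definition flip {k} (x : 'rV[R]_k.+1) : 'rV[R]_k.+1 := cons_row (- x ord0 ord0)%R (tail_row x).

Lemma flip_isometry k (x y : 'rV[R]_k.+1) : enorm (flip x - flip y)%R = enorm (x - y)%R.
Proof.
rewrite /enorm cons_rowB dot_cons [in RHS]dot_tail; congr Num.sqrt; congr (_ + _)%R.
  by rewrite !mxE -opprD mulrNN.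
by congr dot; apply/rowP => j; rewrite !mxE.
Qed.

Lemma shear_flip k (w : 'rV[R]_k) x : shear (- w)%R x = flip (shear w (flip x)).
Proof.
rewrite -[x in LHS]cons_tail -[flip x]cons_tail /shear !cons_row0 !cons_rowZ !cons_rowD.
rewrite /flip !cons_row0 !tail_cons !mulr0 !addr0 !opprK; congr cons_row.
by rewrite scalerN scaleNr.
Qed.

Lemma flip_cube k (x : 'rV[R]_k.+1) : unit_cube (flip x) <->
  unit_cube (x + cons_row 1 0)%R.
Proof.
have E i : flip x 0%R i = (if i == ord0 then - x ord0 ord0 else x 0 i)%R.
  by case: (unliftP ord0 i) => [j|] ->; rewrite ?cons_rowS ?cons_row0 ?mxE.
have E' i : ((x + cons_row 1 0) 0 i = if i == ord0 then x ord0 ord0 + 1 else x 0 i)%R.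
  rewrite mxE; case: (unliftP ord0 i) => [j|] ->; rewrite ?cons_rowS ?cons_row0 ?mxE ?addr0 //.
by split=> Qx i; have := Qx i; rewrite E E'; case: ifP => // _; lra.
Qed.

(** A shear is conjugate to its inverse by the reflection [flip], so that both
multiply the measure by the same factor; hence this factor is 1. *)
Lemma hausdorff_shear_cube k (w : 'rV[R]_k) :
  hausdorff k.+1 (shear w @` @unit_cube R k.+1) = cube_measure k.+1.
Proof.
pose Q := @unit_cube R k.+1.
have sh v X : spread (@hausdorff R k.+1 k.+1) (fun x => [set shear v x]) X =
    hausdorff k.+1 (shear v @` X) by rewrite /spread bigcup_imset1.
have e1 := homogeneous_unique (homogeneous_shear (- w)%R)
  (@closed_shear _ w _ (@unit_cube_closed R k.+1)) (@ebounded_shear _ w _ (@unit_cube_bounded R k.+1)).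
have e2 : hausdorff k.+1 (shear (- w)%R @` Q) = hausdorff k.+1 (shear w @` Q).
  have -> : shear (- w)%R @` Q = flip @` (shear w @` (flip @` Q)).
    apply/seteqP; split=> [_ [x Qx <-]|_ [_ [_ [x Qx <-] <-] <-]].
      by rewrite shear_flip; exists (shear w (flip x)) => //; exists (flip x) => //; exists x.
    by rewrite -shear_flip; exists x.
  rewrite hausdorff_isometry => [|x y _ _]; last exact: flip_isometry.
  have -> : flip @` Q = [set (x + - cons_row 1 0)%R | x in Q].
    apply/seteqP; split=> [_ [x Qx <-]|_ [x Qx <-]].
      exists (flip x + cons_row 1 0)%R; last by rewrite addrK.
      apply/flip_cube; rewrite (_ : flip (flip x) = x) // /flip cons_row0 tail_cons opprK.
      exact: cons_tail.
    exists (flip (x - cons_row 1 0))%R; last first.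
      by rewrite {1}/flip cons_row0 tail_cons opprK; exact: cons_tail.
    by apply/flip_cube; rewrite subrK.
  rewrite (_ : shear w @` _ = [set (x + shear w (- cons_row 1 0))%R | x in shear w @` Q]).
    exact: hausdorff_shift.
  apply/seteqP; split=> [_ [_ [x Qx <-] <-]|_ [_ [x Qx <-] <-]].
    by exists (shear w x); [exists x|rewrite -shearD].
  by exists (x - cons_row 1 0)%R; [exists x|rewrite -shearD].
move: e1; rewrite /= !sh e2 image_shearK -/(cube_measure _).
have fin : hausdorff k.+1 (shear w @` Q) \is a fin_num.
  by rewrite ge0_fin_numE ?hausdorff_ge0 // hausdorff_bounded //; exact/ebounded_shear/unit_cube_bounded.
have := hausdorff_ge0 k.+1 (shear w @` Q); have := @cube_measure_gt0 R k.+1.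
rewrite -(fineK fin) -(fineK (cube_measure_fin k)) -!EFinM lte_fin lee_fin.
set h := fine (hausdorff _ (shear w @` Q)); set C := fine (cube_measure _) => C0 h0 [hC]; congr EFin.
have hC0 : ((h - C) * (h + C) = 0)%R by rewrite -subr_sqr !expr2 hC subrr.
have /mulIf : (h + C != 0)%R by rewrite gt_eqF // ltr_wpDl.
by move=> /(_ (h - C) 0)%R; rewrite hC0 mul0r => /(_ erefl) /eqP; rewrite subr_eq0 => /eqP.
Qed.

Lemma hausdorff_shear k (w : 'rV[R]_k) K : closed K -> ebounded K ->
  hausdorff k.+1 (shear w @` K) = hausdorff k.+1 K.
Proof.
move=> cK bK; have := homogeneous_unique (homogeneous_shear w) cK bK.
rewrite /= /spread !bigcup_imset1 hausdorff_shear_cube.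
by apply: mule_cancelr; [exact: cube_measure_fin|exact: cube_measure_gt0].
Qed.

End ShearMeasure.

Section Prism.
Context {R : realType}.

(** An additive nonnegative function is monotone, and monotone additive functions
are linear: compare at the multiples of [1 / n]. *)
Lemma additive_linear (phi : R -> R) : (forall s, 0 <= s -> 0 <= phi s) ->
  (forall s t, 0 <= s -> 0 <= t -> phi (s + t) = phi s + phi t) ->
  forall s, 0 <= s -> phi s = s * phi 1.
Proof.
move=> phi0 phiD s s0; have phi00 : phi 0 = 0.
  by have := phiD 0 0 (lexx _) (lexx _); rewrite addr0; lra.
have phiM n t : 0 <= t -> phi (n%:R * t) = n%:R * phi t.
  move=> t0; elim: n => [|n ih]; first by rewrite !mul0r.
  by rewrite -natr1 !mulrDl !mul1r phiD ?mulr_ge0 // ih.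
have mono t u : 0 <= t -> t <= u -> phi t <= phi u.
  move=> t0 tu; rewrite -(subrK t u) addrC phiD ?subr_ge0 // lerDl.
  by apply: phi0; rewrite subr_ge0.
have p1 := phi0 1 ler01.
have near n : n%:R * `|phi s - s * phi 1| <= phi 1.
  have ns0 : 0 <= n%:R * s by rewrite mulr_ge0.
  have /andP[k1 k2] := Num.Theory.truncn_itv ns0; set k := Num.truncn _ in k1 k2.
  have l1 := mono _ _ (ler0n R k) k1; have l2 := mono _ _ ns0 (ltW k2).
  move: l1 l2; rewrite -[k%:R]mulr1 -[k.+1%:R]mulr1 !phiM ?ler01 // -natr1 => l1 l2.
  rewrite -[n%:R]ger0_norm // -normrM ler_norml; nra.
apply/eqP; rewrite -subr_eq0 -normr_eq0; apply/eqP/le_anti; rewrite normr_ge0 andbT.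
rewrite leNgt; apply/negP => d0.
have := near (Num.truncn (phi 1 / `|phi s - s * phi 1|)).+1.
rewrite leNgt => /negP; apply; rewrite -ltr_pdivrMr //; exact: Num.Theory.truncnS_gt.
Qed.

Local Open Scope ereal_scope.
Context {k : nat}.

Definition prism (I : set R) : set 'rV[R]_k.+1 :=
  \bigcup_(t in I) [set cons_row t y | y in @unit_cube R k].

Lemma prism_ebounded (I : set R) (M : R) : (forall t, I t -> `|t| <= M)%R ->
  ebounded (prism I).
Proof.
move=> IM; have [N QN] := @unit_cube_bounded R k.
exists (M + N)%R => _ [t It [y Qy <-]]; apply: le_trans (ler_enorm_cons _ _) _.
by apply: lerD; [exact: IM|exact: QN].
Qed.

Lemma prism_unit : prism `[0%R, 1%R] = @unit_cube R k.+1.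
Proof.
apply/seteqP; split=> [_ [t + [y Qy <-]]|x Qx].
  rewrite /= in_itv /= => t01 i.
  by case: (unliftP ord0 i) => [j|] ->; rewrite ?cons_rowS ?cons_row0.
exists (x ord0 ord0); first by rewrite /= in_itv /=; exact: Qx.
by exists (tail_row x); [move=> j; rewrite mxE; exact: Qx|rewrite cons_tail].
Qed.

Lemma prism_closed (u v : R) : closed (prism `[u, v]).
Proof.
rewrite (_ : prism _ = (fun x : 'rV[R]_k.+1 => x ord0 ord0) @^-1` `[u, v] `&`
   \bigcap_(i in [set: 'I_k]) (fun x : 'rV[R]_k.+1 => x ord0 (lift ord0 i)) @^-1` `[0%R, 1%R]).
  apply: closedI.
    by apply: preimage_closed; [move=> x _; exact: coord_continuous|exact: itv_closed].
  apply: closed_bigI => i _.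
  by apply: preimage_closed; [move=> x _; exact: coord_continuous|exact: itv_closed].
apply/seteqP; split=> [_ [t It [y Qy <-]]|x [Ix Qx]].
  split=> [|i _]; first by rewrite /preimage /= cons_row0.
  by rewrite /preimage /= cons_rowS in_itv /= Qy.
exists (x ord0 ord0) => //; exists (tail_row x); last by rewrite cons_tail.
by move=> i; have := Qx i I; rewrite /preimage /= in_itv /= mxE.
Qed.

Let mu : {outer_measure set R -> \bar R} :=
  spread (@hausdorff R k.+1 k.+1) (fun t => [set cons_row t y | y in @unit_cube R k]).

Let muE I : mu I = hausdorff k.+1 (prism I).
Proof. by []. Qed.

Let mu_shift s I : mu [set (t + s)%R | t in I] = mu I.
Proof.
rewrite !muE -(hausdorff_shift (cons_row s 0) (prism I)); congr hausdorff.
apply/seteqP; split=> [_ [_ [t It <-] [y Qy <-]]|_ [_ [t It [y Qy <-]] <-]].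
  exists (cons_row t y); first by exists t => //; exists y.
  by rewrite cons_rowD addr0.
rewrite cons_rowD addr0; exists (t + s)%R; first by exists t.
by exists y.
Qed.

Let mu_fin (u v : R) : mu `]u, v]%classic \is a fin_num.
Proof.
rewrite ge0_fin_numE ?outer_measure_ge0 // muE hausdorff_bounded //.
apply: (@prism_ebounded _ (`|u| + `|v|)%R) => t /=; rewrite in_itv /= => /andP[ut tv].
have := ler_norm v; have := ler_norm (- u)%R; rewrite normrN ler_norml => h1 h2.
have u0 := normr_ge0 u; have v0 := normr_ge0 v.
by apply/andP; split; lra.
Qed.

Let mu_split (u v w : R) : (u <= v)%R -> (v <= w)%R ->
  mu `]u, w]%classic = mu `]u, v]%classic + mu `]v, w]%classic.
Proof.
move=> uv vw; have /measurable_sublevel M : separates mu id.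
  apply: separates_spread => c d cd; exists (d - c)%R; first by rewrite subr_gt0.
  move=> x y _ _ xc dy [y1 _ <-] [y2 _ <-]; rewrite enormC.
  apply: le_trans (ler_coord_enorm _ ord0); apply: le_trans (ler_norm _).
  by rewrite cons_rowB cons_row0 lerB.
rewrite (M v); congr (mu _ + mu _); apply/seteqP; split=> t /=; rewrite !in_itv /=.
- by move=> [/andP[-> _] ->].
- by move=> /andP[ut tv]; rewrite ut tv; split => //; exact: le_trans vw.
- by move=> [/andP[_ ->] /negP]; rewrite -ltNge => ->.
- move=> /andP[vt ->]; split; first by rewrite andbT (le_lt_trans uv).
  by apply/negP; rewrite -ltNge.
Qed.

Let mu_itv (u v : R) : (u <= v)%R -> mu `]u, v]%classic = ((v - u) * fine (mu `]0%R, 1%R]%classic))%:E.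
Proof.
move=> uv; have sh (s : R) : (0 <= s)%R -> forall a, mu `]a, (a + s)%R]%classic = mu `]0%R, s]%classic.
  move=> s0 a; rewrite -(mu_shift a `]0%R, s]%classic); congr (mu _); apply/seteqP; split=> t /=.
    rewrite in_itv /= => /andP[t1 t2]; exists (t - a)%R; last by rewrite subrK.
    by rewrite in_itv /=; apply/andP; split; lra.
  by move=> [s' + <-]; rewrite !in_itv /= => /andP[t1 t2]; apply/andP; split; lra.
rewrite -(@additive_linear (fun s => fine (mu `]0%R, s]%classic))).
- rewrite fineK ?mu_fin // -(sh (v - u)%R _ u) ?subr_ge0 //.
  by congr (mu _); rewrite addrC subrK.
- by move=> s s0; rewrite fine_ge0 // outer_measure_ge0.
- move=> s t s0 t0; rewrite -fineD ?mu_fin // (@mu_split 0 s (s + t)) ?lerDl //.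
  by rewrite sh.
- by rewrite subr_ge0.
Qed.

(* the end points carry no measure, because of the linear growth of the half-open
   intervals around them *)
Let mu_between (u v : R) I : (u <= v)%R -> `]u, v[ `<=` I -> I `<=` `[u, v] ->
  mu I = ((v - u) * fine (mu `]0%R, 1%R]%classic))%:E.
Proof.
move=> uv uI Iv; set p := fine _.
have p0 : (0 <= p)%R by rewrite fine_ge0 // outer_measure_ge0.
apply/eqP; rewrite eq_le; apply/andP; split.
  apply/lee_addgt0Pr => e e0; pose d := (e / (p + 1))%R.
  have d0 : (0 < d)%R by rewrite divr_gt0 // ltr_wpDl.
  apply: le_trans (_ : mu `](u - d)%R, v]%classic <= _).
    apply: le_outer_measure => t /Iv /=; rewrite !in_itv /= => /andP[t1 t2].
    by apply/andP; split; lra.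
  rewrite mu_itv; last by lra.
  rewrite -EFinD lee_fin -/p.
  have : (d * p <= e)%R by rewrite mulrAC ler_pdivrMr ?ltr_wpDl // ler_pM2l // lerDl.
  by lra.
apply/lee_addgt0Pr => e e0; pose d := (e / (p + 1))%R.
have d0 : (0 < d)%R by rewrite divr_gt0 // ltr_wpDl.
have dp : (d * p <= e)%R by rewrite mulrAC ler_pdivrMr ?ltr_wpDl // ler_pM2l // lerDl.
have [duv|uvd] := leP d (v - u)%R.
  apply: (@le_trans _ _ (mu `]u, (v - d)%R]%classic + e%:E)).
    rewrite mu_itv; last by lra.
    by rewrite -EFinD lee_fin -/p; lra.
  apply: leeD2r; apply: le_outer_measure => t /=; rewrite in_itv /= => /andP[t1 t2].
  by apply: uI; rewrite /= in_itv /=; apply/andP; split; lra.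
apply: (@le_trans _ _ e%:E); last by rewrite leeDr // outer_measure_ge0.
rewrite lee_fin; apply: le_trans dp; apply: ler_wpM2r => //; exact: ltW.
Qed.

(** By translation, the measure of a prism is an additive function of its height;
the prism of height 1 is the unit cube. *)
Lemma hausdorff_prism (u v : R) : (u <= v)%R ->
  hausdorff k.+1 (prism `[u, v]) = (v - u)%:E * cube_measure k.+1.
Proof.
have oc (a b : R) : `]a, b[ `<=` `[a, b].
  by move=> t; rewrite /= !in_itv /= => /andP[/ltW -> /ltW ->].
move=> uv; rewrite -muE (mu_between uv (@oc u v) (@subset_refl _ _)).
rewrite /cube_measure -prism_unit -muE (mu_between ler01 (@oc 0 1) (@subset_refl _ _))%R.
by rewrite subr0 mul1r EFinM.
Qed.

End Prism.

Section Swept.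
Context {R : realType} {k : nat}.
Implicit Types (w y : 'rV[R]_k.+1) (I : set R).

(** The point of height [c * t] above [y] on a line of direction [cons_row c w]:
the model, in flat space, of the tube map near a point. *)
Definition oblique (c : R) w y (t : R) : 'rV[R]_k.+2 := cons_row (c * t) (y + t *: w).

Lemma obliqueB c w y y' t t' :
  oblique c w y t - oblique c w y' t' = oblique c w (y - y') (t - t').
Proof.
rewrite /oblique cons_rowB; congr cons_row; first by rewrite mulrBr.
by rewrite opprD addrACA -scalerBl.
Qed.

Lemma ler_oblique c w y t : 0 < c ->
  `|t| <= c^-1 * enorm (oblique c w y t) /\
  enorm y <= (1 + c^-1 * enorm w) * enorm (oblique c w y t).
Proof.
move=> c0; have tc : `|t| <= c^-1 * enorm (oblique c w y t).
  rewrite ler_pdivlMl //; apply: le_trans (ler_coord_enorm _ ord0).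
  by rewrite cons_row0 normrM gtr0_norm.
split=> //; rewrite -[y in leLHS](addrK (t *: w)); apply: le_trans (ler_enormB _ _) _.
rewrite mulrDl mul1r lerD //.
  by have := ler_enorm_tail (oblique c w y t); rewrite tail_cons.
by rewrite enormZ mulrAC ler_wpM2r ?enorm_ge0.
Qed.

Lemma enorm_oblique c w y t : enorm (oblique c w y t) <= `|c * t| + enorm y + `|t| * enorm w.
Proof.
apply: le_trans (ler_enorm_cons _ _) _; rewrite -addrA lerD2l.
by apply: le_trans (ler_enormD _ _) _; rewrite enormZ.
Qed.

Local Open Scope ereal_scope.

Definition swept c w I y := [set oblique c w y t | t in I].

Lemma homogeneous_swept c w I (M : R) : (0 < c)%R -> (forall t, I t -> `|t| <= M)%R ->
  homogeneous (spread (@hausdorff R k.+2 k.+2) (swept c w I)).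
Proof.
move=> c0 IM; split=> [v X|i|X [N XN]].
- rewrite /= /spread -(hausdorff_shift (cons_row 0 v) (\bigcup_(x in X) swept c w I x)).
  congr hausdorff.
  apply/seteqP; split=> [_ [_ [y Xy <-] [t It <-]]|_ [_ [y Xy [t It <-]] <-]].
    exists (oblique c w y t); first by exists y => //; exists t.
    by rewrite /oblique cons_rowD addr0 addrAC.
  exists (y + v)%R; first by exists y.
  by exists t => //; rewrite /oblique cons_rowD addr0 addrAC.
- apply: separates_spread => a b ab; pose L := (1 + c^-1 * enorm w)%R.
  have L0 : (0 < L)%R.
    by rewrite ltr_wpDr // mulr_ge0 ?enorm_ge0 // invr_ge0 ltW.
  exists ((b - a) / L)%R; first by rewrite divr_gt0 ?subr_gt0.
  move=> x y _ _ xa yb [t _ <-] [s _ <-]; rewrite ler_pdivrMr // mulrC enormC obliqueB.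
  apply: le_trans (ler_oblique _ _ _ c0).2.
  apply: le_trans (ler_coord_enorm _ i); apply: le_trans (ler_norm _).
  by rewrite !mxE lerB.
- apply: hausdorff_bounded; exists (c * M + N + M * enorm w)%R.
  move=> _ [y Xy [t It <-]]; apply: le_trans (enorm_oblique _ _ _ _) _.
  rewrite normrM gtr0_norm // !lerD ?ler_pM2l ?IM ?XN //.
  by rewrite ler_wpM2r ?enorm_ge0 ?IM.
Qed.

(** An oblique cylinder over the cube is a sheared prism. *)
Lemma swept_cube_closed c w (u v : R) : (0 < c)%R -> (u <= v)%R ->
  spread (@hausdorff R k.+2 k.+2) (swept c w `[u, v]) (@unit_cube R k.+1) =
    (c * (v - u))%:E * cube_measure k.+2.
Proof.
move=> c0 uv; rewrite /spread.
have -> : \bigcup_(y in @unit_cube R k.+1) swept c w `[u, v] y =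
    shear (c^-1 *: w)%R @` prism `[(c * u)%R, (c * v)%R].
  have E t y : oblique c w y t = shear (c^-1 *: w)%R (cons_row (c * t)%R y).
    rewrite /shear cons_row0 cons_rowZ cons_rowD mulr0 addr0 scalerA mulrAC divff ?gt_eqF //.
    by rewrite mul1r.
  apply/seteqP; split=> [_ [y Qy [t + <-]]|_ [_ [s + [y Qy <-]] <-]]; rewrite /= in_itv /=.
    move=> tuv; exists (cons_row (c * t)%R y) => //.
    exists (c * t)%R; last by exists y.
    by rewrite /= in_itv /= !ler_pM2l.
  move=> suv; exists y => //; exists (s / c)%R.
    by rewrite /= in_itv /= ler_pdivlMr // ler_pdivrMr // mulrC [(v * c)%R]mulrC.
  by rewrite E mulrC divfK ?gt_eqF.
rewrite hausdorff_shear; first by rewrite hausdorff_prism ?ler_pM2l // mulrBr.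
  exact: prism_closed.
apply: (@prism_ebounded _ _ _ (`|c * u| + `|c * v|)%R) => t; rewrite /= in_itv /= => /andP[t1 t2].
have h1 := ler_norm (c * v)%R; have h2 := ler_norm (- (c * u))%R.
have h3 := normr_ge0 (c * u)%R; have h4 := normr_ge0 (c * v)%R.
by move: h2; rewrite normrN ler_norml => h2; apply/andP; split; lra.
Qed.

(** Closed intervals serve for upper bounds, half-open ones for lower bounds; both
are covered by this notion. *)
Definition between (u v : R) I := `]u, v[ `<=` I /\ I `<=` `[u, v].

Lemma between_bound u v I : between u v I -> forall t, I t -> (`|t| <= `|u| + `|v|)%R.
Proof.
move=> [_ Iv] t /Iv; rewrite /= in_itv /= => /andP[t1 t2].
have h1 := ler_norm v; have h2 := ler_norm (- u)%R.
have h3 := normr_ge0 u; have h4 := normr_ge0 v.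
by move: h2; rewrite normrN ler_norml => h2; apply/andP; split; lra.
Qed.

Lemma swept_cube c w (u v : R) I : (0 < c)%R -> (u <= v)%R -> between u v I ->
  spread (@hausdorff R k.+2 k.+2) (swept c w I) (@unit_cube R k.+1) =
    (c * (v - u))%:E * cube_measure k.+2.
Proof.
move=> c0 uv [uI Iv]; set m := spread _ _ _.
have sub J J' : J `<=` J' ->
    spread (@hausdorff R k.+2 k.+2) (swept c w J) (@unit_cube R k.+1) <=
    spread (@hausdorff R k.+2 k.+2) (swept c w J') (@unit_cube R k.+1).
  move=> JJ'; apply: le_hausdorff; apply: subset_bigcup => y _ _ [t Jt <-].
  by exists t => //; exact: JJ'.
apply/eqP; rewrite eq_le; apply/andP; split.
  by rewrite -(swept_cube_closed w c0 uv); exact: sub.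
have C0 := @cube_measure_gt0 R k.+2.
rewrite -(fineK (@cube_measure_fin R k.+1)) -EFinM; set C := fine _.
have {}C0 : (0 < C)%R by rewrite fine_gt0 // C0 -ge0_fin_numE ?hausdorff_ge0 // cube_measure_fin.
apply/lee_addgt0Pr => e e0; pose d := (e / (2 * c * C))%R.
have d0 : (0 < d)%R by rewrite divr_gt0 // !mulr_gt0.
have dE : (c * (2 * d) * C = e)%R by rewrite /d; field; rewrite !gt_eqF.
have [duv|uvd] := leP (u + d)%R (v - d)%R.
  apply: (@le_trans _ _ (m + e%:E)) => //.
  apply: le_trans (_ : (c * (v - d - (u + d)))%:E * cube_measure k.+2 + e%:E <= _).
    rewrite -(fineK (@cube_measure_fin R k.+1)) -/C -EFinM -EFinD lee_fin -dE; lra.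
  apply: leeD2r; rewrite -(swept_cube_closed w c0 duv); apply: sub => t /=.
  by rewrite in_itv /= => /andP[t1 t2]; apply: uI; rewrite /= in_itv /=; apply/andP; split; lra.
apply: (@le_trans _ _ e%:E); last by rewrite leeDr // hausdorff_ge0.
by rewrite lee_fin -dE ler_pM2r // ler_pM2l //; lra.
Qed.

(** Cavalieri's principle: as a function of the base, the measure of an oblique
cylinder is homogeneous, hence proportional to the measure of the base, and the
factor is read off on the cube. *)
Lemma swept_measure c w (u v : R) I B B' : (0 < c)%R -> (u <= v)%R -> between u v I ->
  closed B -> closed B' -> B' `<=` B -> ebounded B ->
  hausdorff k.+2 (\bigcup_(y in B `\` B') swept c w I y) * cube_measure k.+1 =
  (c * (v - u))%:E * cube_measure k.+2 * hausdorff k.+1 (B `\` B').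
Proof.
move=> c0 uv bI cB cB' B'B bB.
have hS := homogeneous_swept w c0 (between_bound bI).
have := homogeneous_unique_diff hS cB cB' B'B bB.
by rewrite /= (swept_cube w c0 uv bI) => ->; rewrite muleC.
Qed.

End Swept.

(** * Local comparison of the tube with a sheared cylinder *)

Section Lipschitz.
Context {R : realType}.

Lemma ler_mxnorm_enorm m (x : 'rV[R]_m) : `|x| <= enorm x.
Proof.
rewrite /Num.norm /= mx_normrE; apply/bigmax_leP; split; first exact: enorm_ge0.
by move=> -[i j] _ /=; rewrite (ord1 i) ler_coord_enorm.
Qed.

Lemma ler_enorm_mxnorm m (x : 'rV[R]_m) : enorm x <= m%:R * `|x|.
Proof.
apply: le_trans (ler_enorm_coords _) _; apply: ler_sum_ord_const => i.
rewrite /Num.norm /= mx_normrE.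
by apply: (le_trans _ (le_bigmax _ _ (ord0, i))).
Qed.

Lemma lipschitz_continuous_enorm m p (F : 'rV[R]_m -> 'rV[R]_p) (L : R) :
  (forall x y, enorm (F x - F y) <= L * enorm (x - y)) -> continuous F.
Proof.
move=> FL x A /nbhs_ballP [e /= e0 eA].
pose K := `|L| * m%:R + 1; have K0 : 0 < K by rewrite ltr_wpDl // mulr_ge0.
apply/nbhs_ballP; exists (e / K) => [|y]; first exact: divr_gt0.
rewrite -ball_normE /= => xy; apply: eA; rewrite -ball_normE /=.
apply: le_lt_trans (ler_mxnorm_enorm _) _; apply: le_lt_trans (FL _ _) _.
apply: (@le_lt_trans _ _ (K * `|x - y|)); last by rewrite mulrC -ltr_pdivlMr.
apply: (@le_trans _ _ (`|L| * (m%:R * `|x - y|))).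
  apply: le_trans (ler_wpM2r (enorm_ge0 _) (ler_norm L)) _.
  by apply: ler_wpM2l => //; exact: ler_enorm_mxnorm.
by rewrite mulrA ler_wpM2r // lerDl.
Qed.

Lemma ebounded_bounded m (X : set 'rV[R]_m) : ebounded X -> bounded_set X.
Proof.
move=> [M XM]; exists M; split; first exact: num_real.
by move=> y My x Xx; apply: le_trans (ler_mxnorm_enorm _) _; apply: le_trans (XM _ Xx) (ltW My).
Qed.

Lemma compact_ebounded m (X : set 'rV[R]_m) : compact X -> ebounded X.
Proof.
move=> /compact_bounded [M [_ XM]]; exists (m%:R * (M + 1)) => x Xx.
apply: le_trans (ler_enorm_mxnorm _) _; apply: ler_wpM2l => //.
by apply: XM => //; rewrite ltrDl.
Qed.

Lemma ebounded_closed_compact m (X : set 'rV[R]_m) : ebounded X -> closed X -> compact X.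
Proof. by move=> /ebounded_bounded; exact: bounded_closed_compact. Qed.

(** Sets that are parametrized by the same index set are compared without
inverting either parametrization. *)
Lemma hausdorff_le_param k m p (T : Type) (Z : set T) (g : T -> 'rV[R]_m) (h : T -> 'rV[R]_p)
    (L : R) : 0 < L ->
  (forall z z', Z z -> Z z' -> enorm (h z - h z') <= L * enorm (g z - g z')) ->
  (hausdorff k (h @` Z) <= (L ^+ k)%:E * hausdorff k (g @` Z))%E.
Proof.
move=> L0 hg; have /choice [F FP] : forall x, exists y, forall z, Z z -> g z = x -> h z = y.
  move=> x; have [[z [Zz gz]]|n] := pselect (exists z, Z z /\ g z = x); last first.
    by exists 0 => z Zz gz; case: n; exists z.
  exists (h z) => z' Zz' gz'; apply/eqP; rewrite -subr_eq0; apply/eqP/enorm_eq0/le_anti.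
  by rewrite enorm_ge0 andbT (le_trans (hg _ _ Zz' Zz)) // gz gz' subrr enorm0 mulr0.
apply: (@hausdorff_lipschitz R m p k (g @` Z) (h @` Z) F L L0).
  by move=> _ [z Zz <-]; exists (g z); [exists z|rewrite (FP (g z) z)].
by move=> _ _ [z Zz <-] [z' Zz' <-]; rewrite -(FP (g z) z Zz erefl) -(FP (g z') z' Zz' erefl) hg.
Qed.

End Lipschitz.

Section Projection.
Context {R : realType} {k : nat}.

(** Reflection in the hyperplane orthogonal to [u]; the identity when [u] is 0. *)
Definition reflect_along (u x : 'rV[R]_k.+1) := x - (2 * dot x u / dot u u) *: u.

Lemma dot_reflect (u x y : 'rV[R]_k.+1) :
  dot (reflect_along u x) (reflect_along u y) = dot x y.
Proof.
rewrite /reflect_along !dotBl !dotBr !dotZl !dotZr (dotC u y).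
have [u0|u0] := eqVneq (dot u u) 0; last by field.
have /enorm_eq0 -> : enorm u = 0 by rewrite /enorm u0 sqrtr0.
by rewrite -(scale0r 0) !dotZr; ring.
Qed.

(** Coordinates on the hyperplane orthogonal to [x0]: reflect [x0] to the first
axis and drop the first coordinate. *)
Lemma orthogonal_projection (x0 : 'rV[R]_k.+1) (r : R) : 0 < r -> enorm x0 = r ->
  exists P : 'rV[R]_k.+1 -> 'rV[R]_k, [/\ forall x y, P (x + y) = P x + P y,
    forall a x, P (a *: x) = a *: P x
    & forall x, dot x x = (dot x x0 / r) ^+ 2 + dot (P x) (P x)].
Proof.
move=> r0 x0r; pose e : 'rV[R]_k.+1 := cons_row 1 0.
have x0x0 : dot x0 x0 = r ^+ 2 by rewrite -x0r sqr_enorm.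
have doteE x : dot x e = x 0 ord0.
  rewrite -[x in LHS]cons_tail dot_cons mulr1 (_ : dot _ _ = 0) ?addr0 //.
  by rewrite -(scale0r 0) dotZr mul0r.
have ee : dot e e = 1 by rewrite doteE cons_row0.
pose u := r^-1 *: x0 - e; pose H := reflect_along u.
have Hx0 : H x0 = r *: e.
  rewrite /H /reflect_along.
  have [u0|u0] := eqVneq (dot u u) 0.
    rewrite u0 invr0 mulr0 scale0r subr0.
    have /enorm_eq0 /eqP : enorm u = 0 by rewrite /enorm u0 sqrtr0.
    by rewrite subr_eq0 => /eqP <-; rewrite scalerA divff ?gt_eqF // scale1r.
  have uu : dot u u = 2 - 2 * (r^-1 * dot x0 e).
    rewrite /u !dotBl !dotBr !dotZl !dotZr (dotC e x0) ee x0x0; field.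
    by rewrite gt_eqF.
  have x0u : dot x0 u = r * (1 - r^-1 * dot x0 e).
    by rewrite /u dotBr dotZr x0x0; field; rewrite gt_eqF.
  have -> : 2 * dot x0 u / dot u u = r.
    rewrite x0u [in X in _ / X]uu; rewrite uu in u0; field.
    rewrite gt_eqF //= (_ : 2 * r - _ = r * (2 - 2 * (r^-1 * dot x0 e))).
      by apply: mulf_neq0 => //; rewrite gt_eqF.
    by field; rewrite gt_eqF.
  by rewrite /u scalerBr scalerA divff ?gt_eqF // scale1r opprB addrCA subrr addr0.
exists (fun x => tail_row (H x)); split=> [x y|s x|x].
- by apply/rowP => j; rewrite !mxE dotDl; ring.
- by apply/rowP => j; rewrite !mxE dotZl; ring.
- rewrite -(dot_reflect u) -/H [LHS]dot_tail -expr2; congr (_ ^+ 2 + _).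
  rewrite -doteE -[e](scalerK (lt0r_neq0 r0)) -Hx0 dotZr (dot_reflect u x x0).
  by rewrite mulrC.
Qed.

End Projection.

Section UniformDifferentiability.
Context {R : realType}.

(** Uniform strict differentiability: the derivative at [t0] controls all difference
quotients near [t0], which is what bi-Lipschitz estimates need. *)
Definition uniform_C1 m (a b : R) (g dg : R -> 'rV[R]_m) := forall e : R, 0 < e ->
  exists2 d : R, 0 < d & forall s t t0, a <= s <= b -> a <= t <= b -> a <= t0 <= b ->
    `|s - t0| < d -> `|t - t0| < d ->
    enorm (g s - g t - (s - t) *: dg t0) <= e * `|s - t|.

Lemma finite_common_radius (I : finType) (Q : I -> R -> Prop) :
  (forall i d d', d' <= d -> Q i d -> Q i d') ->
  (forall i, exists2 d : R, 0 < d & Q i d) -> exists2 d : R, 0 < d & forall i, Q i d.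
Proof.
move=> Qanti Qex; have /choice [d dP] : forall i, exists d, 0 < d /\ Q i d.
  by move=> i; have [d d0 Qd] := Qex i; exists d.
exists (\big[Num.min/1]_i d i).
  by elim/big_ind: _ => // [x y x0 y0|i _]; [rewrite lt_min x0|exact: (dP i).1].
by move=> i; apply: Qanti (dP i).2; exact: bigmin_le.
Qed.

End UniformDifferentiability.

Section Tube.
Context {R : realType} {q : nat}.
Implicit Types (X : 'rV[R]_q.+2) (t : R).

Definition tube (f : R -> 'rV[R]_q.+3) (W : 'I_q.+2 -> R -> 'rV[R]_q.+3) X t : 'rV[R]_q.+3 :=
  f t + \sum_j X 0 j *: W j t.

(** What the volume computation uses of a moving frame, with the derivatives and
the components of the velocity as data: [E] is the unit tangent, [W] an orthonormal
basis of the normal space, and the velocity of a point of the sphere carried by the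
frame has the tangential component [c] and the normal components [om]. The field
[frame_radial] says that the point does not leave the sphere. *)
Record adapted_frame (r a b : R) (f df E : R -> 'rV[R]_q.+3)
    (W dW : 'I_q.+2 -> R -> 'rV[R]_q.+3) (c : 'rV[R]_q.+2 -> R -> R)
    (om : 'rV[R]_q.+2 -> R -> 'rV[R]_q.+2) : Prop := AdaptedFrame {
  frame_curve : uniform_C1 a b f df;
  frame_normals : forall j, uniform_C1 a b (W j) (dW j);
  frame_bound : exists L : R, forall t, a <= t <= b ->
    (forall j, enorm (dW j t) <= L) /\ (forall X, enorm X = r -> enorm (om X t) <= L);
  frame_speed : exists2 c0, 0 < c0 & forall X t, enorm X = r -> a <= t <= b -> c0 <= c X t;
  frame_radial : forall X t, enorm X = r -> a <= t <= b -> dot (om X t) X = 0;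
  frame_norm : forall t (s : R) X, a <= t <= b ->
    enorm (s *: E t + \sum_j X 0 j *: W j t) = enorm (cons_row s X);
  frame_velocity : forall X t, a <= t <= b ->
    df t + \sum_j X 0 j *: dW j t = c X t *: E t + \sum_j om X t 0 j *: W j t }.

Context {r a b : R} {f df E : R -> 'rV[R]_q.+3} {W dW : 'I_q.+2 -> R -> 'rV[R]_q.+3}.
Context {c : 'rV[R]_q.+2 -> R -> R} {om : 'rV[R]_q.+2 -> R -> 'rV[R]_q.+2}.
Hypothesis (r_gt0 : 0 < r) (frame : adapted_frame r a b f df E W dW c om).

(** The differential of the tube map at [(X0, t0)] approximates its increments,
uniformly in the base point. *)
Lemma tube_linearization e : 0 < e -> exists2 d, 0 < d & forall X X' X0 t t' t0,
  enorm X' <= r -> enorm (X' - X0) < d ->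
  a <= t <= b -> a <= t' <= b -> a <= t0 <= b -> `|t - t0| < d -> `|t' - t0| < d ->
  enorm (tube f W X t - tube f W X' t' -
     (\sum_j (X - X') 0 j *: W j t0 + (t - t') *: (df t0 + \sum_j X0 0 j *: dW j t0)))
  <= e * (enorm (X - X') + `|t - t'|).
Proof.
move=> e0; have [L LP] := frame_bound frame.
pose n : R := q.+2%:R; pose e1 := e / (1 + n * r + n).
have n0 : 0 <= n by [].
have k0 : 0 < 1 + n * r + n by rewrite ltr_wpDr // ltr_wpDr // mulr_ge0 // ltW.
have e10 : 0 < e1 by rewrite divr_gt0.
have e1E : e1 * (1 + n * r + n) = e by rewrite divfK // gt_eqF.
have [d1 d10 fd] := frame_curve frame e10.
have [d2 d20 Wd] : exists2 d, 0 < d & forall j s t t0, a <= s <= b -> a <= t <= b ->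
    a <= t0 <= b -> `|s - t0| < d -> `|t - t0| < d ->
    enorm (W j s - W j t - (s - t) *: dW j t0) <= e1 * `|s - t|.
  apply: (@finite_common_radius R 'I_q.+2 (fun j d => forall s t t0, a <= s <= b ->
      a <= t <= b -> a <= t0 <= b -> `|s - t0| < d -> `|t - t0| < d ->
      enorm (W j s - W j t - (s - t) *: dW j t0) <= e1 * `|s - t|)).
    move=> j d d' d'd h s t t0 hs ht ht0 sd td.
    by apply: h => //; [exact: lt_le_trans sd _|exact: lt_le_trans td _].
  by move=> j; exact: (frame_normals frame).
pose l := `|L| + e1 + 1.
have l0 : 0 < l by rewrite ltr_wpDl // addr_ge0 // ltW.
exists (Num.min (Num.min d1 d2) (e1 / l)).
  by rewrite !lt_min d10 d20 divr_gt0.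
move=> X X' X0 t t' t0 X'r; rewrite !lt_min => /andP[/andP[_ _] XX0] ht ht' ht0.
move=> /andP[/andP[td1 td2] tl] /andP[/andP[t'd1 t'd2] t'l].
have [dWL _] := LP t0 ht0.
have LL : L <= l by rewrite /l; have := ler_norm L; lra.
have tt0 : `|t0 - t0| < d2 by rewrite subrr normr0.
set D := (X in enorm X).
have -> : D = (f t - f t' - (t - t') *: df t0) +
    \sum_j ((X - X') 0 j *: (W j t - W j t0) +
     X' 0 j *: (W j t - W j t' - (t - t') *: dW j t0) +
     ((t - t') * (X' - X0) 0 j) *: dW j t0).
  rewrite /D /tube; set SA := \sum_j X 0 j *: _; set SB := \sum_j X' 0 j *: _.
  set SC := \sum_j _; set SD := \sum_j X0 0 j *: _.
  have -> : \sum_j ((X - X') 0 j *: (W j t - W j t0) +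
     X' 0 j *: (W j t - W j t' - (t - t') *: dW j t0) +
     ((t - t') * (X' - X0) 0 j) *: dW j t0) = SA - SB - SC - (t - t') *: SD.
    rewrite /SA /SB /SC /SD scaler_sumr -!sumrB; apply: eq_bigr => j _.
    by apply/rowP => i; rewrite !mxE; ring.
  by apply/rowP => i; rewrite !mxE; ring.
apply: le_trans (ler_enormD _ _) _.
have h1 := fd t t' t0 ht ht' ht0 td1 t'd1.
suff h2 j : enorm ((X - X') 0 j *: (W j t - W j t0) +
     X' 0 j *: (W j t - W j t' - (t - t') *: dW j t0) +
     ((t - t') * (X' - X0) 0 j) *: dW j t0) <=
    e1 * enorm (X - X') + r * e1 * `|t - t'| + e1 * `|t - t'|.
  have h3 := le_trans (ler_enorm_sum _ _ _) (ler_sum_ord_const h2).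
  apply: le_trans (lerD h1 h3) _; rewrite -/n.
  have p1 : 0 <= e1 * (1 + n * r) * enorm (X - X').
    by rewrite mulr_ge0 ?enorm_ge0 // mulr_ge0 ?(ltW e10) // addr_ge0 // mulr_ge0 // ltW.
  by rewrite -e1E; lra.
have X'j : `|X' 0 j| <= r by rewrite (le_trans (ler_coord_enorm _ _)).
have Xj : `|(X - X') 0 j| <= enorm (X - X') by exact: ler_coord_enorm.
have X0j : `|(X' - X0) 0 j| <= e1 / l.
  by rewrite (le_trans (ler_coord_enorm _ _)) // ltW.
have Wj : enorm (W j t - W j t0) <= e1.
  have := Wd j t t0 t0 ht ht0 ht0 td2 tt0 => h4.
  have h5 := ler_enorm_dist (W j t - W j t0) ((t - t0) *: dW j t0).
  rewrite enormZ in h5; have := dWL j => h6.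
  have h7 : `|t - t0| * enorm (dW j t0) <= `|t - t0| * `|L|.
    by rewrite ler_wpM2l // (le_trans h6) // ler_norm.
  have h8 : `|t - t0| * l <= e1 by rewrite -ler_pdivlMr // ltW.
  have h9 : `|t - t0| * l = `|t - t0| * `|L| + e1 * `|t - t0| + `|t - t0|.
    by rewrite /l; ring.
  by have := normr_ge0 (t - t0); lra.
apply: le_trans (ler_enormD _ _) _; apply: lerD.
  apply: le_trans (ler_enormD _ _) _; apply: lerD; rewrite enormZ.
    by rewrite mulrC ler_pM ?enorm_ge0.
  by rewrite -mulrA ler_pM ?enorm_ge0 // Wd.
rewrite enormZ normrM -mulrA mulrC; apply: ler_wpM2r => //.
apply: (@le_trans _ _ (e1 / l * l)); last by rewrite divfK // gt_eqF.
by rewrite ler_pM ?enorm_ge0 // (le_trans (dWL j)).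
Qed.

(** On a small piece of the sphere the radial part of an increment is negligible,
and the differential of the tube map, read in the orthonormal frame at [t0], is an
oblique map over the hyperplane orthogonal to [X0]. The tube map is therefore
bi-Lipschitz equivalent to an oblique map with constants close to 1; so is the
sphere to its projection. *)
Lemma tube_local_model lam : 1 < lam -> exists2 d, 0 < d & forall X0 t0,
  enorm X0 = r -> a <= t0 <= b -> exists P : 'rV[R]_q.+2 -> 'rV[R]_q.+1, exists w,
  [/\ forall x y, P (x - y) = P x - P y, forall x, enorm (P x) <= enorm x,
    forall X X', enorm X = r -> enorm X' = r -> enorm (X - X0) < d -> enorm (X' - X0) < d ->
      enorm (X - X') <= lam * enorm (P X - P X')
    & forall X X' t t', enorm X = r -> enorm X' = r ->
      enorm (X - X0) < d -> enorm (X' - X0) < d -> a <= t <= b -> a <= t' <= b ->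
      `|t - t0| < d -> `|t' - t0| < d ->
      let T := enorm (tube f W X t - tube f W X' t') in
      let M := enorm (oblique (c X0 t0) w (P X) t - oblique (c X0 t0) w (P X') t') in
      T <= lam * M /\ M <= lam * T].
Proof.
move=> lam1; have lam0 : 0 < lam by exact: lt_trans lam1.
have [L LP] := frame_bound frame; have [c0 c00 cP] := frame_speed frame.
pose K := c0^-1 + 2 * (1 + c0^-1 * `|L|).
have K0 : 0 < K.
  by rewrite ltr_wpDr ?invr_gt0 // mulr_ge0 // addr_ge0 // mulr_ge0 // invr_ge0 ltW.
pose g := 1 - lam^-1; have g0 : 0 < g by rewrite subr_gt0 invf_lt1.
pose e := Num.min (g / (2 * K)) (Num.min g 2^-1).
have e0 : 0 < e by rewrite !lt_min !divr_gt0 ?mulr_gt0 // g0 invr_gt0 ltr0n.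
have eK : 2 * (e * K) <= g.
  have : e <= g / (2 * K) by rewrite ge_min lexx.
  by rewrite ler_pdivlMr ?mulr_gt0 // mulrCA.
have eg : e <= g by rewrite !ge_min lexx orbT.
have eh : e <= 2^-1 by rewrite !ge_min lexx !orbT.
have lamV : lam * (1 - g) = 1 by rewrite /g opprB addrCA subrr addr0 divff // gt_eqF.
have [d d0 dP] := tube_linearization e0.
exists (Num.min d (e * r)); first by rewrite lt_min d0 mulr_gt0.
move=> X0 t0 X0r ht0; have [P [PD PZ Psq]] := orthogonal_projection r_gt0 X0r.
have PB x y : P (x - y) = P x - P y by rewrite PD -scaleN1r PZ scaleN1r.
have Ple x : enorm (P x) <= enorm x.
  by rewrite ler_sqrt ?dot_ge0 // [leRHS]Psq lerDr sqr_ge0.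
(* the radial component of an increment along the sphere is of second order *)
have radial X X' : enorm X = r -> enorm X' = r -> enorm (X - X0) < Num.min d (e * r) ->
    enorm (X' - X0) < Num.min d (e * r) -> `|dot (X - X') X0 / r| <= e * enorm (X - X').
  rewrite !lt_min => Xr X'r /andP[_ h1] /andP[_ h2].
  have chord : dot (X - X') X0 = dot (X - X') (2^-1 *: ((X0 - X) + (X0 - X'))).
    have : dot (X - X') (X + X') = 0.
      by rewrite dotBl !dotDr (dotC X' X) -!sqr_enorm Xr X'r; ring.
    rewrite dotDr => h; rewrite dotZr [dot _ (_ + (X0 - X'))]dotDr !dotBr; lra.
  rewrite chord normrM [`|r^-1|]gtr0_norm ?invr_gt0 // ler_pdivrMr //.
  apply: le_trans (cauchy_schwarz _ _) _; rewrite mulrC mulrAC ler_wpM2r ?enorm_ge0 //.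
  rewrite enormZ gtr0_norm ?invr_gt0 //.
  have := ler_enormD (X0 - X) (X0 - X'); rewrite (enormC X0 X) (enormC X0 X').
  by lra.
exists P, (P (om X0 t0)); split=> // [X X' Xr X'r XX0 X'X0|X X' t t' Xr X'r XX0 X'X0 ht ht' tt0 t't0].
  have h := radial X X' Xr X'r XX0 X'X0; rewrite -PB.
  have n1 : enorm (X - X') <= `|dot (X - X') X0 / r| + enorm (P (X - X')).
    rewrite -(@ler_pXn2r _ 2) ?nnegrE ?addr_ge0 ?enorm_ge0 // sqrrD sqr_enorm Psq.
    rewrite real_normK ?num_real // sqr_enorm.
    have : 0 <= `|dot (X - X') X0 / r| * enorm (P (X - X')) by rewrite mulr_ge0 ?enorm_ge0.
    by lra.
  rewrite -[leLHS]mul1r -lamV -mulrA ler_pM2l // mulrBl mul1r.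
  have : e * enorm (X - X') <= g * enorm (X - X') by rewrite ler_wpM2r ?enorm_ge0.
  by lra.
have h := radial X X' Xr X'r XX0 X'X0.
have cX := cP X0 t0 X0r ht0; have c1 : 0 < c X0 t0 by exact: lt_le_trans cX.
have omL : enorm (om X0 t0) <= `|L|.
  by have [_ /(_ X0 X0r)] := LP t0 ht0; move/le_trans; apply; exact: ler_norm.
cbv zeta; rewrite obliqueB -PB; set xi := X - X' in h *; set tau := t - t'.
set M := enorm (oblique _ _ _ _); set T := enorm (tube _ _ _ _ - _).
have M0 : 0 <= M by exact: enorm_ge0.
have [tM yM] := @ler_oblique R q (c X0 t0) (P (om X0 t0)) (P xi) tau c1.
rewrite -/M in tM yM.
pose V := \sum_j xi 0 j *: W j t0 + tau *: (df t0 + \sum_j X0 0 j *: dW j t0).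
have TV : enorm (tube f W X t - tube f W X' t' - V) <= e * (enorm xi + `|tau|).
  move: XX0 X'X0 tt0 t't0; rewrite !lt_min => /andP[h1 _] /andP[h2 _] /andP[h3 _] /andP[h4 _].
  by apply: dP => //; rewrite X'r.
have VM : M <= enorm V <= M + `|dot xi X0 / r|.
  have VE : enorm V = enorm (cons_row (c X0 t0 * tau) (xi + tau *: om X0 t0)).
    rewrite -(frame_norm frame _ _ ht0) /V (frame_velocity frame) // scalerDr scalerA.
    rewrite mulrC addrCA; congr (enorm (_ + _)); rewrite scaler_sumr -big_split /=.
    apply: eq_bigr => j _; rewrite scalerA.
    have -> : (xi + tau *: om X0 t0) 0 j = xi 0 j + tau * om X0 t0 0 j.
      by rewrite mxE [X in _ + X]mxE.
    by rewrite scalerDl.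
  have Vsq : enorm V ^+ 2 = (dot xi X0 / r) ^+ 2 + M ^+ 2.
    rewrite VE sqr_enorm dot_cons [dot (xi + _) _]Psq dotDl dotZl (frame_radial frame) // mulr0 addr0.
    by rewrite PD PZ /M sqr_enorm dot_cons; ring.
  apply/andP; split; rewrite -(@ler_pXn2r _ 2) ?nnegrE ?addr_ge0 ?enorm_ge0 //.
    by rewrite Vsq lerDr sqr_ge0.
  rewrite Vsq sqrrD real_normK ?num_real //.
  have : 0 <= M * `|dot xi X0 / r| by rewrite mulr_ge0.
  by lra.
have sum_le : enorm xi + `|tau| <= K * M.
  have n1 : enorm xi <= `|dot xi X0 / r| + enorm (P xi).
    rewrite -(@ler_pXn2r _ 2) ?nnegrE ?addr_ge0 ?enorm_ge0 // sqrrD sqr_enorm Psq.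
    rewrite real_normK ?num_real // sqr_enorm.
    have : 0 <= `|dot xi X0 / r| * enorm (P xi) by rewrite mulr_ge0 ?enorm_ge0.
    by lra.
  have n2 : e * enorm xi <= 2^-1 * enorm xi by rewrite ler_wpM2r ?enorm_ge0.
  have n3 : enorm xi <= 2 * enorm (P xi) by lra.
  have i1 : (c X0 t0)^-1 <= c0^-1 by rewrite lef_pV2.
  have n4 : enorm (P xi) <= (1 + c0^-1 * `|L|) * M.
    apply: le_trans yM _; rewrite ler_wpM2r // lerD2l ler_pM ?enorm_ge0 ?invr_ge0 ?(ltW c1) //.
    exact: le_trans omL.
  have n5 : `|tau| <= c0^-1 * M by apply: le_trans tM _; rewrite ler_wpM2r.
  by rewrite /K; lra.
have err : 2 * (e * (enorm xi + `|tau|)) <= g * M.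
  apply: (@le_trans _ _ (2 * (e * (K * M)))); first by rewrite ler_pM2l // ler_pM2l.
  by rewrite !mulrA -(mulrA 2) ler_wpM2r.
have TVd := ler_enorm_dist (tube f W X t - tube f W X' t') V.
have VTd := ler_enorm_dist V (tube f W X t - tube f W X' t').
rewrite -/T in TVd VTd; rewrite enormC in VTd.
have /andP[VM1 VM2] := VM.
have tau0 : 0 <= e * `|tau| by rewrite mulr_ge0 // ltW.
have xi0 : 0 <= e * enorm xi by rewrite mulr_ge0 ?enorm_ge0 // ltW.
have hT1 : T <= M + g * M by lra.
have hT2 : (1 - g) * M <= T by lra.
split; last by rewrite -[leLHS]mul1r -lamV -mulrA ler_pM2l.
apply: le_trans hT1 _; rewrite -[X in X + _]mul1r -mulrDl ler_wpM2r //.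
have : (lam - 1) ^+ 2 * lam^-1 >= 0 by rewrite mulr_ge0 ?sqr_ge0 // invr_ge0 ltW.
have -> : (lam - 1) ^+ 2 * lam^-1 = lam - 1 - g by rewrite /g; field; rewrite gt_eqF.
by lra.
Qed.

End Tube.

Section LocalMeasure.
Local Open Scope ereal_scope.
Context {R : realType} {q : nat} {r a b : R}.

Definition tube_set (f : R -> 'rV[R]_q.+3) (W : 'I_q.+2 -> R -> 'rV[R]_q.+3)
    (A : set 'rV[R]_q.+2) (I : set R) :=
  \bigcup_(X in A) [set tube f W X t | t in I].

Lemma image_uncurry {T1 T2 T3 : Type} (g : T1 -> T2 -> T3) (A : set T1) (I : set T2) :
  [set g p.1 p.2 | p in A `*` I] = \bigcup_(X in A) [set g X t | t in I].
Proof.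
apply/seteqP; split=> [_ [[X t] [/= AX It] <-]|_ [X AX [t It <-]]].
  by exists X => //; exists t.
by exists (X, t).
Qed.

(** On a small piece of the sphere and a short interval, the measure of the tube is
almost the product of the measure of the piece, of the length of the interval and
of the tangential component [c] of the velocity: pass to the oblique model, apply
[swept_measure], and pass back from the projection to the sphere. *)
Lemma tube_piece_measure (f df E : R -> 'rV[R]_q.+3) (W dW : 'I_q.+2 -> R -> 'rV[R]_q.+3)
    (c : 'rV[R]_q.+2 -> R -> R) (om : 'rV[R]_q.+2 -> R -> 'rV[R]_q.+2) (lam : R) :
  (0 < r)%R -> adapted_frame r a b f df E W dW c om -> (1 < lam)%R ->
  exists2 d, (0 < d)%R & forall X0 u v I K K', enorm X0 = r ->
    (a <= u)%R -> (u < v)%R -> (v <= b)%R -> (v - u < d)%R -> between u v I ->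
    closed K -> closed K' -> K' `<=` K ->
    (forall X, K X -> enorm X = r /\ enorm (X - X0) < d)%R ->
    let T := hausdorff q.+2 (tube_set f W (K `\` K') I) * cube_measure q.+1 in
    let S := (c X0 u * (v - u))%:E * cube_measure q.+2 * hausdorff q.+1 (K `\` K') in
    T <= (lam ^+ q.+2)%:E * S /\ S <= (lam ^+ q.+1 * lam ^+ q.+2)%:E * T.
Proof.
move=> r0 frame lam1; have lam0 : (0 < lam)%R by exact: lt_trans lam1.
have [d d0 dP] := tube_local_model r0 frame lam1.
exists d => // X0 u v I K K' X0r au uv vb uvd bI cK cK' K'K Ksph.
have u_ab : (a <= u <= b)%R by rewrite au (le_trans (ltW uv)).
have [c0 c00 cP] := frame_speed frame.
have c_gt0 : (0 < c X0 u)%R by exact: lt_le_trans (cP X0 u X0r u_ab).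
have [P [w [PB Ple Pge PM]]] := dP X0 u X0r u_ab.
have bK : ebounded K by exists r => X /Ksph [->].
have bK' : ebounded K' by exists r => X /K'K /Ksph [->].
have Pcont : continuous P.
  by apply: (@lipschitz_continuous_enorm _ _ _ _ 1%R) => x y; rewrite -PB mul1r.
have cP' (J : set 'rV[R]_q.+2) : closed J -> ebounded J -> closed (P @` J) /\ ebounded (P @` J).
  move=> cJ bJ; have cPJ : compact (P @` J).
    apply: continuous_compact; last exact: ebounded_closed_compact.
    exact: continuous_subspaceT.
  by split; [apply: compact_closed => //; exact: norm_hausdorff|exact: compact_ebounded].
pose A := K `\` K'.
have PA : P @` A = P @` K `\` P @` K'.
  apply/seteqP; split=> [_ [X [KX K'X] <-]|_ [[X KX <-] nK']].
    split; first by exists X.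
    move=> [X' K'X' PXX']; apply: K'X; suff -> : X = X' by [].
    have [Xr Xd] := Ksph _ KX; have [X'r X'd] := Ksph _ (K'K _ K'X').
    have := Pge X X' Xr X'r Xd X'd; rewrite PXX' subrr enorm0 mulr0 => h.
    apply/eqP; rewrite -subr_eq0; apply/eqP/enorm_eq0/le_anti.
    by rewrite h enorm_ge0.
  by exists X => //; split=> // K'X; apply: nK'; exists X.
have Asph X : A X -> (enorm X = r /\ enorm (X - X0) < d)%R by move=> [/Ksph].
have It t : I t -> (a <= t <= b /\ `|t - u| < d)%R.
  move/bI.2; rewrite /= in_itv /= => /andP[ut tv]; split.
    by rewrite (le_trans au) // (le_trans tv).
  by rewrite ger0_norm ?subr_ge0 // (le_lt_trans _ uvd) // lerB.
pose M X t := oblique (c X0 u) w (P X) t.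
have MA : \bigcup_(y in P @` A) swept (c X0 u) w I y = [set M p.1 p.2 | p in A `*` I].
  by rewrite image_uncurry bigcup_image.
have flat : hausdorff q.+2 [set M p.1 p.2 | p in A `*` I] * cube_measure q.+1 =
    (c X0 u * (v - u))%:E * cube_measure q.+2 * hausdorff q.+1 (P @` A).
  have [cPK bPK] := cP' K cK bK; have [cPK' _] := cP' K' cK' bK'.
  rewrite -MA PA; apply: swept_measure => //; first exact: ltW.
  exact: image_subset.
have TM : hausdorff q.+2 (tube_set f W A I) <=
    (lam ^+ q.+2)%:E * hausdorff q.+2 [set M p.1 p.2 | p in A `*` I].
  rewrite /tube_set -image_uncurry; apply: hausdorff_le_param => //.
  move=> [X t] [X' t'] [/= AX tI] [/= AX' t'I].
  have [Xr Xd] := Asph _ AX; have [X'r X'd] := Asph _ AX'.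
  have [h1 h2] := It _ tI; have [h3 h4] := It _ t'I.
  by have [] := PM X X' t t' Xr X'r Xd X'd h1 h3 h2 h4.
have MT : hausdorff q.+2 [set M p.1 p.2 | p in A `*` I] <=
    (lam ^+ q.+2)%:E * hausdorff q.+2 (tube_set f W A I).
  rewrite /tube_set -image_uncurry; apply: hausdorff_le_param => //.
  move=> [X t] [X' t'] [/= AX tI] [/= AX' t'I].
  have [Xr Xd] := Asph _ AX; have [X'r X'd] := Asph _ AX'.
  have [h1 h2] := It _ tI; have [h3 h4] := It _ t'I.
  by have [] := PM X X' t t' Xr X'r Xd X'd h1 h3 h2 h4.
have PAle : hausdorff q.+1 (P @` A) <= hausdorff q.+1 A.
  rewrite -[leRHS]mul1e -(expr1n R q.+1).
  by apply: (@hausdorff_lipschitz R _ _ _ A _ P) => // x y _ _; rewrite mul1r -PB.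
have APle : hausdorff q.+1 A <= (lam ^+ q.+1)%:E * hausdorff q.+1 (P @` A).
  rewrite -[A in leLHS]image_id; apply: hausdorff_le_param => // X X' AX AX'.
  have [Xr Xd] := Asph _ AX; have [X'r X'd] := Asph _ AX'.
  exact: Pge.
have C1 := @cube_measure_gt0 R q.+1; have C2 := @cube_measure_gt0 R q.+2.
have k0 : 0 <= (c X0 u * (v - u))%:E * cube_measure q.+2.
  by rewrite mule_ge0 ?(ltW C2) // lee_fin mulr_ge0 ?subr_ge0 ?(ltW c_gt0) ?(ltW uv).
rewrite /= -/A; split.
  apply: (@le_trans _ _ ((lam ^+ q.+2)%:E *
      (hausdorff q.+2 [set M p.1 p.2 | p in A `*` I] * cube_measure q.+1))).
    by rewrite muleA lee_wpmul2r // ltW.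
  by rewrite flat; apply: lee_wpmul2l; [rewrite lee_fin exprn_ge0 // ltW|exact: lee_wpmul2l].
apply: le_trans (lee_wpmul2l k0 APle) _.
rewrite muleCA (EFinM (lam ^+ q.+1)) -[leRHS]muleA; apply: lee_wpmul2l; first by rewrite lee_fin exprn_ge0 // ltW.
by rewrite -flat muleA lee_wpmul2r // ltW.
Qed.

End LocalMeasure.

(** * From pieces of the sphere to the whole sphere *)

Section SphereTopology.
Context {R : realType} {m : nat}.

Lemma enorm_continuous : continuous (@enorm R m).
Proof.
move=> x A /nbhs_ballP [e /= e0 eA].
pose K : R := m%:R + 1; have K0 : 0 < K by rewrite ltr_wpDl.
apply/nbhs_ballP; exists (e / K) => [|y]; first exact: divr_gt0.
rewrite -ball_normE /= => xy; apply: eA; rewrite /ball /=.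
apply: (@le_lt_trans _ _ (enorm (x - y))).
  by rewrite ler_norml ler_enorm_dist andbT lerNl opprB enormC ler_enorm_dist.
apply: le_lt_trans (ler_enorm_mxnorm _) _.
apply: (@le_lt_trans _ _ (K * `|x - y|)); last by rewrite mulrC -ltr_pdivlMr.
by rewrite ler_wpM2r // lerDl.
Qed.

Lemma closed_sphere (r : R) : closed (sphere r : set 'rV[R]_m).
Proof.
rewrite (_ : sphere r = @enorm R m @^-1` [set r]) //.
by apply: preimage_closed => [x _|]; [exact: enorm_continuous|exact: closed_eq].
Qed.

Lemma compact_sphere (r : R) : compact (sphere r : set 'rV[R]_m).
Proof.
apply: ebounded_closed_compact; last exact: closed_sphere.
by exists r => x ->.
Qed.

(** The closed set [K'] consists of the lower faces of the tile. *)
Lemma sphere_tile (r : R) j i X0 : sphere r X0 -> @tile R m j i X0 ->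
  exists K K', [/\ closed K, closed K', K' `<=` K, sphere r `&` tile j i = K `\` K'
    & forall X, K X -> enorm X = r /\ enorm (X - X0) <= m%:R * 2^-1 ^+ j].
Proof.
move=> X0r X0i; pose z := tile_index j X0.
have j0 : 0 < 2 ^+ j :> R by rewrite exprn_gt0.
pose lo l : R := (z 0 l - 1)%:~R / 2 ^+ j; pose hi l : R := (z 0 l)%:~R / 2 ^+ j.
pose S (l : 'I_m) (I : interval R) := (fun y : 'rV[R]_m => y ord0 l) @^-1` [set` I].
have cS l I : closed [set` I] -> closed (S l I).
  by move=> cI; apply: preimage_closed => // y _; exact: coord_continuous.
pose K := sphere r `&` \bigcap_(l in [set: 'I_m]) S l `[lo l, hi l].
pose K' := K `&` \bigcup_(l in [set: 'I_m]) S l `]-oo, lo l].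
have tileE y : tile j i y <-> forall l, lo l < y 0 l <= hi l.
  have zi : pickle z = i by exact: X0i.
  rewrite /tile /= -zi; split=> [/(pcan_inj pickleK) yz l|yz].
    rewrite /lo /hi -yz mxE ltr_pdivrMr // ler_pdivlMr // ![y 0 l * _]mulrC.
    exact: ceil_itv.
  congr pickle; apply/rowP => l; rewrite [LHS]mxE; apply/eqP; rewrite ceil_eq.
  by have := yz l; rewrite /lo /hi ltr_pdivrMr // ler_pdivlMr // ![y 0 l * _]mulrC.
have cK : closed K.
  by apply: closedI; [exact: closed_sphere|apply: closed_bigI => l _; apply: cS; exact: itv_closed].
exists K, K'; split => //.
- apply: closedI => //; apply: closed_bigcup; first exact: finite_finset.
  by move=> l _; apply: cS; exact: closed_le.
- by move=> x [].
- apply/seteqP; split=> [y [yr /tileE yz]|y [[yr yK] nK']].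
    split; first by split=> // l _; rewrite /S /preimage /= in_itv /= (ltW (andP (yz l)).1) (andP (yz l)).2.
    move=> [_ [l _]]; rewrite /S /preimage /= in_itv /= leNgt => /negP; apply.
    by case/andP: (yz l).
  split=> //; apply/tileE => l; have := yK l I; rewrite /S /preimage /= in_itv /= => /andP[y1 ->].
  rewrite andbT lt_neqAle y1 andbT; apply/eqP => e; apply: nK'; split; first by split.
  by exists l => //; rewrite /S /preimage /= in_itv /= e.
- move=> X [Xr XK]; split=> //; apply: le_trans (ler_enorm_coords _) _.
  apply: ler_sum_ord_const => l; have := XK l I; rewrite /S /preimage /= in_itv /=.
  have /tileE /(_ l) := X0i; rewrite !mxE.
  have hl : hi l = lo l + 2^-1 ^+ j.
    by rewrite /hi /lo rmorphB /= exprVn; field; rewrite gt_eqF.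
  rewrite hl ler_norml => /andP[x1 x2] /andP[x3 x4].
  by apply/andP; split; lra.
Qed.

End SphereTopology.

Lemma continuous_sum_at {R : realType} {T : topologicalType} m (I : finType)
    (F : I -> T -> 'rV[R]_m) (p : T) : (forall i, {for p, continuous (F i)}) ->
  {for p, continuous (fun x => \sum_i F i x)}.
Proof.
move=> Fc; have -> : (fun x => \sum_i F i x) = \sum_i F i.
  by apply/funext => x; rewrite fct_sumE.
elim/big_ind: _ => [|g h|i _]; [exact: cvg_cst|exact: continuousD|exact: Fc].
Qed.

Section Separation.
Context {R : realType} {q : nat} {r a b : R}.
Variables (f : R -> 'rV[R]_q.+3) (W : 'I_q.+2 -> R -> 'rV[R]_q.+3).
Hypothesis f_continuous : forall t, a <= t <= b -> {for t, continuous f}.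
Hypothesis W_continuous : forall j t, a <= t <= b -> {for t, continuous (W j)}.
Hypothesis tube_inj : forall X X' t t', enorm X = r -> enorm X' = r ->
  a <= t <= b -> a <= t' <= b -> tube f W X t = tube f W X' t' -> X = X' /\ t = t'.

Lemma tube_continuous (p : 'rV[R]_q.+2 * R) : a <= p.2 <= b ->
  {for p, continuous (fun p => tube f W p.1 p.2)}.
Proof.
move=> p2; rewrite /tube.
apply: (@continuousD _ _ _ (fun p : 'rV[R]_q.+2 * R => f p.2)
   (fun p => \sum_j p.1 0 j *: W j p.2)).
  by apply: continuous_comp; [exact: cvg_snd|exact: f_continuous].
apply: continuous_sum_at => j; apply: continuousZ.
  apply: (@continuous_comp _ _ _ fst (fun x : 'rV[R]_q.+2 => x 0 j)); first exact: cvg_fst.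
  exact: coord_continuous.
by apply: (@continuous_comp _ _ _ snd (W j)); [exact: cvg_snd|exact: W_continuous].
Qed.

(** Parts of the tube with distinct parameters are a positive distance apart, by
compactness and injectivity. This is what makes measures of parts of the tube
additive. *)
Lemma tube_separated (g : 'rV[R]_q.+2 * R -> R) (l h : R) : continuous g -> l < h ->
  exists2 e, 0 < e & forall X X' t t', enorm X = r -> enorm X' = r ->
    a <= t <= b -> a <= t' <= b -> g (X, t) <= l -> h <= g (X', t') ->
    e <= enorm (tube f W X t - tube f W X' t').
Proof.
move=> gc lh; pose D := (sphere r : set 'rV[R]_q.+2) `*` `[a, b].
have cD : compact D by apply: compact_setX; [exact: compact_sphere|exact: segment_compact].
pose Z := (D `&` g @^-1` [set x | x <= l]) `*` (D `&` g @^-1` [set x | h <= x]).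
have cZ : compact Z.
  apply: compact_setX; apply: (@subclosed_compact _ _ D) => //;
    try (by move=> p []); apply: closedI => //; try exact: compact_closed.
  - by apply: preimage_closed => [p _|]; [exact: gc|exact: closed_le].
  - by apply: preimage_closed => [p _|]; [exact: gc|exact: closed_ge].
pose F (z : ('rV[R]_q.+2 * R) * ('rV[R]_q.+2 * R)) :=
  enorm (tube f W z.1.1 z.1.2 - tube f W z.2.1 z.2.2).
have [Z0|Z0] := pselect (Z !=set0); last first.
  exists 1 => // X X' t t' Xr X'r ht ht' gl gh; case: Z0; exists ((X, t), (X', t')).
  by split; split=> //=; split=> //=; rewrite in_itv.
have Fc : {within Z, continuous F}.
  apply: continuous_in_subspaceT => z /set_mem [[[_ /= z1] _] [[_ /= z2] _]].
  apply: (@continuous_comp _ _ _ (fun z => tube f W z.1.1 z.1.2 - tube f W z.2.1 z.2.2)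
    (@enorm R _)); last exact: enorm_continuous.
  apply: (@continuousB _ _ _ (fun z : ('rV[R]_q.+2 * R) * ('rV[R]_q.+2 * R) => tube f W z.1.1 z.1.2)
    (fun z : ('rV[R]_q.+2 * R) * ('rV[R]_q.+2 * R) => tube f W z.2.1 z.2.2)).
    apply: (@continuous_comp _ _ _ fst (fun p => tube f W p.1 p.2)); first exact: cvg_fst.
    by apply: tube_continuous; move: z1; rewrite /= in_itv.
  apply: (@continuous_comp _ _ _ snd (fun p => tube f W p.1 p.2)); first exact: cvg_snd.
  by apply: tube_continuous; move: z2; rewrite /= in_itv.
have [z /set_mem zZ zmin] := compact_EVT_min Z0 cZ Fc.
exists (F z).
  rewrite lt_neqAle enorm_ge0 andbT eq_sym; apply/eqP => /enorm_eq0 /eqP; rewrite subr_eq0 => /eqP.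
  move: zZ => [[[z11 z12] zl] [[z21 z22] zh]].
  move: z12 z22 zl zh; rewrite /preimage /= !in_itv /= => z12 z22 zl zh.
  case/(tube_inj z11 z21 z12 z22) => e1 e2; move: zh zl.
  rewrite (surjective_pairing z.1) (surjective_pairing z.2) e1 e2 => zh zl.
  by have := lt_le_trans lh (le_trans zh zl); rewrite ltxx.
move=> X X' t t' Xr X'r ht ht' gl gh; apply: (zmin ((X, t), (X', t'))).
by apply/mem_set; split; split=> //=; split=> //=; rewrite in_itv.
Qed.

End Separation.

Section SphereSum.
Local Open Scope ereal_scope.
Context {R : realType} {q : nat} {r a b : R}.
Variables (f : R -> 'rV[R]_q.+3) (W : 'I_q.+2 -> R -> 'rV[R]_q.+3).
Hypothesis separated : forall (g : 'rV[R]_q.+2 * R -> R) (l h : R), continuous g -> (l < h)%R ->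
  exists2 e, (0 < e)%R & forall X X' t t', enorm X = r -> enorm X' = r ->
    (a <= t <= b)%R -> (a <= t' <= b)%R -> (g (X, t) <= l)%R -> (h <= g (X', t'))%R ->
    (e <= enorm (tube f W X t - tube f W X' t'))%R.

Lemma tube_sphere_sum j I : I `<=` `[a, b] ->
  hausdorff q.+2 (tube_set f W (sphere r) I) =
  \sum_(i <oo) hausdorff q.+2 (tube_set f W (sphere r `&` tile j i) I).
Proof.
move=> Iab; pose F X := [set y | enorm X = r /\ exists2 t, I t & tube f W X t = y].
have E A : spread (hausdorff q.+2) F A = hausdorff q.+2 (tube_set f W (sphere r `&` A) I).
  congr hausdorff; apply/seteqP; split=> [y [X AX [Xr [t It <-]]]|y [X [Xr AX] [t It <-]]].
    by exists X => //; exists t.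
  by exists X => //; split=> //; exists t.
rewrite -[sphere r in LHS]setIT -E.
rewrite (tile_sum (mu := spread (@hausdorff R q.+3 q.+2) F) j) => [|l].
  by apply: eq_eseriesr => i _; rewrite /= setTI E.
apply: separates_spread => x y xy.
have [|e e0 eP] := separated (g := fun p => p.1 ord0 l) _ xy.
  move=> p; apply: (@continuous_comp _ _ _ fst (fun x : 'rV[R]_q.+2 => x ord0 l)).
    exact: cvg_fst.
  exact: coord_continuous.
exists e => // X X' _ _ Xx yX' [Xr [t It <-]] [X'r [t' It' <-]].
by apply: eP => //; [have := Iab _ It|have := Iab _ It']; rewrite /= in_itv.
Qed.

Lemma tube_time_sum (J K : set R) (s : R) : J `<=` `[a, b] -> K `<=` `[a, b] ->
  (forall t, J t -> t <= s)%R -> (forall t, K t -> s < t)%R ->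
  hausdorff q.+2 (tube_set f W (sphere r) (J `|` K)) =
  hausdorff q.+2 (tube_set f W (sphere r) J) + hausdorff q.+2 (tube_set f W (sphere r) K).
Proof.
move=> Jab Kab Js Ks.
pose F t := [set y | (a <= t <= b)%R /\ exists2 X, enorm X = r & tube f W X t = y].
have E (A : set R) : A `<=` `[a, b] ->
    spread (hausdorff q.+2) F A = hausdorff q.+2 (tube_set f W (sphere r) A).
  move=> Aab; congr hausdorff; apply/seteqP; split=> [y [t At [_ [X Xr <-]]]|y [X Xr [t At <-]]].
    by exists X => //; exists t.
  exists t => //; split; last by exists X.
  by have := Aab _ At; rewrite /= in_itv.
have sep : separates (spread (@hausdorff R q.+3 q.+2) F) id.
  apply: separates_spread => x y xy.
  have [|e e0 eP] := separated (g := snd) _ xy; first by move=> p; exact: cvg_snd.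
  by exists e => // t t' _ _ tx yt' [ht [X Xr <-]] [ht' [X' X'r <-]]; apply: eP.
rewrite -!E //; last by move=> t [/Jab|/Kab].
rewrite (measurable_sublevel sep s); congr (_ + _); rewrite /=; congr spread.
  apply/seteqP; split=> [t [[//|/Ks st]]|t Jt]; last by split; [left|exact: Js].
  by rewrite /= leNgt st.
apply/seteqP; split=> [t [[/Js Jt|//]]|t Kt]; first by rewrite /= Jt.
by split; [right|apply/negP; rewrite -ltNge; exact: Ks].
Qed.

End SphereSum.

Section TimeSlice.
Local Open Scope ereal_scope.
Context {R : realType} {q : nat} {r a b : R}.
Context {f df E : R -> 'rV[R]_q.+3} {W dW W' dW' : 'I_q.+2 -> R -> 'rV[R]_q.+3}.
Context {c c' : 'rV[R]_q.+2 -> R -> R} {om om' : 'rV[R]_q.+2 -> R -> 'rV[R]_q.+2}.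
Variable nu : R -> R.
Hypotheses (r0 : (0 < r)%R) (frame : adapted_frame r a b f df E W dW c om)
  (frame' : adapted_frame r a b f df E W' dW' c' om').
Hypothesis mean_speed : forall X t, enorm X = r -> (a <= t <= b)%R ->
  (c X t + c' X t = 2 * nu t)%R.
Hypothesis same_tube : forall I, tube_set f W' (sphere r) I = tube_set f W (sphere r) I.
Hypothesis sum_W : forall j I, I `<=` `[a, b] ->
  hausdorff q.+2 (tube_set f W (sphere r) I) =
  \sum_(i <oo) hausdorff q.+2 (tube_set f W (sphere r `&` tile j i) I).
Hypothesis sum_W' : forall j I, I `<=` `[a, b] ->
  hausdorff q.+2 (tube_set f W' (sphere r) I) =
  \sum_(i <oo) hausdorff q.+2 (tube_set f W' (sphere r `&` tile j i) I).

(** Sum the estimates of [tube_piece_measure] for two frames that parametrize the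
same tube: the tangential components add up to twice the speed of the curve at
every point, so that the sums reduce to the measure of the sphere. *)
Lemma tube_time_slice (lam : R) : (1 < lam)%R -> exists2 d, (0 < d)%R & forall u v I,
  (a <= u)%R -> (u < v)%R -> (v <= b)%R -> (v - u < d)%R -> between u v I ->
  let T := hausdorff q.+2 (tube_set f W (sphere r) I) * cube_measure q.+1 in
  let B := (nu u * (v - u))%:E * cube_measure q.+2 * hausdorff q.+1 (sphere r : set 'rV[R]_q.+2) in
  T <= (lam ^+ q.+2)%:E * B /\ B <= (lam ^+ q.+1 * lam ^+ q.+2)%:E * T.
Proof.
move=> lam1; have lam0 : (0 < lam)%R by exact: lt_trans lam1.
have [d1 d10 P1] := tube_piece_measure r0 frame lam1.
have [d2 d20 P2] := tube_piece_measure r0 frame' lam1.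
exists (Num.min d1 d2); first by rewrite lt_min d10.
move=> u v I au uv vb; rewrite lt_min => /andP[uvd1 uvd2] bI T B.
have Iab : I `<=` `[a, b].
  move=> t /bI.2; rewrite /= !in_itv /= => /andP[ut tv].
  by rewrite (le_trans au ut) (le_trans tv vb).
have u_ab : (a <= u <= b)%R by rewrite au (le_trans (ltW uv)).
have [j [jd1 jd2]] : exists j, (q.+2%:R * 2^-1 ^+ j < d1)%R /\ (q.+2%:R * 2^-1 ^+ j < d2)%R.
  have dq : (0 < Num.min d1 d2 / q.+2%:R)%R by rewrite divr_gt0 // lt_min d10.
  have := @cvg_expr R 2^-1; rewrite ger0_norm // invf_lt1 // ltr1n => /(_ isT).
  move=> /cvgr_lt /(_ _ dq) [N _ /(_ N (leqnn N))] /=.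
  by rewrite ltr_pdivlMr ?ltr0n // mulrC lt_min => /andP[h1 h2]; exists N.
pose A i : set 'rV[R]_q.+2 := sphere r `&` tile j i.
pose h i := hausdorff q.+1 (A i).
pose g i := hausdorff q.+2 (tube_set f W (A i) I).
pose g' i := hausdorff q.+2 (tube_set f W' (A i) I).
pose C1 := fine (cube_measure q.+1 : \bar R); pose C2 := fine (cube_measure q.+2 : \bar R).
have C1E : cube_measure q.+1 = C1%:E by rewrite fineK // cube_measure_fin.
have C2E : cube_measure q.+2 = C2%:E by rewrite fineK // cube_measure_fin.
have C10 : (0 < C1)%R by rewrite -lte_fin -C1E cube_measure_gt0.
have C20 : (0 < C2)%R by rewrite -lte_fin -C2E cube_measure_gt0.
have h0 i : 0 <= h i by exact: hausdorff_ge0.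
have g0 i : 0 <= g i by exact: hausdorff_ge0.
have g'0 i : 0 <= g' i by exact: hausdorff_ge0.
have hE : hausdorff q.+1 (sphere r : set 'rV[R]_q.+2) = \sum_(i <oo) h i.
  by apply: (tile_sum (mu := @hausdorff R q.+2 q.+1) j) => l; exact: separates_hausdorff.
have gE : hausdorff q.+2 (tube_set f W (sphere r) I) = \sum_(i <oo) g i by exact: sum_W.
have g'E : hausdorff q.+2 (tube_set f W (sphere r) I) = \sum_(i <oo) g' i.
  by rewrite -same_tube; exact: sum_W'.
pose beta := (nu u * (v - u) * C2)%R.
have beta0 (X : 'rV[R]_q.+2) : enorm X = r -> (0 <= beta)%R.
  move=> Xr; have [c0 c00 cP] := frame_speed frame; have [c1 c10 cP'] := frame_speed frame'.
  have e1 := cP X u Xr u_ab; have e2 := cP' X u Xr u_ab; have e3 := mean_speed Xr u_ab.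
  have nu0 : (0 <= nu u)%R by lra.
  by rewrite mulr_ge0 ?(ltW C20) // mulr_ge0 // subr_ge0 ltW.
have piece i : C1%:E * (g i + g' i) <= (lam ^+ q.+2 * (2 * beta))%:E * h i /\
    (2 * beta)%:E * h i <= (lam ^+ q.+1 * lam ^+ q.+2 * C1)%:E * (g i + g' i).
  have [[X0 [X0r X0i]]|empty] := pselect (A i !=set0); last first.
    have A0 : A i = set0 by apply/seteqP; split=> // X AX; case: empty; exists X.
    have z V : hausdorff q.+2 (tube_set f V (A i) I) = 0.
      by rewrite A0 /tube_set bigcup_set0 hausdorff0.
    by rewrite /g /g' /h !z A0 hausdorff0 adde0 !mule0.
  have [K [K' [cK cK' K'K AE KP]]] := sphere_tile X0r X0i.
  have [|e1 e2] := P1 X0 u v I K K' X0r au uv vb uvd1 bI cK cK' K'K.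
    by move=> X /KP [-> h1]; split=> //; exact: le_lt_trans jd1.
  have [|e3 e4] := P2 X0 u v I K K' X0r au uv vb uvd2 bI cK cK' K'K.
    by move=> X /KP [-> h1]; split=> //; exact: le_lt_trans jd2.
  rewrite -/tile -AE C1E C2E -/(A i) -/(h i) -/(g i) in e1 e2.
  rewrite -/tile -AE C1E C2E -/(A i) -/(h i) -/(g' i) in e3 e4.
  have cc : (c X0 u * (v - u) * C2 + c' X0 u * (v - u) * C2 = 2 * beta)%R.
    by rewrite -mulrDl -mulrDl (mean_speed X0r u_ab) /beta !mulrA.
  have [k1 k2] : (0 <= c X0 u * (v - u) * C2)%R /\ (0 <= c' X0 u * (v - u) * C2)%R.
    have [c0 c00 cP] := frame_speed frame; have [c1 c10 cP'] := frame_speed frame'.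
    have f1 := cP X0 u X0r u_ab; have f2 := cP' X0 u X0r u_ab.
    by split; rewrite mulr_ge0 ?(ltW C20) // mulr_ge0 ?subr_ge0 ?(ltW uv) //; lra.
  split.
    rewrite ge0_muleDr // EFinM -cc EFinD -muleA ge0_muleDl ?lee_fin //.
    rewrite ge0_muleDr ?mule_ge0 ?lee_fin // !(muleC C1%:E).
    by apply: leeD; [rewrite [(_ * C2)%:E]EFinM|rewrite [(_ * C2)%:E]EFinM].
  rewrite (EFinM (lam ^+ q.+1 * lam ^+ q.+2)) -[leRHS]muleA [in leRHS]ge0_muleDr // -cc EFinD ge0_muleDl ?lee_fin //.
  rewrite ge0_muleDr ?mule_ge0 ?lee_fin ?(ltW C10) // !(muleC C1%:E).
  by apply: leeD; [rewrite [(_ * C2)%:E]EFinM|rewrite [(_ * C2)%:E]EFinM].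
have [nS|[X0 X0r]] : (sphere r : set 'rV[R]_q.+2) = set0 \/ (sphere r : set 'rV[R]_q.+2) !=set0.
- have [|n] := pselect ((sphere r : set 'rV[R]_q.+2) !=set0); first by right.
  by left; apply/seteqP; split=> // X Xr; case: n; exists X.
- rewrite /T /B nS /tube_set bigcup_set0 !hausdorff0 mule0 mul0e !mule0.
  by split.
have {}beta0 := beta0 X0 X0r.
set Tn := hausdorff q.+2 (tube_set f W (sphere r) I) in gE g'E T *.
set Sn := hausdorff q.+1 (sphere r : set 'rV[R]_q.+2) in hE B *.
have sumg : \sum_(i <oo) (g i + g' i) = 2%:E * Tn.
  rewrite nneseriesD // -gE -g'E (_ : 2%:E = 1 + 1) ?ge0_muleDl ?mul1e //.
have gg0 i : 0 <= g i + g' i by rewrite adde_ge0.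
have up : C1%:E * (2%:E * Tn) <= (lam ^+ q.+2 * (2 * beta))%:E * Sn.
  rewrite -sumg hE -!nneseriesZl //; apply: lee_nneseries => i _; last exact: (piece i).1.
  by rewrite mule_ge0 // lee_fin ltW.
have down : (2 * beta)%:E * Sn <= (lam ^+ q.+1 * lam ^+ q.+2 * C1)%:E * (2%:E * Tn).
  rewrite -sumg hE -!nneseriesZl //; apply: lee_nneseries => i _; last exact: (piece i).2.
  by rewrite mule_ge0 // lee_fin mulr_ge0.
have BE : B = beta%:E * Sn by rewrite /B C2E -EFinM.
have TE : T = C1%:E * Tn by rewrite /T C1E muleC.
have two x y : 2%:E * x <= 2%:E * y -> x <= y :> \bar R by rewrite lee_pmul2l // lte_fin.
rewrite BE TE; split; apply: two.
  move: up; rewrite muleCA => /le_trans; apply.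
  by rewrite !muleA -!EFinM [(2 * lam ^+ _)%R]mulrC -!mulrA.
rewrite muleA -EFinM; apply: le_trans down _.
by rewrite !muleA -!EFinM [(2 * (_ * _))%R]mulrC [X in X%:E * _ <= _]mulrAC.
Qed.

End TimeSlice.

(** * From short time intervals to the whole interval *)

Section Concatenation.
Context {R : realType}.

(** Heine's theorem. *)
Lemma uniform_continuity_segment (a b : R) (g : R -> R) :
  (forall t, a <= t <= b -> {for t, continuous g}) -> forall e : R, 0 < e ->
  exists2 d : R, 0 < d & forall s t, a <= s <= b -> a <= t <= b -> `|s - t| < d -> `|g s - g t| < e.
Proof.
move=> gc e e0; have half (x y z h : R) : z <= x + y -> x < h / 2 -> y < h / 2 -> z < h by lra.
have := @segment_compact R a b; rewrite compact_near_coveringP => cov.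
pose P d t := forall s, a <= s <= b -> `|s - t| < d -> `|g s - g t| < e.
have : \forall d \near 0^'+, `[a, b] `<=` P d.
  apply: (cov R (0^'+) P) => t; rewrite /= in_itv /= => ht.
  have /cvgrPdist_lt /(_ (e / 2)) := gc t ht; rewrite divr_gt0 // => /(_ isT) /nbhs_ballP[h /= h0 hP].
  exists (ball t (h / 2), [set d | d < h / 2]).
    by split; [apply: nbhsx_ballx; rewrite divr_gt0|apply: nbhs_right_lt; rewrite divr_gt0].
  move=> [t' d] [/= tt' dh] s hs st'; rewrite /ball /= in tt'.
  have tt2 : `|t - t'| < h by apply: lt_le_trans tt' _; rewrite ler_pdivrMr // ler_pMr // ler1n.
  have ts : `|t - s| < h.
    have := ler_normD (t - t') (t' - s); rewrite addrA subrK (distrC t' s) => h1.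
    exact: (half _ _ _ _ h1 tt' (lt_trans st' dh)).
  have := hP s; rewrite /ball /= => /(_ ts) g1; have := hP t'; rewrite /ball /= => /(_ tt2) g2.
  have := ler_normD (g s - g t) (g t - g t'); rewrite addrA subrK (distrC (g s) (g t)) => h1.
  exact: (half _ _ _ _ h1 g1 g2).
move=> [d /= d0 dP]; exists (d / 2); first by rewrite divr_gt0.
move=> s t hs ht st; apply: (dP (d / 2)) => //=.
- by rewrite sub0r normrN gtr0_norm ?divr_gt0 // ltr_pdivrMr // ltr_pMr // ltr1n.
- by rewrite divr_gt0.
Qed.

Lemma interval_concatenation (P : R -> R -> Prop) (a b d : R) : a < b -> 0 < d ->
  (forall u v w, a <= u -> u < v -> v < w -> w <= b -> P u v -> P v w -> P u w) ->
  (forall u v, a <= u -> u < v -> v <= b -> v - u < d -> P u v) -> P a b.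
Proof.
move=> ab d0 cat short; pose N := (Num.truncn ((b - a) / d)).+1.
pose h := (b - a) / N%:R; have N0 : 0 < N%:R :> R by rewrite ltr0n.
have h0 : 0 < h by rewrite divr_gt0 // subr_gt0.
have hd : h < d.
  rewrite ltr_pdivrMr // mulrC -ltr_pdivrMr //; exact: Num.Theory.truncnS_gt.
have hN : a + N%:R * h = b by rewrite mulrC divfK ?gt_eqF // addrC subrK.
have in_b i : (i <= N)%N -> a + i%:R * h <= b.
  by move=> iN; rewrite -hN lerD2l ler_wpM2r ?(ltW h0) // ler_nat.
suff : forall i, (i < N)%N -> P a (a + i.+1%:R * h) by move=> /(_ N.-1 (ltnSn _)); rewrite hN.
elim=> [|i ih] iN.
  by apply: short; rewrite ?in_b // mul1r ?ltrDl // addrC addKr.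
have e1 : a + i.+2%:R * h - (a + i.+1%:R * h) = h.
  by rewrite -[i.+2%:R]natr1; ring.
apply: (cat a (a + i.+1%:R * h)) => //; last 2 first.
- exact/ih/ltnW.
- apply: short; rewrite ?in_b ?e1 //; last by rewrite -subr_gt0 e1.
  by rewrite lerDl mulr_ge0 // ltW.
- by rewrite ltrDl mulr_gt0.
- by rewrite -subr_gt0 e1.
- exact: in_b.
Qed.

End Concatenation.

Lemma lee_of_powers {R : realType} (x y : \bar R) k : (0 <= y)%E ->
  (forall lam : R, 1 < lam -> (x <= (lam ^+ k)%:E * y)%E) -> (x <= y)%E.
Proof.
move=> y0 xy; have [->|] := eqVneq y +oo%E; first by rewrite leey.
rewrite -ltey -ge0_fin_numE // => yfin; rewrite -(fineK yfin).
apply/lee_addgt0Pr => e e0; set z := fine y.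
have z0 : 0 <= z by rewrite fine_ge0.
have pc : (fun l : R => l ^+ k * z) @ (1 : R) --> (1 : R) ^+ k * z.
  by apply: cvgM; [exact: exprn_continuous|exact: cvg_cst].
have ze : 1 ^+ k * z < z + e by rewrite expr1n mul1r ltrDl.
move: (pc) => /cvgr_lt /(_ _ ze) /nbhs_ballP [d /= d0 dP].
have d2 : 0 < d / 2 by rewrite divr_gt0.
apply: (le_trans (xy (1 + d / 2) _)); first by rewrite ltrDl.
rewrite -(fineK yfin) -/z -EFinM -EFinD lee_fin; apply/ltW/dP.
rewrite /ball /= opprD addrA subrr sub0r normrN gtr0_norm //.
by rewrite ltr_pdivrMr // ltr_pMr // ltr1n.
Qed.

Section TubeVolume.
Local Open Scope ereal_scope.
Context {R : realType} {q : nat} {r a b : R}.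
Context {f : R -> 'rV[R]_q.+3} {W : 'I_q.+2 -> R -> 'rV[R]_q.+3}.
Variable nu : R -> R.
Hypothesis ab : (a < b)%R.
Hypothesis nu_gt0 : forall t, (a <= t <= b)%R -> (0 < nu t)%R.
Hypothesis nu_continuous : forall t, (a <= t <= b)%R -> {for t, continuous nu}.

Let Tube I := hausdorff q.+2 (tube_set f W (sphere r) I).
Let S : \bar R := hausdorff q.+1 (sphere r : set 'rV[R]_q.+2).
Let arc u v := \int[lebesgue_measure]_(t in `]u, v]) (nu t)%:E.

Hypothesis slice : forall lam : R, (1 < lam)%R -> exists2 d, (0 < d)%R & forall u v I,
  (a <= u)%R -> (u < v)%R -> (v <= b)%R -> (v - u < d)%R -> between u v I ->
  let T := Tube I * cube_measure q.+1 in
  let B := (nu u * (v - u))%:E * cube_measure q.+2 * S in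
  T <= (lam ^+ q.+2)%:E * B /\ B <= (lam ^+ q.+1 * lam ^+ q.+2)%:E * T.
Hypothesis time_sum : forall (J K : set R) (s : R), J `<=` `[a, b] -> K `<=` `[a, b] ->
  (forall t, J t -> t <= s)%R -> (forall t, K t -> s < t)%R ->
  Tube (J `|` K) = Tube J + Tube K.

Let nu_measurable : measurable_fun `[a, b] (fun t => (nu t)%:E).
Proof.
apply/measurable_EFinP; apply: subspace_continuous_measurable_fun; first exact: measurable_itv.
by apply: continuous_in_subspaceT => t; rewrite inE /= in_itv /=; exact: nu_continuous.
Qed.

Let sub_itv (u v : R) : (a <= u)%R -> (v <= b)%R -> `]u, v] `<=` `[a, b].
Proof.
move=> au vb t; rewrite /= !in_itv /= => /andP[ut tv].
by rewrite (le_trans au (ltW ut)) (le_trans tv vb).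
Qed.

Let arc_add (u v w : R) : (a <= u)%R -> (u < v)%R -> (v < w)%R -> (w <= b)%R ->
  arc u w = arc u v + arc v w.
Proof.
move=> au uv vw wb; have uvw : `]u, w]%classic = `]u, v] `|` `]v, w].
  apply/seteqP; split=> t /=; rewrite !in_itv /=.
    by move=> /andP[ut tw]; have [tv|vt] := leP t v; [left; rewrite ut|right].
  move=> [/andP[ut tv]|/andP[vt tw]]; first by rewrite ut (le_trans tv (ltW vw)).
  by rewrite (lt_trans uv vt).
rewrite /arc uvw ge0_integral_setU //; try exact: measurable_itv.
- rewrite -uvw; apply: measurable_funS nu_measurable; first exact: measurable_itv.
  exact: sub_itv.
- move=> t; rewrite -uvw => /(sub_itv au wb); rewrite /= in_itv /= => /nu_gt0 h.
  by rewrite lee_fin ltW.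
- apply/eqP/seteqP; split=> // t /=; rewrite !in_itv /= => -[/andP[_ tv] /andP[vt _]].
  by have := le_lt_trans tv vt; rewrite ltxx.
Qed.

Let arc_bounds (lam : R) (u v : R) : (0 < lam)%R -> (a <= u)%R -> (u < v)%R -> (v <= b)%R ->
  (forall t, u <= t <= v -> nu t <= lam * nu u /\ nu u <= lam * nu t)%R ->
  arc u v <= (lam * (nu u * (v - u)))%:E /\ (nu u * (v - u))%:E <= lam%:E * arc u v.
Proof.
move=> lam0 au uv vb nuP.
have mD : measurable (`]u, v]%classic : set R) by exact: measurable_itv.
have cstE (k : R) : \int[lebesgue_measure]_(t in `]u, v]) (cst k%:E t : \bar R) = (k * (v - u))%:E.
  rewrite integral_cst //; have := @lebesgue_measure_itv R `]u, v]; rewrite /= lte_fin uv => ->.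
  by rewrite -EFinB -EFinM.
have mnu : measurable_fun `]u, v] (fun t => (nu t)%:E).
  by apply: measurable_funS nu_measurable; [exact: measurable_itv|exact: sub_itv].
have nu0 t : `]u, v]%classic t -> 0 <= (nu t)%:E.
  by move=> /(sub_itv au vb); rewrite /= in_itv /= => /nu_gt0 h; rewrite lee_fin ltW.
have uvP t : `]u, v]%classic t -> (u <= t <= v)%R.
  by rewrite /= in_itv /= => /andP[/ltW -> ->].
have u_ab : (a <= u <= b)%R by rewrite au (le_trans (ltW uv)).
have nuu := nu_gt0 u_ab.
split.
  by rewrite mulrA -cstE; apply: ge0_le_integral => // t Dt; rewrite /= lee_fin; have [] := nuP t (uvP t Dt).
rewrite /arc -ge0_integralZl_EFin //; last exact: ltW.
rewrite -cstE; apply: ge0_le_integral => // [t Dt||t Dt].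
- by rewrite lee_fin ltW.
- by apply: measurable_funeM.
- by rewrite /= -EFinM lee_fin; have [] := nuP t (uvP t Dt).
Qed.

(** On a short interval the speed is almost constant, so that the estimates of
[slice] can be written with the arc length; in this form they concatenate. *)
Let slice_arc (lam : R) : (1 < lam)%R -> exists2 d, (0 < d)%R & forall u v,
  (a <= u)%R -> (u < v)%R -> (v <= b)%R -> (v - u < d)%R ->
  Tube `[u, v] * cube_measure q.+1
    <= (lam ^+ q.+3)%:E * (cube_measure q.+2 * S * arc u v) /\
  cube_measure q.+2 * S * arc u v
    <= (lam ^+ (q.+1 + q.+3))%:E * (Tube `]u, v] * cube_measure q.+1).
Proof.
move=> lam1; have lam0 : (0 < lam)%R by exact: lt_trans lam1.
have [d1 d10 sl] := slice lam1.
have [n0 n00 nu_n0] : exists2 n0, (0 < n0)%R & forall t, (a <= t <= b)%R -> (n0 <= nu t)%R.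
  have [|t0 t0ab tmin] := @EVT_min R nu a b (ltW ab).
    by apply: continuous_in_subspaceT => t; rewrite inE /= in_itv /=; exact: nu_continuous.
  exists (nu t0); first by apply: nu_gt0; move: t0ab; rewrite in_itv.
  by move=> t tab; apply: tmin; rewrite in_itv.
pose g : R := (1 - lam^-1)%R; have g0 : (0 < g)%R by rewrite subr_gt0 invf_lt1.
have [d2 d20 unif] := uniform_continuity_segment nu_continuous (mulr_gt0 g0 n00).
have lamV : (lam * (1 - g) = 1)%R by rewrite /g opprB addrCA subrr addr0 divff // gt_eqF.
have near (x y : R) : (n0 <= x)%R -> (n0 <= y)%R -> (`|x - y| < g * n0)%R -> (x <= lam * y)%R.
  move=> nx ny; rewrite ltr_norml => /andP[_ xy].
  rewrite -[x in leLHS]mul1r -lamV -mulrA ler_pM2l // mulrBl mul1r.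
  have : (g * n0 <= g * x)%R by rewrite ler_pM2l.
  by lra.
exists (Num.min d1 d2); first by rewrite lt_min d10.
move=> u v au uv vb; rewrite lt_min => /andP[uvd1 uvd2].
have u_ab : (a <= u <= b)%R by rewrite au (le_trans (ltW uv)).
have [|arc1 arc2] := arc_bounds lam0 au uv vb.
  move=> t /andP[ut tv]; have t_ab : (a <= t <= b)%R by rewrite (le_trans au) // (le_trans tv).
  have tu : (`|t - u| < d2)%R by rewrite ger0_norm ?subr_ge0 // (le_lt_trans _ uvd2) // lerB.
  split; apply: near; rewrite ?nu_n0 // ?[(`|nu u - _|)%R]distrC; exact: unif.
have C20 : 0 <= cube_measure q.+2 :> \bar R by exact: hausdorff_ge0.
have S0 : 0 <= S by exact: hausdorff_ge0.
have CS0 : 0 <= cube_measure q.+2 * S by exact: mule_ge0.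
have pow0 k : 0 <= (lam ^+ k)%:E by rewrite lee_fin exprn_ge0 // ltW.
have oc : `]u, v[ `<=` `]u, v] by move=> t; rewrite /= !in_itv /= => /andP[-> /ltW ->].
have oC : `]u, v] `<=` `[u, v] by move=> t; rewrite /= !in_itv /= => /andP[/ltW -> ->].
split.
  have [up _] := sl u v `[u, v]%classic au uv vb uvd1 (conj (subset_trans oc oC) (@subset_refl _ _)).
  apply: le_trans up _; rewrite [in leRHS]exprSr (EFinM (lam ^+ q.+2)) -[leRHS]muleA; apply: lee_wpmul2l => //.
  rewrite -muleA muleC [leRHS]muleCA; apply: lee_wpmul2l => //.
have [_ down] := sl u v `]u, v]%classic au uv vb uvd1 (conj oc oC).
apply: (@le_trans _ _ (cube_measure q.+2 * S * (lam%:E * ((nu u * (v - u))%:E)))).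
  apply: lee_wpmul2l => //.
rewrite muleCA addnS exprS (EFinM lam) -[leRHS]muleA; apply: lee_wpmul2l; first by rewrite lee_fin ltW.
rewrite exprD; apply: le_trans down.
by rewrite -[leRHS]muleA muleC.
Qed.

(** Upper bounds concatenate for closed intervals, by subadditivity, and lower bounds
for half-open intervals, by additivity. *)
Lemma tube_volume : Tube `[a, b] * cube_measure q.+1 =
  cube_measure q.+2 * S * \int[lebesgue_measure]_(t in `[a, b]) (nu t)%:E.
Proof.
have arcE : \int[lebesgue_measure]_(t in `[a, b]) (nu t)%:E = arc a b.
  rewrite /arc integral_itv_obnd_cbnd //.
  by apply: measurable_funS nu_measurable; [exact: measurable_itv|exact: sub_itv].
have C10 : 0 <= cube_measure q.+1 :> \bar R by exact: hausdorff_ge0.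
have C20 : 0 <= cube_measure q.+2 :> \bar R by exact: hausdorff_ge0.
have S0 : 0 <= S by exact: hausdorff_ge0.
have CS0 : 0 <= cube_measure q.+2 * S by exact: mule_ge0.
have Tube0 I : 0 <= Tube I by exact: hausdorff_ge0.
have arc0 u v : (a <= u)%R -> (v <= b)%R -> 0 <= arc u v.
  move=> au vb; apply: integral_ge0 => t /(sub_itv au vb); rewrite /= in_itv /= => /nu_gt0 h.
  by rewrite lee_fin ltW.
have pow0 (lam : R) k : (1 < lam)%R -> 0 <= (lam ^+ k)%:E.
  by move=> lam1; rewrite lee_fin exprn_ge0 // (le_trans ler01 (ltW lam1)).
have up lam : (1 < lam)%R -> Tube `[a, b] * cube_measure q.+1
    <= (lam ^+ q.+3)%:E * (cube_measure q.+2 * S * arc a b).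
  move=> lam1; have [d d0 dP] := slice_arc lam1.
  apply: (@interval_concatenation R (fun u v => Tube `[u, v] * cube_measure q.+1
    <= (lam ^+ q.+3)%:E * (cube_measure q.+2 * S * arc u v)) a b d) => // [u v w au uv vw wb h1 h2|].
    have uvw : `[u, w]%classic = `[u, v] `|` `]v, w].
      apply/seteqP; split=> t /=; rewrite !in_itv /=.
        by move=> /andP[ut tw]; have [tv|vt] := leP t v; [left; rewrite ut|right].
      move=> [/andP[ut tv]|/andP[vt tw]]; first by rewrite ut (le_trans tv (ltW vw)).
      by rewrite tw (le_trans (ltW uv) (ltW vt)).
    apply: (@le_trans _ _ ((Tube `[u, v] + Tube `[v, w]) * cube_measure q.+1)).
      apply: lee_wpmul2r => //; apply: le_trans (outer_measureU2 (@hausdorff R q.+3 q.+2) _ _).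
      apply: le_hausdorff => _ [X Xr [t tuw <-]].
      move: tuw; rewrite uvw => -[tuv|tvw]; [left|right]; exists X => //; exists t => //.
      by move: tvw; rewrite /= !in_itv /= => /andP[/ltW -> ->].
    rewrite ge0_muleDl // (arc_add au uv vw wb) ge0_muleDr ?arc0 ?(le_trans au (ltW uv)) ?(le_trans (ltW vw) wb) //.
    rewrite ge0_muleDr; first exact: leeD.
      by rewrite mule_ge0 // arc0 // (le_trans (ltW vw) wb).
    by rewrite mule_ge0 // arc0 // (le_trans au (ltW uv)).
  by move=> u v au uv vb uvd; have [] := dP u v au uv vb uvd.
have down lam : (1 < lam)%R -> cube_measure q.+2 * S * arc a b
    <= (lam ^+ (q.+1 + q.+3))%:E * (Tube `[a, b] * cube_measure q.+1).
  move=> lam1; have [d d0 dP] := slice_arc lam1.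
  apply: (@le_trans _ _ ((lam ^+ (q.+1 + q.+3))%:E * (Tube `]a, b] * cube_measure q.+1))); last first.
    apply: lee_wpmul2l; first exact: pow0.
    apply: lee_wpmul2r => //; apply: le_hausdorff => _ [X Xr [t tab <-]].
    by exists X => //; exists t => //; move: tab; rewrite /= !in_itv /= => /andP[/ltW -> ->].
  apply: (@interval_concatenation R (fun u v => cube_measure q.+2 * S * arc u v
    <= (lam ^+ (q.+1 + q.+3))%:E * (Tube `]u, v] * cube_measure q.+1)) a b d) => // [u v w au uv vw wb h1 h2|].
    have uvw : `]u, w]%classic = `]u, v] `|` `]v, w].
      apply/seteqP; split=> t /=; rewrite !in_itv /=.
        by move=> /andP[ut tw]; have [tv|vt] := leP t v; [left; rewrite ut|right].
      move=> [/andP[ut tv]|/andP[vt tw]]; first by rewrite ut (le_trans tv (ltW vw)).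
      by rewrite tw (lt_trans uv vt).
    rewrite uvw (@time_sum _ _ v).
    - rewrite ge0_muleDl // (arc_add au uv vw wb) ge0_muleDr ?arc0 ?(le_trans au (ltW uv)) ?(le_trans (ltW vw) wb) //.
      rewrite [leRHS]ge0_muleDr; first exact: leeD.
        by rewrite mule_ge0.
      by rewrite mule_ge0.
    - by apply: sub_itv => //; exact: le_trans (ltW vw) wb.
    - by apply: sub_itv => //; exact: le_trans au (ltW uv).
    - by move=> t; rewrite /= in_itv /= => /andP[].
    - by move=> t; rewrite /= in_itv /= => /andP[].
  by move=> u v au uv vb uvd; have [] := dP u v au uv vb uvd.
rewrite arcE; apply/eqP; rewrite eq_le; apply/andP; split.
  by apply: lee_of_powers up; rewrite mule_ge0 // arc0.
by apply: lee_of_powers down; rewrite mule_ge0.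
Qed.

End TubeVolume.

(** * The Frenet frame along the curve *)

Lemma dist_between {R : realType} (t x s t0 d : R) : t <= x -> x <= s ->
  `|s - t0| < d -> `|t - t0| < d -> `|x - t0| < d.
Proof.
by rewrite !ltr_norml => tx xs /andP[s1 s2] /andP[t1 t2]; apply/andP; split; lra.
Qed.

Section SmoothCurves.
Context {R : realType} {m : nat} {J : set R} {a b : R}.
Hypothesis I_sub_J : `[a, b] `<=` J.
Context {g : R -> 'rV[R]_m}.
Hypothesis g_smooth : smooth_on J g.

Let in_J t : a <= t <= b -> J t.
Proof. by move=> tab; apply: I_sub_J; rewrite /= in_itv. Qed.

Lemma smooth_derivable k t : a <= t <= b -> derivable (derive1n k g) t 1.
Proof. by case: g_smooth => O [_ JO gO] /in_J /JO; exact: gO. Qed.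

Lemma smooth_continuous k t : a <= t <= b -> {for t, continuous (derive1n k g)}.
Proof.
by move=> tab; apply/differentiable_continuous/derivable1_diffP/smooth_derivable.
Qed.

Let coord_derivable k i t : a <= t <= b -> derivable (fun x => derive1n k g x 0 i) t 1.
Proof. by move=> tab; apply/(derivable_mxP _ _ _).1/smooth_derivable. Qed.

Let coord_derive k i t : a <= t <= b ->
  is_derive t 1 (fun x => derive1n k g x 0 i) (derive1n k.+1 g t 0 i).
Proof.
move=> tab; apply: DeriveDef; first exact: coord_derivable.
by rewrite derive1nS derive1E (derive_mx (@smooth_derivable k t tab)) mxE.
Qed.

Let coord_continuous_at k i t : a <= t <= b ->
  {for t, continuous (fun x => derive1n k g x 0 i)}.
Proof.
by move=> tab; apply/differentiable_continuous/derivable1_diffP/coord_derivable.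
Qed.

(** By the mean value theorem in each coordinate and uniform continuity of the
derivative. *)
Lemma smooth_uniform_C1 : uniform_C1 a b g (derive1 g).
Proof.
move=> e e0; pose e1 := e / (m%:R + 1).
have m1 : 0 < m%:R + 1 :> R by rewrite ltr_wpDl.
have e10 : 0 < e1 by rewrite divr_gt0.
have [d d0 dP] : exists2 d : R, 0 < d & forall i s t, a <= s <= b -> a <= t <= b -> `|s - t| < d ->
    `|derive1 g s 0 i - derive1 g t 0 i| < e1.
  apply: (@finite_common_radius R 'I_m (fun i d => forall s t, a <= s <= b -> a <= t <= b ->
      `|s - t| < d -> `|derive1 g s 0 i - derive1 g t 0 i| < e1)).
    by move=> i d d' d'd h s t hs ht st; apply: h => //; exact: lt_le_trans st _.
  move=> i; apply: uniform_continuity_segment => // t tab.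
  exact: (@coord_continuous_at 1%N i t tab).
exists d => // s t t0 hs ht ht0 st0 tt0.
wlog st : s t hs ht st0 tt0 / t <= s.
  move=> h; have [/h|/ltW ts] := leP t s; first exact.
  have -> : g s - g t - (s - t) *: derive1 g t0 = - (g t - g s - (t - s) *: derive1 g t0).
    by apply/rowP => i; rewrite !mxE; ring.
  by rewrite enormN distrC; apply: h.
have coord i : `|(g s - g t - (s - t) *: derive1 g t0) 0 i| <= e1 * `|s - t|.
  have in_ab x : x \in `[t, s] -> a <= x <= b.
    rewrite in_itv /= => /andP[tx xs]; case/andP: hs => _ sb; case/andP: ht => at' _.
    by rewrite (le_trans at' tx) (le_trans xs sb).
  have [||x xts gE] := @MVT_segment R (fun x => g x 0 i) (fun x => derive1 g x 0 i) t s st.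
  - move=> x /subset_itv_oo_cc xts; exact: (@coord_derive 0%N i x (in_ab _ xts)).
  - apply: continuous_in_subspaceT => x; rewrite inE /= => xts.
    exact: (@coord_continuous_at 0%N i x (in_ab _ xts)).
  have -> : (g s - g t - (s - t) *: derive1 g t0) 0 i =
      (derive1 g x 0 i - derive1 g t0 0 i) * (s - t).
    by rewrite !mxE gE; ring.
  rewrite normrM; apply: ler_wpM2r => //; apply/ltW/dP => //; first exact: in_ab.
  by move: xts; rewrite in_itv /= => /andP[tx xs]; exact: (dist_between tx xs st0 tt0).
apply: (le_trans (ler_enorm_coords _)); apply: (le_trans (ler_sum_ord_const coord)).
rewrite mulrA ler_wpM2r // /e1 mulrCA -[leRHS]mulr1 ler_pM2l //.
by rewrite ler_pdivrMr // mul1r lerDl.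
Qed.

Lemma smooth_derivative_bound : a <= b -> exists L : R, forall t, a <= t <= b -> enorm (derive1 g t) <= L.
Proof.
move=> ab; have [t0 _ tmax] : exists2 t0, t0 \in `[a, b] & forall t, t \in `[a, b] ->
    enorm (derive1 g t) <= enorm (derive1 g t0).
  apply: EVT_max => //; apply: continuous_in_subspaceT => t; rewrite inE /= in_itv /= => tab.
  apply: (@continuous_comp _ _ _ (derive1 g) (@enorm R m)); last exact: enorm_continuous.
  exact: (@smooth_continuous 1%N).
by exists (enorm (derive1 g t0)) => t tab; apply: tmax; rewrite in_itv.
Qed.

End SmoothCurves.

Section OrthonormalFamilies.
Context {R : realType} {m : nat} (e : 'rV[R]_m.+1) (w : 'I_m -> 'rV[R]_m.+1).
Hypotheses (ee : dot e e = 1) (ew : forall j, dot e (w j) = 0)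
  (ww : forall i j, dot (w i) (w j) = (i == j)%:R).

Lemma orthonormal_norm s (X : 'rV[R]_m) :
  enorm (s *: e + \sum_j X 0 j *: w j) = enorm (cons_row s X).
Proof.
rewrite /enorm dot_cons; congr Num.sqrt.
have eS : dot e (\sum_j X 0 j *: w j) = 0.
  by rewrite dot_sumr big1 // => j _; rewrite dotZr ew mulr0.
rewrite dotDl !dotDr !dotZl !dotZr ee (dotC _ e) eS !mulr0 addr0 mulr1 add0r; congr (_ + _).
rewrite dot_suml; apply: eq_bigr => i _; rewrite dotZl dot_sumr (bigD1 i) //=.
rewrite dotZr ww eqxx mulr1 big1 ?addr0 // => j ji.
by rewrite dotZr ww eq_sym (negbTE ji) mulr0.
Qed.

(** A square matrix with orthonormal rows has orthonormal columns, so that an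
orthonormal family of maximal size is a basis. *)
Lemma orthonormal_expansion v : v = dot v e *: e + \sum_j dot v (w j) *: w j.
Proof.
pose u i := if unlift ord0 i is Some j then w j else e.
pose Q : 'M[R]_m.+1 := \matrix_i u i.
have uu i j : dot (u i) (u j) = (i == j)%:R.
  rewrite /u; case: (unliftP ord0 i) => [i'|] ->; case: (unliftP ord0 j) => [j'|] ->.
  - by rewrite ww (inj_eq lift_inj).
  - by rewrite dotC ew eq_sym (negbTE (neq_lift _ _)).
  - by rewrite ew (negbTE (neq_lift _ _)).
  - by rewrite eqxx.
have QQT : Q *m Q^T = 1%:M.
  apply/matrixP => i j; rewrite !mxE -uu; apply: eq_bigr => l _.
  by rewrite !mxE.
have {1}-> : v = v *m Q^T *m Q by rewrite -mulmxA (mulmx1C QQT) mulmx1.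
have vQ i : (v *m Q^T) 0 i = dot v (u i).
  by rewrite !mxE; apply: eq_bigr => l _; rewrite !mxE.
rewrite mulmx_sum_row big_ord_recl !vQ rowK /u unlift_none; congr (_ + _).
by apply: eq_bigr => j _; rewrite vQ rowK /u liftK.
Qed.

End OrthonormalFamilies.

Section FrenetTube.
Context {R : realType} {q : nat} {J : set R} {f : R -> 'rV[R]_q.+3}.
Context {kappa : nat -> R -> R} {V : nat -> R -> 'rV[R]_q.+3} {a b r : R}.
Hypotheses (f_smooth : smooth_on J f) (f_regular : forall t, J t -> 0 < speed f t)
  (f_frenet : frenet_apparatus J f kappa V) (ab : a < b) (I_sub_J : `[a, b] `<=` J) (r_gt0 : 0 < r).

Let in_J t : a <= t <= b -> J t.
Proof. by move=> tab; apply: I_sub_J; rewrite /= in_itv. Qed.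

(** All the Frenet equations at once: the matrix of the derivatives in the frame
is tridiagonal and skew-symmetric. *)
Lemma frenet_products i j t : (1 <= i <= q.+3)%N -> (1 <= j <= q.+3)%N -> J t ->
  dot (derive1 (V j) t) (V i t) =
    (i == j.+1)%:R * (kappa j t * speed f t) - (j == i.+1)%:R * (kappa i t * speed f t).
Proof.
move=> hi hj Jt; have orth k : (1 <= k <= q.+3)%N -> dot (V k t) (V i t) = (k == i)%:R.
  by move=> hk; rewrite (frenet_orthonormal f_frenet).
have [j1|jn1] := eqVneq j 1%N.
  rewrite j1 (frenet_first f_frenet Jt) dotZl orth // mulrC (eq_sym 2%N).
  by case: (i) hi => // i' _; rewrite mul0r subr0.
have [jl|jnl] := eqVneq j q.+3.
  rewrite jl (frenet_last f_frenet Jt) dotZl orth ?leqnSn // eqSS.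
  have /negbTE -> : i != q.+4 by case/andP: hi => _; apply: contraTneq => ->; rewrite ltnn.
  by have [<-|_] := eqVneq q.+2 i; rewrite ?mul0r ?mulr0 ?mul1r ?mulr1 sub0r ?oppr0.
have hj2 : (2 <= j <= q.+2)%N.
  case/andP: hj => j1 j2; rewrite ltn_neqAle eq_sym jn1 j1 /=.
  by move: j2; rewrite leq_eqVlt (negbTE jnl).
rewrite (frenet_middle f_frenet hj2 Jt) dotDl !dotZl.
case/andP: hj2 => j2 j3; rewrite !orth; last 2 first.
- by apply/andP; split.
- by apply/andP; split; [rewrite -ltnS prednK // ltnW|rewrite (leq_trans (leq_pred _)) // leqW].
rewrite addrC (eq_sym i) mulrC; congr (_ + _).
have -> : (j == i.+1) = (j.-1 == i) by rewrite -[in RHS]eqSS prednK // ltnW.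
by have [<-|_] := eqVneq j.-1 i; rewrite ?mulr1 ?mul1r ?mulr0 ?mul0r ?oppr0.
Qed.

Let df_tangent t : J t -> derive1 f t = speed f t *: V 1%N t.
Proof.
by move=> Jt; rewrite (frenet_tangent f_frenet Jt) scalerA divff ?scale1r // gt_eqF // f_regular.
Qed.

(** For [s = -1] the principal normal is reversed; this gives a second frame that
parametrizes the same tube. *)
Definition normal_sign (s : R) (j : 'I_q.+2) : R := if j == ord0 then s else 1.

Definition normals (s : R) (j : 'I_q.+2) t := normal_sign s j *: V j.+2 t.

Definition dnormals (s : R) (j : 'I_q.+2) t := normal_sign s j *: derive1 (V j.+2) t.

Definition tube_velocity (s : R) (X : 'rV[R]_q.+2) t :=
  derive1 f t + \sum_j X 0 j *: dnormals s j t.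

Definition tangent_speed (s : R) (X : 'rV[R]_q.+2) t :=
  speed f t - s * X 0 ord0 * (kappa 1%N t * speed f t).

Definition normal_velocity (s : R) (X : 'rV[R]_q.+2) t : 'rV[R]_q.+2 :=
  \row_i dot (tube_velocity s X t) (normals s i t).

Let sign_sq s j : s ^+ 2 = 1 -> normal_sign s j * normal_sign s j = 1.
Proof. by rewrite /normal_sign; case: ifP => _ s2; [rewrite -expr2|rewrite mulr1]. Qed.

Let rank (j : 'I_q.+2) : (1 <= j.+2 <= q.+3)%N.
Proof. by apply/andP; split=> //; rewrite ltnS; exact: ltn_ord. Qed.

Let tangent_unit t : J t -> dot (V 1%N t) (V 1%N t) = 1.
Proof. by move=> Jt; rewrite (@frenet_orthonormal _ _ _ _ _ _ f_frenet 1%N 1%N t). Qed.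

Let tangent_normal s t : J t -> forall j, dot (V 1%N t) (normals s j t) = 0.
Proof.
move=> Jt j; rewrite dotZr (frenet_orthonormal f_frenet _ (rank j) Jt) //.
by rewrite (_ : (1 == j.+2)%N = false) // mulr0.
Qed.

Let normals_orthonormal s t : s ^+ 2 = 1 -> J t ->
  forall i j, dot (normals s i t) (normals s j t) = (i == j)%:R.
Proof.
move=> s2 Jt i j; rewrite dotZl dotZr (frenet_orthonormal f_frenet (rank i) (rank j) Jt) !eqSS.
have [->|ij] := eqVneq i j; first by rewrite eqxx mulr1 sign_sq.
by rewrite (_ : (nat_of_ord i == j) = false) ?mulr0 //; apply/negbTE.
Qed.

Let velocity_tangent s X t : J t -> dot (tube_velocity s X t) (V 1%N t) = tangent_speed s X t.
Proof.
move=> Jt; rewrite dotDl (df_tangent Jt) dotZl (tangent_unit Jt) mulr1 dot_suml.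
rewrite /tangent_speed -mulNr; congr (_ + _).
rewrite big_ord_recl big1 => [|j _].
  rewrite addr0 dotZl dotZl frenet_products //= /normal_sign eqxx; ring.
by rewrite dotZl dotZl frenet_products ?rank //= ; ring.
Qed.

Let velocity_norm s X t : s ^+ 2 = 1 -> J t ->
  tube_velocity s X t = tangent_speed s X t *: V 1%N t +
    \sum_j normal_velocity s X t 0 j *: normals s j t.
Proof.
move=> s2 Jt; rewrite [LHS](orthonormal_expansion (tangent_unit Jt) (tangent_normal s Jt)
  (normals_orthonormal s2 Jt)) (velocity_tangent s X Jt); congr (_ + _).
by apply: eq_bigr => j _; rewrite mxE.
Qed.

(* the derivatives of the normals have skew-symmetric normal components *)
Let velocity_radial s X t : J t -> dot (normal_velocity s X t) X = 0.
Proof.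
move=> Jt; pose G i j := X 0 i * X 0 j * dot (dnormals s j t) (normals s i t).
have skew i j : G i j = - G j i.
  by rewrite /G !dotZl !dotZr !frenet_products ?rank //; ring.
have E : dot (normal_velocity s X t) X = \sum_i \sum_j G i j.
  apply: eq_bigr => i _; rewrite mxE dotDl (df_tangent Jt) dotZl (tangent_normal s Jt) mulr0 add0r.
  rewrite dot_suml mulr_suml; apply: eq_bigr => j _; rewrite dotZl /G; ring.
have : \sum_i \sum_j G i j = - \sum_i \sum_j G i j.
  rewrite {1}exchange_big /= -sumrN; apply: eq_bigr => i _; rewrite -sumrN.
  by apply: eq_bigr => j _; rewrite skew.
by rewrite E; lra.
Qed.

Let uniform_C1_scale m (g dg : R -> 'rV[R]_m) (k : R) : uniform_C1 a b g dg ->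
  uniform_C1 a b (fun t => k *: g t) (fun t => k *: dg t).
Proof.
move=> gC e e0; have k0 : 0 < `|k| + 1 by rewrite ltr_wpDl.
have [d d0 dP] := gC (e / (`|k| + 1)) (divr_gt0 e0 k0); exists d => // s t t0 hs ht ht0 sd td.
rewrite -scalerBr scalerA (mulrC (s - t)) -scalerA -scalerBr enormZ.
apply: (le_trans (ler_wpM2l (normr_ge0 k) (dP s t t0 hs ht ht0 sd td))).
rewrite mulrA; apply: ler_wpM2r => //.
by rewrite mulrA ler_pdivrMr // mulrC ler_pM2l // lerDl.
Qed.

Lemma normal_smooth (j : 'I_q.+2) : smooth_on J (V j.+2).
Proof. exact: (frenet_smooth f_frenet (rank j)). Qed.

Lemma speed_continuous t : a <= t <= b -> {for t, continuous (speed f)}.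
Proof.
move=> tab; apply: (@continuous_comp _ _ _ (derive1 f) (@enorm R _)); last exact: enorm_continuous.
exact: (smooth_continuous I_sub_J f_smooth (k := 1)).
Qed.

(* the positivity of the tangential velocity at the two poles of the sphere *)
Hypothesis curvature_bound : forall t, a <= t <= b ->
  r * `|kappa 1%N t * speed f t| < speed f t.

Lemma tangent_speed_min s : s ^+ 2 = 1 -> exists2 c0, 0 < c0 & forall X t,
  enorm X = r -> a <= t <= b -> c0 <= tangent_speed s X t.
Proof.
move=> s2; pose h t := dot (derive1 (V 1%N) t) (V 2%N t).
have hE t : a <= t <= b -> h t = kappa 1%N t * speed f t.
  move=> tab; rewrite /h (frenet_first f_frenet (in_J tab)) dotZl.
  by rewrite (@frenet_orthonormal _ _ _ _ _ _ f_frenet 2%N 2%N t) ?mulr1 //; exact: in_J.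
have Vc k j t : (1 <= j <= q.+3)%N -> a <= t <= b -> {for t, continuous (derive1n k (V j))}.
  by move=> hj; apply: (smooth_continuous I_sub_J (frenet_smooth f_frenet hj)).
have coord k j i t : (1 <= j <= q.+3)%N -> a <= t <= b ->
    {for t, continuous (fun x => derive1n k (V j) x 0 i)}.
  move=> hj tab; apply: (@continuous_comp _ _ _ (derive1n k (V j)) (fun x : 'rV[R]_q.+3 => x 0 i)).
    exact: Vc.
  exact: coord_continuous.
have hc t : a <= t <= b -> {for t, continuous h}.
  move=> tab; rewrite /h /dot.
  have -> : (fun t => \sum_i derive1 (V 1%N) t 0 i * V 2%N t 0 i) =
      \sum_i (fun t => derive1 (V 1%N) t 0 i * V 2%N t 0 i).
    by apply/funext => x; rewrite fct_sumE.
  elim/big_ind: _ => [|g1 g2|i _]; [exact: cvg_cst|exact: continuousD|].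
  by apply: continuousM; [exact: (coord 1%N 1%N i t)|exact: (coord 0%N 2%N i t)].
have [t0 t0ab tmin] : exists2 c, c \in `[a, b] & forall t, t \in `[a, b] ->
    speed f c - r * `|h c| <= speed f t - r * `|h t|.
  apply: EVT_min; first exact: ltW.
  apply: continuous_in_subspaceT => t; rewrite inE /= in_itv /= => tab.
  apply: continuousB; first exact: speed_continuous.
  apply: continuousM; first exact: cvg_cst.
  by apply: (@continuous_comp _ _ _ h Num.norm); [exact: hc|exact: norm_continuous].
exists (speed f t0 - r * `|h t0|).
  have t0_ab : a <= t0 <= b by move: t0ab; rewrite in_itv.
  by rewrite subr_gt0 hE // curvature_bound.
move=> X t Xr tab; apply: (le_trans (tmin t _)); first by rewrite in_itv.
rewrite /tangent_speed -(hE t tab) lerD2l lerN2.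
apply: (le_trans (ler_norm _)); rewrite !normrM.
have -> : `|s| = 1 by apply/eqP; rewrite -sqrp_eq1 // real_normK ?num_real // s2.
by rewrite mul1r ler_wpM2r // -Xr ler_coord_enorm.
Qed.

Lemma frenet_frame s : s ^+ 2 = 1 -> adapted_frame r a b f (derive1 f) (V 1%N)
  (normals s) (dnormals s) (tangent_speed s) (normal_velocity s).
Proof.
move=> s2; split.
- exact: (smooth_uniform_C1 I_sub_J f_smooth).
- move=> j; apply: uniform_C1_scale; exact: (smooth_uniform_C1 I_sub_J (normal_smooth j)).
- have [Lf LfP] := smooth_derivative_bound I_sub_J f_smooth (ltW ab).
  have /choice [LV LVP] : forall j : 'I_q.+2, exists L, forall t, a <= t <= b ->
      enorm (derive1 (V j.+2) t) <= L.
    by move=> j; exact: (smooth_derivative_bound I_sub_J (normal_smooth j) (ltW ab)).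
  pose L := \sum_j `|LV j|; have L0 : 0 <= L by exact: sumr_ge0.
  have dn j t : a <= t <= b -> enorm (dnormals s j t) <= L.
    move=> tab; have s1 : `|normal_sign s j| = 1.
      by apply/eqP; rewrite -sqrp_eq1 // real_normK ?num_real // expr2 sign_sq.
    rewrite enormZ s1 mul1r (le_trans (LVP j t tab)) // (le_trans (ler_norm _)) //.
    by rewrite /L (bigD1 j) //= lerDl sumr_ge0.
  exists (`|Lf| + q.+2%:R * (r * L) + L) => t tab; split=> [j|X Xr].
    by rewrite (le_trans (dn j t tab)) // lerDr addr_ge0 // mulr_ge0 // mulr_ge0 // ltW.
  apply: (@le_trans _ _ (enorm (tube_velocity s X t))).
    rewrite (velocity_norm X s2 (in_J tab)) (orthonormal_norm (tangent_unit (in_J tab))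
      (tangent_normal s (in_J tab)) (normals_orthonormal s2 (in_J tab))).
    by rewrite -[X in enorm X <= _](tail_cons (tangent_speed s X t)) ler_enorm_tail.
  rewrite -[leLHS]addr0; apply: lerD => //; apply: (le_trans (ler_enormD _ _)); apply: lerD.
    by apply: (le_trans (LfP t tab)); exact: ler_norm.
  apply: (le_trans (ler_enorm_sum _ _ _)); apply: ler_sum_ord_const => j; rewrite enormZ.
  by apply: ler_pM; rewrite ?enorm_ge0 ?dn // -Xr ler_coord_enorm.
- exact: tangent_speed_min.
- by move=> X t _ tab; apply: velocity_radial; exact: in_J.
- move=> t k X tab; apply: orthonormal_norm.
  + exact/tangent_unit/in_J.
  + exact/tangent_normal/in_J.
  + exact/normals_orthonormal/in_J.
- by move=> X t tab; exact/velocity_norm/in_J.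
Qed.

End FrenetTube.

(** * The volume of the sphere tube *)

Section SignChange.
Context {R : realType} {q : nat}.
Variables (f : R -> 'rV[R]_q.+3) (V : nat -> R -> 'rV[R]_q.+3).

(** Changing the sign of the principal normal is a reflection of the parameter
sphere. *)
Definition sign_flip (s : R) (X : 'rV[R]_q.+2) : 'rV[R]_q.+2 :=
  \row_j (normal_sign s j * X 0 j).

Lemma sign_flipK s : s ^+ 2 = 1 -> involutive (sign_flip s).
Proof.
move=> s2 X; apply/rowP => j; rewrite !mxE /normal_sign; case: ifP => _; last by rewrite !mul1r.
by rewrite mulrA -expr2 s2 mul1r.
Qed.

Lemma enorm_sign_flip s X : s ^+ 2 = 1 -> enorm (sign_flip s X) = enorm X.
Proof.
move=> s2; congr Num.sqrt; apply: eq_bigr => j _; rewrite !mxE /normal_sign.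
case: ifP => _; last by rewrite !mul1r.
by rewrite mulrACA -expr2 s2 mul1r.
Qed.

Lemma tube_normals s X t : tube f (normals (V := V) s) X t = tube_map f V (sign_flip s X) t.
Proof.
congr (_ + _); apply: eq_bigr => j _.
by rewrite /normals scalerA mxE mulrC.
Qed.

Lemma tube_set_normals s r I : s ^+ 2 = 1 ->
  tube_set f (normals (V := V) s) (sphere r) I =
  \bigcup_(X in sphere r) [set tube_map f V X t | t in I].
Proof.
move=> s2; apply/seteqP; split=> y [X Xr [t It <-]].
  exists (sign_flip s X); first by rewrite /sphere /= enorm_sign_flip.
  by exists t => //; rewrite tube_normals.
exists (sign_flip s X); first by rewrite /sphere /= enorm_sign_flip.
by exists t => //; rewrite tube_normals sign_flipK.
Qed.

End SignChange.

Theorem corollary6p14 (R : realType) (n : nat) (n_ge2 : (2 <= n)%N)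
    (J : set R) (J_itv : is_interval J)
    (f : R -> 'rV[R]_n.+1) (f_smooth : smooth_on J f)
    (f_regular : forall t, J t -> 0 < speed f t)
    (kappa : nat -> R -> R) (V : nat -> R -> 'rV[R]_n.+1)
    (f_frenet : frenet_apparatus J f kappa V)
    (a b : R) (lt_ab : a < b) (I_sub_J : `[a, b] `<=` J)
    (r : R) (r_gt0 : 0 < r)
    (G_tube : exists U : set ('rV[R]_n * R),
      [/\ open U, tube_domain r a b `<=` U,
          forall p q, U p -> J p.2 -> U q -> J q.2 ->
            tube_map f V p.1 p.2 = tube_map f V q.1 q.2 -> p = q
        & forall p, U p -> J p.2 ->
            0 < speed f p.2 * (1 - p.1 0 (Ordinal (ltnW n_ge2)) * kappa 1%N p.2)]) :
  vol n (tube_lateral f V r a b)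
    = (vol n.-1 (sphere r : set 'rV[R]_n) * arc_length f a b)%E.
Proof.
case: n n_ge2 f f_smooth f_regular V f_frenet G_tube => [//|[//|q]] n_ge2 f f_smooth f_regular V
  f_frenet [U [_ domU U_inj U_pos]].
have in_J t : a <= t <= b -> J t by move=> tab; apply: I_sub_J; rewrite /= in_itv.
have in_U X t : enorm X = r -> a <= t <= b -> U (X, t) by move=> Xr tab; apply: domU; rewrite /tube_domain /= Xr.
have o0 : Ordinal (ltnW n_ge2) = ord0 by exact: val_inj.
(* evaluate the hypothesis on the tube at the two points of the sphere on the first
   axis *)
have curv t : a <= t <= b -> r * `|kappa 1%N t * speed f t| < speed f t.
  move=> tab; have Jt := in_J t tab; have nu0 := f_regular t Jt.
  have side s : s ^+ 2 = 1 -> 0 < speed f t * (1 - s * r * kappa 1%N t).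
    move=> s2; pose X : 'rV[R]_q.+2 := cons_row (s * r) 0.
    have Xr : enorm X = r.
      rewrite /enorm dot_cons (_ : dot _ _ = 0) ?addr0; last by rewrite -(scale0r 0) dotZr mul0r.
      by rewrite mulrACA -expr2 s2 mul1r -expr2 sqrtr_sqr gtr0_norm.
    by have := U_pos (X, t) (in_U X t Xr tab) Jt; rewrite /= o0 cons_row0.
  have p1 := side 1 (expr1n _ _); have p2 := side (-1) (sqrr_sign _ 1).
  rewrite -[r in ltLHS]gtr0_norm // -normrM ltr_norml; apply/andP; split; lra.
have s1 : (1 : R) ^+ 2 = 1 by rewrite expr1n.
have s2 : (-1 : R) ^+ 2 = 1 by rewrite sqrrN expr1n.
have frame s (ss : s ^+ 2 = 1) :=
  frenet_frame f_smooth f_regular f_frenet lt_ab I_sub_J r_gt0 curv ss.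
have inj s : s ^+ 2 = 1 -> forall X X' t t', enorm X = r -> enorm X' = r ->
    a <= t <= b -> a <= t' <= b ->
    tube f (normals (V := V) s) X t = tube f (normals (V := V) s) X' t' -> X = X' /\ t = t'.
  move=> ss X X' t t' Xr X'r tab t'ab; rewrite !tube_normals => e.
  have Xs : enorm (sign_flip s X) = r by rewrite enorm_sign_flip.
  have X's : enorm (sign_flip s X') = r by rewrite enorm_sign_flip.
  have [] := U_inj (sign_flip s X, t) (sign_flip s X', t') (in_U _ _ Xs tab) (in_J _ tab)
    (in_U _ _ X's t'ab) (in_J _ t'ab) e.
  by move=> /(congr1 (sign_flip s)); rewrite !sign_flipK.
have fc t : a <= t <= b -> {for t, continuous f}.
  exact: (smooth_continuous I_sub_J f_smooth (k := 0)).
have Wc s j t : a <= t <= b -> {for t, continuous (normals (V := V) s j)}.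
  move=> tab; apply: continuousZl_tmp.
  exact: (smooth_continuous I_sub_J (normal_smooth f_frenet j) (k := 0)).
have sep s (ss : s ^+ 2 = 1) := tube_separated fc (Wc s) (inj s ss).
have slice := tube_time_slice r_gt0 (frame 1 s1) (frame (-1) s2).
have time := tube_time_sum (sep 1 s1).
have volume := @tube_volume R q r a b f (normals (V := V) 1) (speed f) lt_ab _ _ _ time.
have lateral : tube_lateral f V r a b = tube_set f (normals (V := V) 1) (sphere r) `[a, b].
  rewrite tube_set_normals //; apply/seteqP; split=> [_ [[X t] [/= X1 tab] <-]|_ [X Xr [t tab <-]]].
    exists (r *: X); first by rewrite /sphere /= enormZ X1 mulr1 gtr0_norm.
    by exists t => //; rewrite /= in_itv.
  exists (r^-1 *: X, t) => /=; last by rewrite scalerA divff ?scale1r // gt_eqF.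
  split; last by move: tab; rewrite /= in_itv.
  by rewrite /sphere /= enormZ Xr gtr0_norm ?invr_gt0 // mulVf // gt_eqF.
have {volume} : (hausdorff q.+2 (tube_lateral f V r a b) * cube_measure q.+1 =
  cube_measure q.+2 * hausdorff q.+1 (sphere r : set 'rV[R]_q.+2) * arc_length f a b)%E.
  rewrite lateral; apply: volume.
  - by move=> t tab; apply: f_regular; exact: in_J.
  - by move=> t tab; exact: (speed_continuous f_smooth I_sub_J tab).
  - apply: (slice (speed f)) => [X t Xr tab|I|j I Iab|j I Iab].
    + by rewrite /tangent_speed; ring.
    + by rewrite !tube_set_normals.
    + exact: (tube_sphere_sum (sep 1 s1) j Iab).
    + exact: (tube_sphere_sum (sep (-1) s2) j Iab).
rewrite /vol -/(cube_measure q.+2) -/(cube_measure q.+1).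
have := @cube_measure_gt0 R q.+1; have := @cube_measure_gt0 R q.+2.
rewrite -(fineK (@cube_measure_fin R q.+1)) -(fineK (@cube_measure_fin R q)).
set c2 := fine (cube_measure q.+2); set c1 := fine (cube_measure q.+1).
rewrite !lte_fin => c20 c10 e; rewrite !inver !gt_eqF //.
set T := hausdorff _ _ in e *; set S := hausdorff _ _ in e *.
have -> : T = (T * c1%:E * (c1^-1)%:E)%E by rewrite -muleA -EFinM divff ?mule1 // gt_eqF.
rewrite e muleAC -(muleA c2%:E) (muleAC c2%:E) -EFinM divff ?gt_eqF // mul1e.
by rewrite muleAC.
Qed.
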